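(* Let $L/K$ be a finite extension, let $r\geq 1$, and suppose that there is a uniform bound on the size of the torsion submodules $\phi^{\mathrm{Tors}}(L)$ as $\phi/L$ varies over Drinfeld $A$-modules of rank $r$. Then there is a constant $C$, depending only on $L$ and $r$, such that for every Drinfeld $A$-module $\phi/L$ of rank $r$ there is a non-torsion $x\in\phi(L)$ such that $$\hat{h}_\phi(x)\leq 2\max\{h(j_\phi),\ \deg(\mathscr{D}_{\phi/L})\}+C.$$
   Context: **Drinfeld modules.** $q$ is a prime power, $X/\mathbb{F}_q$ is a smooth projective geometrically irreducible curve, $K=\mathbb{F}_q(X)$, $\infty\in X(\mathbb{F}_q)$ is a fixed point, and $A\subseteq K$ is the ring of functions regular away from $\infty$. For nonzero $a\in A$, $|a|_\infty=\#(A/aA)$ and $\deg(a)$ is defined by $|a|_\infty=q^{\deg(a)}$. For a field $L$ with an injection $A\to L$ (here the inclusion $A\subseteq K\subseteq L$), a Drinfeld $A$-module $\phi/L$ is a ring homomorphism $A\to\mathrm{End}_L(\mathbb{G}_{\mathrm a})$, $a\mapsto\phi_a$ (additive polynomials over $L$ under composition), with $\phi_a(x)=ax+O(x^q)\in L[x]$ for all $a\in A$, and $\phi_a(x)\neq ax$ for at least some $a$. There is an integer $r\ge1$, the rank of $\phi$, with $\deg\phi_a=|a|_\infty^r$ for all nonzero $a$. $\phi(L)$ denotes $L$ with the $A$-module structure $a\cdot x=\phi_a(x)$, and $\phi^{\mathrm{Tors}}(L)$ its torsion submodule. Drinfeld modules $\phi,\psi$ over $L$ are $L$-isomorphic if there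 is $\alpha\in L^*$ with $\phi_a(\alpha x)=\alpha\psi_a(x)$ for all $a\in A$. Fix once and for all non-constant generators $T_1,\dots,T_m$ of $A$ as an $\mathbb{F}_q$-algebra, and write $\phi_{T_i}(x)=T_ix+\sum_{j=1}^{r\deg(T_i)}a_{i,j}x^{q^j}$. **Heights.** Logarithms are normalized so that $\log q=1$; $\log^+t=\max\{0,\log t\}$. $M_L$ is the set of places of $L$, with $\log|x|_v=-\deg(v)\,v(x)$ for the normalized valuation $v$ and $\deg(v)$ the degree of $v$ (over the constant field of $L$), so that $\sum_v\log|x|_v=0$ for $x\in L^*$. A place is finite if the elements of $A$ are $v$-integral, and infinite otherwise; $M_L^0$ is the set of finite places. The point $j_\phi$ is the point with coordinates $(a_{i,j})_{i,j}$ in the weighted projective space in which the $(i,j)$ coordinate has weight $q^j-1$, and $$h(j_\phi)=\sum_{v\in M_L}\max_{i,j}\frac{1}{q^j-1}\log|a_{i,j}|_v .$$ The canonical height is $\hat h_\phi(x)=\sum_{v\in M_L}G_{\phi,v}(x)$, where $G_{\phi,v}(x)=\lim_{N\to\infty}|T|_\infty^{-rN}\log^+|\phi_{T^N}(x)|_v$ for any non-constant $T\in A$ (independent of $T$). **Minimal discriminant.** For a place $v$, $c_v(\phi)=-\frac{1}{q^{r\deg(T)}-1}\log|\Delta_T|_v$, where $\Delta_T$ is the leading coefficient of $\phi_T$ ($T\in A$ non-constant; independent of $T$). For $v\in M_L^0$ with completion $L_v$ and valuation ring $\mathcal{O}_v$, an integral model of $\phi$ at $v$ is a Drinfeld module $\psi/L_v$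 that is $L_v$-isomorphic to $\phi$ with $\psi_a(x)\in\mathcal{O}_v[x]$ for all $a\in A$; $\mathscr{D}_{\phi,v}$ is the minimum of $c_v(\psi)$ over integral models $\psi$. Then $\mathscr{D}_{\phi/L}=\sum_{v\in M_L^0}\mathscr{D}_{\phi,v}[v]$ and $\deg(\mathscr{D}_{\phi/L})=\sum_{v\in M_L^0}\mathscr{D}_{\phi,v}$. $A$ (with its chosen generators) is fixed throughout, so constants may depend on it. *)

(* Defs.v *)
From HB Require Import structures.
From mathcomp Require Export all_boot all_order all_algebra all_field.
From mathcomp Require Export finmap.
From mathcomp Require Export all_classical all_reals all_analysis.
Export Order.TTheory GRing.Theory Num.Theory numFieldNormedType.Exports.

Set Implicit Arguments.
Unset Strict Implicit.
Unset Printing Implicit Defensive.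

Local Open Scope classical_set_scope.
Local Open Scope ring_scope.

(* Places are normalized discrete valuations.  The value at 0 stands for       *)
(* +oo but is coded as 0, so that a place is determined by its function;       *)
(* the definitions below treat x = 0 separately whenever this matters, and     *)
(* `0 <= v x' does express that x is v-integral, for every x.                  *)
Record place (F : fieldType) := Place {
  pval :> F -> int;
  pval0 : pval 0 = 0;
  pvalM : forall x y, x != 0 -> y != 0 -> pval (x * y) = pval x + pval y;
  pvalD : forall x y, x + y != 0 -> Num.min (pval x) (pval y) <= pval (x + y);
  pval_uniformizer : exists x, pval x = 1 }.

HB.instance Definition _ (F : fieldType) := gen_eqMixin (place F).
HB.instance Definition _ (F : fieldType) := gen_choiceMixin (place F).

Section Places.
Variable F : fieldType.

Definition pval_ge (v : place F) (N : int) (x : F) : bool :=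
  (x == 0) || (N <= v x).

(* The dimension over k of the residue field of v, for a subfield k of         *)
(* v-integral elements: the size d of a family b of v-integral elements whose  *)
(* residues form a k-basis of the residue field.                               *)
Definition is_residue_dim (k : set F) (v : place F) (d : nat) : Prop :=
  exists2 b : 'I_d -> F, (forall i, 0 <= v (b i)) &
    forall x, 0 <= v x ->
      exists! c : {ffun 'I_d -> F},
        (forall i, k (c i)) /\ pval_ge v 1 (x - \sum_i c i * b i).

Definition residue_dim (k : set F) (v : place F) : nat :=
  xget 0%N (is_residue_dim k v).

(* log|x|_v, for a place v of degree d, with values in [-oo, +oo[ *)
Definition logv (R : realType) (d : nat) (v : place F) (x : F) : \bar R :=
  if x == 0 then -oo%E else ((- (d%:Z * v x))%:~R)%:E.

Definition logv_plus (R : realType) (d : nat) (v : place F) (x : F) : R :=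
  fine (maxe 0%E (logv R d v x)).

Definition cauchy_seq (v : place F) (u : nat -> F) : Prop :=
  forall N : int, exists n0 : nat, forall i j : nat,
    (n0 <= i)%N -> (n0 <= j)%N -> pval_ge v N (u i - u j).

Definition converges_to (v : place F) (u : nat -> F) (l : F) : Prop :=
  forall N : int, exists n0 : nat, forall i : nat,
    (n0 <= i)%N -> pval_ge v N (u i - l).

End Places.

(* A completion of F at v; it is unique up to a unique isomorphism. *)
Record completion (F : fieldType) (v : place F) := Completion {
  cfield :> fieldType;
  cemb : {rmorphism F -> cfield};
  cplace : place cfield;
  cplaceE : forall x, cplace (cemb x) = v x;
  cemb_dense : forall (x : cfield) (N : int),
    exists y, pval_ge cplace N (x - cemb y);
  ccomplete : forall u : nat -> cfield,
    cauchy_seq cplace u -> exists l, converges_to cplace u l }.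

Definition constants (Fq F : fieldType) (iota : Fq -> F) : set F :=
  [set x | algebraicOver iota x].

(* K is the function field of a smooth projective geometrically irreducible    *)
(* curve over Fq: it is finite over Fq(t) for some t transcendental over Fq,   *)
(* and Fq is algebraically closed in K.  The closed points of the curve are    *)
(* the places of K.                                                            *)
Definition is_function_field (Fq K : fieldType) (iota : {rmorphism Fq -> K}) :=
  (exists t : K, ~ constants iota t /\
     exists (n : nat) (b : 'I_n -> K), forall x : K,
       exists (d : {poly Fq}) (c : 'I_n -> {poly Fq}), d != 0 /\
         (map_poly iota d).[t] * x = \sum_i (map_poly iota (c i)).[t] * b i) /\
  (forall x : K, constants iota x -> exists c : Fq, x = iota c).

Section RegularAway.
Variables (K : fieldType) (infty : place K).

Definition regular_away : {pred K} :=
  fun f => `[< forall v : place K, v <> infty -> 0 <= v f >].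

Lemma place1 (v : place K) : v 1 = 0.
Proof.
have := pvalM v (oner_neq0 K) (oner_neq0 K).
by rewrite mulr1 => /eqP; rewrite -subr_eq0 opprD addrA subrr sub0r oppr_eq0 => /eqP.
Qed.

Lemma placeN (v : place K) x : v (- x) = v x.
Proof.
have n10 : (-1 : K) != 0 by rewrite oppr_eq0 oner_neq0.
have vN1 : v (-1) = 0.
  have := pvalM v n10 n10; rewrite mulrNN mulr1 place1 -mulr2n => /esym/eqP.
  by rewrite mulrn_eq0 => /eqP.
have [->|x0] := eqVneq x 0; first by rewrite oppr0.
by rewrite -mulN1r (pvalM v n10 x0) vN1 add0r.
Qed.

Lemma regular_away_subring : subring_closed regular_away.
Proof.
split=> [|x y /asboolP xA /asboolP yA|x y /asboolP xA /asboolP yA];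
  apply/asboolP => v vi.
- by rewrite place1.
- have [->|xy0] := eqVneq (x - y) 0; first by rewrite pval0.
  apply: le_trans (pvalD v xy0).
  by rewrite le_min xA //= placeN yA.
- have [->|x0] := eqVneq x 0; first by rewrite mul0r pval0.
  have [->|y0] := eqVneq y 0; first by rewrite mulr0 pval0.
  by rewrite (pvalM v x0 y0) addr_ge0 ?xA ?yA.
Qed.

HB.instance Definition _ :=
  GRing.isSubringClosed.Build K regular_away regular_away_subring.

Record regring := Regring { regval :> K; _ : regval \in regular_away }.

HB.instance Definition _ := [isSub for regval].
HB.instance Definition _ := [Choice of regring by <:].
HB.instance Definition _ := [SubChoice_isSubComNzRing of regring by <:].

End RegularAway.

(* #(A / aA), counting the cosets b + aA *)
Definition normA (A : comNzRingType) (a : A) : nat :=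
  #|` fset_set [set [set b + a * c | c in [set: A]] | b in [set: A]]|.

(* In a ring A of functions on a curve over the field with q elements,         *)
(* #(A / aA) is a power of q for nonzero a.                                    *)
Definition degA (A : comNzRingType) (q : nat) (a : A) : nat :=
  trunc_log q (normA a).

(* P(X + Y) = P(X) + P(Y) in F[X, Y] *)
Definition additive_poly (F : fieldType) (P : {poly F}) : Prop :=
  poly_XaY P = P%:P + map_poly polyC P.

(* dphi_low says that phi_a(x) = gamma(a) x + O(x^q). *)
Record drinfeld (A : comNzRingType) (q : nat) (F : fieldType)
    (gamma : {rmorphism A -> F}) := Drinfeld {
  dphi :> A -> {poly F};
  dphi_additive : forall a, additive_poly (dphi a);
  dphi1 : dphi 1 = 'X;
  dphiD : forall a b, dphi (a + b) = dphi a + dphi b;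
  dphiM : forall a b, dphi (a * b) = dphi a \Po dphi b;
  dphi_low : forall a (i : nat), (i < q)%N ->
    (dphi a)`_i = if i == 1%N then gamma a else 0;
  dphi_nontrivial : exists a, dphi a != gamma a *: 'X }.

Definition has_rank (A : comNzRingType) (F : fieldType) (phi : A -> {poly F})
    (r : nat) : Prop :=
  forall a : A, a != 0 -> (size (phi a)).-1 = (normA a ^ r)%N.

Definition torsion (A : comNzRingType) (F : fieldType) (phi : A -> {poly F})
  : set F := [set x | exists2 a : A, a != 0 & (phi a).[x] = 0].

Definition isomorphic (A : comNzRingType) (F : fieldType)
    (phi psi : A -> {poly F}) : Prop :=
  exists2 alpha : F, alpha != 0 &
    forall a, phi a \Po (alpha *: 'X) = alpha *: psi a.

Section Heights.
Variables (R : realType) (Fq : finFieldType) (K : fieldType).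
Variables (iota : {rmorphism Fq -> K}) (infty : place K) (L : fieldExtType K).

Notation A := (regring infty).
Notation q := #|Fq|.

Definition nonconstant (T : A) : Prop := forall c : Fq, regval T <> iota c.

Definition generates (m : nat) (T : 'I_m -> A) : Prop :=
  forall S : {pred A}, subring_closed S ->
    (forall (c : Fq) (a : A), regval a = iota c -> a \in S) ->
    (forall i, T i \in S) -> forall a, a \in S.

Definition A_to_L : {rmorphism A -> L} := in_alg L \o \val.

(* degree over the constant field of L *)
Definition pdeg (v : place L) : nat :=
  residue_dim (constants (in_alg L \o iota)) v.

Definition finite_places : set (place L) :=
  [set v | forall a : A, 0 <= v (A_to_L a)].

Section Module.
Variables (r : nat) (phi : drinfeld q A_to_L).

(* The sums over places below are sums over finite supports in R: each family  *)
(* vanishes outside finitely many places.                                      *)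

(* h(j_phi), with (i, j) ranging over 0 <= i < m and 1 <= j <= r deg(T_i);     *)
(* the inner maximum is a real number, since some a_{i,j} is nonzero.          *)
Definition height_j (m : nat) (T : 'I_m -> A) : R :=
  \sum_(v \in [set: place L]) fine
    (\big[maxe/-oo]_(i < m) \big[maxe/-oo]_(1 <= j < (r * degA q (T i)).+1)
       (((q%:R ^+ j - 1)^-1)%:E * logv R (pdeg v) v (phi (T i))`_(q ^ j)))%E.

Definition local_height (T : A) (v : place L) (x : L) : R :=
  lim ((fun N : nat => (normA T)%:R ^- (r * N) *
          logv_plus R (pdeg v) v (phi (T ^+ N)).[x]) @ \oo).

Definition canonical_height (T : A) (x : L) : R :=
  \sum_(v \in [set: place L]) local_height T v x.

(* c_v(psi), for a place w of a field F that carries log|.|_w = -d w(.) *)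
Definition c_disc (F : fieldType) (d : nat) (w : place F) (T : A)
    (psi : A -> {poly F}) : R :=
  - (q%:R ^+ (r * degA q T) - 1)^-1 * fine (logv R d w (lead_coef (psi T))).

Section LocalDiscriminant.
Variables (v : place L) (Lv : completion v).

Definition A_to_Lv : {rmorphism A -> Lv} := cemb Lv \o A_to_L.

Definition integral_model (psi : drinfeld q A_to_Lv) : Prop :=
  isomorphic psi (fun a => map_poly (cemb Lv) (phi a)) /\
  forall a i, 0 <= cplace Lv (psi a)`_i.

Definition min_disc (T : A) : R :=
  let S := [set c_disc (pdeg v) (cplace Lv) T psi | psi in integral_model] in
  xget 0 [set c | S c /\ lbound S c].

End LocalDiscriminant.

Definition deg_min_disc (T : A) (Lv : forall v : place L, completion v) : R :=
  \sum_(v \in finite_places) min_disc (Lv v) T.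

End Module.
End Heights.

(* Main.v *)
From HB Require Import structures.
Require Import Defs.
From mathcomp Require Import zify ring lra.

(* Write lambda_v for the local term of h(j_phi) and c_v for c_v(phi).  At a
   finite place let n_v be the least n such that alpha^(k-1) a_k is integral
   for v(alpha) = n and for every coefficient a_k of every phi_{T_i}; then
   D_{phi,v} = c_v + deg(v) n_v, and a point x with v(x) >= n_v has local
   height 0.  At an infinite place, rescaling by alpha with
   log|alpha| = -lambda_v bounds the coefficients of phi_{T_i} by 1, so that
   the local height of x is at most log^+|x/alpha|_v + O(1).
   Let D be the divisor with D(v) = -n_v at the finite places and
   D(v) = c_v / deg(v), rounded up, at the infinite ones.  By the product
   formula the sum of c_v over all v is 0, so deg D >= -deg(D_phi); adding
   about deg(D_phi) + O(1) at one infinite place makes the Riemann-Roch space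
   L(D) larger than the torsion.  Since lambda_v + c_v >= 0 and these numbers
   add up to h(j_phi), the height of any point of L(D) is at most
   h(j_phi) + deg(D_phi) + O(1).
   The Riemann inequality and the product formula are obtained by counting
   elements: for x transcendental over Fq let n be the largest size of a family
   linearly independent over Fq(x); independence modulo x of elements with
   prescribed residues gives Q^deg(zeros of x) <= q^n (Q being the number of
   constants), while the combinations of a basis with coefficients of degree
   at most l in x give q^n <= Q^deg(poles of x). *)

Set Implicit Arguments.
Unset Strict Implicit.
Unset Printing Implicit Defensive.
Local Open Scope classical_set_scope.
Local Open Scope ring_scope.

(** * Places *)

(** The definitions provide places as bare functions, so every fact on curves (existence of poles,
    finiteness of the constant field, principal divisors, Riemann's inequality) is drawn from one
    algebraic input: for each x, a fixed number of elements of L is always dependent over Fq(x). The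
    other obstacle is uniformity in phi. At an infinite place the rescaling leaves only log^+|T_i|_v
    as an error, and constants that do depend on phi are tolerated only where the limit defining the
    local height removes them. Choosing D from c_v at the infinite places makes deg D computable by
    the product formula; the price at such a place is lambda_v + c_v up to rounding. As this number
    is nonnegative at every place, it also dominates a maximum with 0, and the finite places may be
    added to the sum although their local heights vanish. Torsion enters only through its
    cardinality: if B bounds it, L(D) has at least Q^B > B elements. The factor 2 is h + deg <= 2
    max(h, deg). *)

Section PlaceTheory.
Variable F : fieldType.
Implicit Types (v w : place F) (x y : F) (M N : int).

Lemma place_inj v w : pval v =1 pval w -> v = w.
Proof.
case: v w => [f f0 fM fD fu] [g g0 gM gD gu] /= /funext efg.
by subst g; congr Place; apply: Prop_irrelevance.
Qed.

Lemma pge0 v N : pval_ge v N 0.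
Proof. by rewrite /pval_ge eqxx. Qed.

Lemma pgeE v N x : x != 0 -> pval_ge v N x = (N <= v x).
Proof. by rewrite /pval_ge => /negbTE->. Qed.

Lemma pge_int v x : (0 <= v x) = pval_ge v 0 x.
Proof. by rewrite /pval_ge; case: eqVneq => // ->; rewrite pval0. Qed.

Lemma pge_val v x : pval_ge v (v x) x.
Proof. by rewrite /pval_ge lexx orbT. Qed.

Lemma pge_le v M N x : M <= N -> pval_ge v N x -> pval_ge v M x.
Proof. by move=> MN; rewrite /pval_ge; case: eqP => //= _; apply: le_trans. Qed.

Lemma pgeD v N x y : pval_ge v N x -> pval_ge v N y -> pval_ge v N (x + y).
Proof.
have [->|x0] := eqVneq x 0; first by rewrite add0r.
have [->|y0] := eqVneq y 0; first by rewrite addr0.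
rewrite (pgeE _ _ x0) (pgeE _ _ y0) => Nx Ny.
have [->|xy0] := eqVneq (x + y) 0; first exact: pge0.
by rewrite pgeE //; apply: le_trans _ (pvalD v xy0); rewrite le_min Nx.
Qed.

Lemma pgeN v N x : pval_ge v N (- x) = pval_ge v N x.
Proof. by rewrite /pval_ge oppr_eq0 placeN. Qed.

Lemma pgeB v N x y : pval_ge v N x -> pval_ge v N y -> pval_ge v N (x - y).
Proof. by move=> Nx Ny; apply: pgeD; rewrite // pgeN. Qed.

Lemma pge_sum (I : Type) (r : seq I) (P : pred I) (f : I -> F) v N :
  (forall i, P i -> pval_ge v N (f i)) ->
  pval_ge v N (\sum_(i <- r | P i) f i).
Proof. by move=> h; elim/big_ind: _ => // [|x y]; [apply: pge0|apply: pgeD]. Qed.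

Lemma pgeM v M N x y :
  pval_ge v M x -> pval_ge v N y -> pval_ge v (M + N) (x * y).
Proof.
have [->|x0] := eqVneq x 0; first by rewrite mul0r => *; apply: pge0.
have [->|y0] := eqVneq y 0; first by rewrite mulr0 => *; apply: pge0.
by rewrite !pgeE ?mulf_neq0 // pvalM // => *; apply: lerD.
Qed.

Lemma pvalV v x : v x^-1 = - v x.
Proof.
have [->|x0] := eqVneq x 0; first by rewrite invr0 pval0 oppr0.
apply/eqP; rewrite -addr_eq0 addrC -pvalM ?invr_eq0 //.
by rewrite divff // place1.
Qed.

Lemma pvalX v x n : v (x ^+ n) = n%:Z * v x.
Proof.
have [->|x0] := eqVneq x 0.
  by rewrite pval0 mulr0; case: n => [|n]; rewrite ?expr0 ?place1 // expr0n pval0.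
elim: n => [|n IH]; first by rewrite expr0 place1 mul0r.
by rewrite exprS pvalM ?expf_neq0 // IH; lia.
Qed.

Lemma pvalXz v x (n : int) : v (x ^ n) = n * v x.
Proof.
case: n => n; first by rewrite -exprnP pvalX.
by rewrite NegzE -exprz_inv -exprnP pvalX pvalV; lia.
Qed.

Lemma pval_dom v x y : x != 0 -> pval_ge v (v x + 1) y ->
  (x + y != 0) /\ v (x + y) = v x.
Proof.
move=> x0 yx.
have nz : x + y != 0.
  apply/eqP => xy0; have ey : y = - x by apply/eqP; rewrite -addr_eq0 addrC xy0.
  by move: yx; rewrite ey pgeN pgeE //; lia.
split=> //; apply/eqP; rewrite eq_le; apply/andP; split; last first.
  by rewrite -pgeE //; apply: pgeD; rewrite ?pge_val //; apply: pge_le yx; lia.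
rewrite leNgt; apply/negP => lt.
have : pval_ge v (v x + 1) (x + y - y).
  by apply: pgeB => //; rewrite pgeE //; lia.
by rewrite addrK pgeE //; lia.
Qed.

Lemma pge_unit v x : pval_ge v 1 (x - 1) -> x != 0 /\ v x = 0.
Proof.
move=> h; have := @pval_dom v 1 (x - 1) (oner_neq0 _).
by rewrite place1 add0r => /(_ h); rewrite addrC subrK.
Qed.

Lemma pval_uniform v n : exists2 x, x != 0 & v x = n.
Proof.
have [p vp] := pval_uniformizer v.
have p0 : p != 0 by apply/eqP => p0; move: vp; rewrite p0 pval0.
by exists (p ^ n); rewrite ?expfz_neq0 // pvalXz vp mulr1.
Qed.

(** An inclusion of valuation rings sends [v]-units to [w]-units, so [w] is [w p] times [v] for a
    uniformizer [p] of [v]; since [w] takes the value 1, the nonnegative integer [w p] is 1. *)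
Lemma place_sub_eq v w : (forall x, 0 <= v x -> 0 <= w x) -> v = w.
Proof.
move=> sub; have unit x : v x = 0 -> w x = 0.
  move=> vx; apply/eqP; rewrite eq_le sub ?vx // andbT.
  by rewrite -oppr_ge0 -pvalV sub // pvalV vx.
have [p p0 vp] := pval_uniform v 1.
have wE x : w x = v x * w p.
  have [->|x0] := eqVneq x 0; first by rewrite !pval0 mul0r.
  have pz : p ^ (- v x) != 0 by rewrite expfz_neq0.
  have := unit (x * p ^ (- v x)); rewrite !pvalM // !pvalXz vp mulr1 subrr.
  by move=> /(_ erefl); lia.
have wp : w p = 1.
  have [y _ wy] := pval_uniform w 1; have := wE y; rewrite wy.
  have : 0 <= w p by rewrite sub // vp.
  move=> h1 /esym h2; have wpn : (`|w p| %| 1)%N.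
    by have := congr1 absz h2; rewrite abszM absz1 => e; rewrite -[X in (_ %| X)%N]e dvdn_mull.
  by move: wpn; rewrite dvdn1 => /eqP; lia.
by apply: place_inj => x; rewrite wE wp mulr1.
Qed.

Lemma place_sep v w : v <> w -> exists2 x, 0 < v x & w x < 0.
Proof.
move=> vw.
have /existsNP[a /not_implyP[va /negP]] : ~ (forall x, 0 <= v x -> 0 <= w x).
  by move=> h; apply: vw; apply: place_sub_eq.
rewrite -ltNge => wa.
have /existsNP[b /not_implyP[wb /negP]] : ~ (forall x, 0 <= w x -> 0 <= v x).
  by move=> h; apply: vw; apply/esym; apply: place_sub_eq.
rewrite -ltNge => vb.
have a0 : a != 0 by apply/eqP => e; rewrite e pval0 in wa.
have b0 : b != 0 by apply/eqP => e; rewrite e pval0 in vb.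
by exists (a / b); rewrite pvalM ?invr_eq0 // pvalV; lia.
Qed.

Lemma place_sep_seq v (s : seq (place F)) : v \notin s ->
  exists2 x, 0 < v x & forall w, w \in s -> w x < 0.
Proof.
elim: s => [_|w s IH]; first by have [x _ vx] := pval_uniform v 1; exists x; rewrite ?vx.
rewrite inE negb_or => /andP[/eqP vw /IH[u vu su]].
have [wu|wu] := ltP (w u) 0.
  by exists u => // w'; rewrite inE => /orP[/eqP->//|/su].
have [y vy wy] := place_sep vw.
have u0 : u != 0 by apply/eqP => e; rewrite e pval0 in vu.
have y0 : y != 0 by apply/eqP => e; rewrite e pval0 in vy.
(* The exponent exceeds every |w'(u)|, so [w' (y ^+ r)] never equals the negative number [w' u], and
   [u + y ^+ r] takes the smaller of the two valuations. *)
pose r := (\sum_(w' <- s) `|w' u|).+1.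
have yr0 : y ^+ r != 0 by rewrite expf_neq0.
have ru w' : w' \in s -> (`|w' u| < r)%N.
  move=> w's; rewrite ltnS; elim: s {IH su r yr0} w's => // w0 s IH.
  by rewrite inE big_cons => /orP[/eqP<-|/IH]; lia.
have key w' : w' u != w' (y ^+ r) -> w' u < 0 \/ w' (y ^+ r) < 0 ->
    w' (u + y ^+ r) < 0.
  move=> neq h; have [lt|ge] := ltP (w' u) (w' (y ^+ r)).
    have [|_ ->] := @pval_dom w' u (y ^+ r) u0; last by lia.
    by rewrite pgeE //; lia.
  have [|_] := @pval_dom w' (y ^+ r) u yr0; first by rewrite pgeE //; lia.
  by rewrite addrC => ->; lia.
have wyr : w (u + y ^+ r) < 0.
  by apply: key; rewrite ?pvalX; [apply/eqP|right]; nia.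
have uy0 : u + y ^+ r != 0 by apply/eqP => e; rewrite e pval0 in wyr.
exists (u + y ^+ r) => [|w'].
  have vyr : 0 < v (y ^+ r) by rewrite pvalX; nia.
  have h : pval_ge v 1 (u + y ^+ r) by apply: pgeD; rewrite pgeE.
  by rewrite pgeE // in h.
rewrite inE => /orP[/eqP->//|w's].
apply: key; last by left; exact: su.
have /= := ru _ w's; have := su _ w's; rewrite pvalX => h1 h2; apply/eqP => e.
have [] : w' y = 0 \/ 1 <= `|w' y| by lia.
  by move=> h; rewrite h mulr0 in e; lia.
by move=> h; nia.
Qed.

(** For [u] with a zero at [v] and poles on [s], the element [1 / (1 + u)] is close to 1 at [v] and
    vanishes on [s]. *)
Lemma weak_approx v (s : seq (place F)) : v \notin s ->
  exists2 e, pval_ge v 1 (e - 1) & forall w, w \in s -> 0 < w e.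
Proof.
move=> /place_sep_seq[u vu su]; have u0 : u != 0.
  by apply/eqP => e; rewrite e pval0 in vu.
have [|nz vz] := @pval_dom v 1 u (oner_neq0 _).
  by rewrite place1 add0r pgeE.
exists (1 + u)^-1 => [|w ws].
  have -> : (1 + u)^-1 - 1 = - (u / (1 + u)).
    by field.
  by rewrite pgeN pgeE ?mulf_neq0 ?invr_eq0 // pvalM ?invr_eq0 // pvalV vz place1; lia.
have wu := su _ ws; have [|_] := @pval_dom w u 1 u0.
  by rewrite pgeE ?oner_neq0 // place1; lia.
by rewrite pvalV addrC => ->; lia.
Qed.
End PlaceTheory.

(** * Linear algebra over subfields *)

Section QuotientBases.
Variable F : fieldType.

Definition subfield_set (k : set F) :=
  [/\ k 1, forall x y, k x -> k y -> k (x - y), forall x y, k x -> k y -> k (x * y)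
    & forall x, k x -> k x^-1].

Definition subspace_set (k V : set F) :=
  [/\ V 0, forall x y, V x -> V y -> V (x - y)
    & forall a x, k a -> V x -> V (a * x)].

Definition dependent_mod (k V W : set F) (n : nat) :=
  forall w : 'I_n -> F, (forall i, V (w i)) ->
    exists c : 'I_n -> F, [/\ forall i, k (c i), exists i, c i != 0
      & W (\sum_i c i * w i)].

Definition is_basis_mod (k V W : set F) (d : nat) (b : 'I_d -> F) :=
  (forall i, V (b i)) /\ forall x, V x ->
    exists! c : {ffun 'I_d -> F}, (forall i, k (c i)) /\ W (x - \sum_i c i * b i).

Lemma subspaceN k V x : subspace_set k V -> V x -> V (- x).
Proof. by move=> [V0 VB _] /(VB _ _ V0); rewrite sub0r. Qed.

Lemma subspaceD k V x y : subspace_set k V -> V x -> V y -> V (x + y).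
Proof.
move=> sV Vx Vy; have [_ VB _] := sV.
by rewrite -[y]opprK; apply: VB => //; apply: subspaceN sV Vy.
Qed.

Lemma subspace_sum k V (I : Type) (r : seq I) (P : pred I) (f : I -> F) :
  subspace_set k V -> (forall i, P i -> V (f i)) -> V (\sum_(i <- r | P i) f i).
Proof.
move=> sV Vf; elim/big_ind: _ => //; first by have [] := sV.
by move=> x y; apply: subspaceD sV.
Qed.

Lemma subfield_subspace k : subfield_set k -> subspace_set k k.
Proof. by case=> k1 kB kM kV; split=> //; rewrite -(subrr 1); apply: kB. Qed.

(** An independent family of the largest size spans: adjoining [x] makes it dependent, and the
    coefficient of [x] cannot vanish. That size is one less than the least size at which
    independence fails. *)
Lemma exists_basis_mod k V W n :
  subfield_set k -> subspace_set k V -> subspace_set k W ->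
  dependent_mod k V W n.+1 ->
  exists d, (d <= n)%N /\ exists b : 'I_d -> F, is_basis_mod k V W b.
Proof.
move=> kf sV sW dep; have sk := subfield_subspace kf; have [k1 kB kM kV] := kf.
pose P d := exists b : 'I_d -> F, (forall i, V (b i)) /\
  forall c, (forall i, k (c i)) -> W (\sum_i c i * b i) -> forall i, c i = 0.
have exP : exists d, `[< ~ P d >].
  exists n.+1; apply/asboolP => -[b [Vb ind]].
  by have [c [kc [i /eqP ci] Wc]] := dep b Vb; apply: ci; apply: ind.
case: (ex_minnP exP) => -[|d] /asboolP nP minP.
  by exfalso; apply: nP; exists (fun=> 0); split; [case|move=> c _ _ []].
have /minP : `[< ~ P n.+1 >].
  apply/asboolP => -[b [Vb ind]].
  by have [c [kc [i /eqP ci] Wc]] := dep b Vb; apply: ci; apply: ind.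
rewrite ltnS => dn; exists d; split=> //.
have /contrapT[b [Vb ind]] : ~ ~ P d.
  by move=> h; have /minP := introT (asboolP _) h; rewrite ltnn.
exists b; split=> // x Vx.
pose w (i : 'I_d.+1) := oapp b x (unlift ord0 i).
have Vw i : V (w i) by rewrite /w; case: unlift => //= j; apply: Vb.
have sumw (c : 'I_d.+1 -> F) : \sum_i c i * w i =
    c ord0 * x + \sum_(i < d) c (lift ord0 i) * b i.
  rewrite big_ord_recl /w unlift_none /=; congr (_ + _).
  by apply: eq_bigr => i _; rewrite liftK.
have [c [kc Wc [i0 /eqP ci0]]] : exists c : 'I_d.+1 -> F,
    [/\ forall i, k (c i), W (\sum_i c i * w i) & exists i, c i <> 0].
  apply: contrapT => h; apply: nP; exists w; split=> // c kc Wc i.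
  by apply: contrapT => ci; apply: h; exists c; split=> //; exists i.
rewrite sumw in Wc; have c0 : c ord0 != 0.
  apply/eqP => c0; rewrite c0 mul0r add0r in Wc.
  have h := ind (fun i => c (lift ord0 i)) (fun i => kc _) Wc.
  by case: (unliftP ord0 i0) ci0 => [j|] ->; rewrite ?h ?c0 eqxx.
pose e := [ffun i => - (c ord0)^-1 * c (lift ord0 i)].
have ke i : k (e i).
  by rewrite ffunE; apply: kM; rewrite // ; apply: subspaceN sk _; apply: kV.
have We : W (x - \sum_i e i * b i).
  have [_ _ WM] := sW; have := WM _ _ (kV _ (kc ord0)) Wc.
  rewrite mulrDr mulKf // mulr_sumr -sumrN.
  congr (W (_ + _)); apply: eq_bigr => i _.
  by rewrite ffunE !mulNr opprK mulrA.
exists e; split=> // f [kf' Wf]; apply/ffunP => i; apply/eqP.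
rewrite -subr_eq0; apply/eqP.
apply: (ind (fun i => e i - f i)) => [j|]; first by apply: kB.
have [_ WB _] := sW; have := WB _ _ Wf We; congr W.
rewrite opprB addrC subrKA -sumrB; apply: eq_bigr => j _; by rewrite mulrBl.
Qed.

(** A transversal of [V] modulo [W]; cardinalities of quotients are compared through such lists, and
    no quotient is formed. *)
Definition is_reps (V W : set F) (s : seq F) :=
  [/\ uniq s, forall r, r \in s -> V r,
      forall x, V x -> exists2 r, r \in s & W (x - r)
    & forall r r', r \in s -> r' \in s -> W (r - r') -> r = r'].

Lemma basis_reps k V W d (b : 'I_d -> F) ks :
  subfield_set k -> subspace_set k V -> subspace_set k W ->
  uniq ks -> (forall x, k x <-> x \in ks) -> is_basis_mod k V W b ->
  exists2 s, is_reps V W s & size s = (size ks ^ d)%N.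
Proof.
move=> kf sV sW uks kE [Vb exb].
pose val (c : {ffun 'I_d -> seq_sub ks}) := \sum_i ssval (c i) * b i.
have kc (c : {ffun 'I_d -> seq_sub ks}) i : k (ssval (c i)).
  by apply/kE; apply: ssvalP.
have Vval c : V (val c).
  by apply: (subspace_sum _ sV) => i _; have [_ _ VM] := sV; apply: VM.
have inj c c' : W (val c - val c') -> c = c'.
  move=> Wcc; have [e [_ eP]] := exb _ (Vval c).
  have E1 : e = [ffun i => ssval (c i)].
    apply: eP; split=> [i|]; first by rewrite ffunE.
    under eq_bigr do rewrite ffunE.
    by rewrite subrr; have [] := sW.
  have E2 : e = [ffun i => ssval (c' i)].
    apply: eP; split=> [i|]; first by rewrite ffunE.
    by under eq_bigr do rewrite ffunE.
  apply/ffunP => i; apply: val_inj; move: E1; rewrite E2 => /ffunP/(_ i).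
  by rewrite !ffunE.
exists [seq val c | c <- enum {: {ffun 'I_d -> seq_sub ks}}]; last first.
  by rewrite size_map -cardE card_ffun card_ord card_seq_sub.
split.
- rewrite map_inj_uniq ?enum_uniq // => c c' e; apply: inj.
  by rewrite e subrr; have [] := sW.
- by move=> _ /mapP[c _ ->].
- move=> x /exb[c [[kc' Wc] _]].
  exists (val [ffun i => SeqSub (proj1 (kE _) (kc' i))]).
    by apply/mapP; eexists; first exact: mem_enum.
  by rewrite /val; under eq_bigr do rewrite ffunE /=.
- by move=> _ _ /mapP[c _ ->] /mapP[c' _ ->] /inj->.
Qed.

Lemma reps_count k V W s s' : subspace_set k W -> is_reps V W s -> uniq s' ->
  (forall r, r \in s' -> V r) ->
  (forall r r', r \in s' -> r' \in s' -> W (r - r') -> r = r') ->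
  (size s' <= size s)%N.
Proof.
move=> sW [us Vs exs inj] us' Vs' inj'.
have exf x : exists r, x \in s' -> r \in s /\ W (x - r).
  have [xs'|] := boolP (x \in s'); last by exists 0.
  by have [r rs Wr] := exs _ (Vs' _ xs'); exists r.
have [f fP] := choice exf.
rewrite -(size_map f); apply: uniq_leq_size.
  rewrite map_inj_in_uniq // => x y xs ys e; apply: inj' => //.
  have [[_ Wx] [_ Wy]] := (fP _ xs, fP _ ys).
  have [_ WB _] := sW; have := WB _ _ Wx Wy.
  by rewrite e opprB addrA subrK.
by move=> _ /mapP[x xs ->]; have [] := fP _ xs.
Qed.
End QuotientBases.

Lemma exists_left_kernel (E : fieldType) (I J : finType) (A : I -> J -> E) :
  (#|J| < #|I|)%N ->
  exists c : I -> E, (exists i, c i != 0) /\ forall j, \sum_i c i * A i j = 0.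
Proof.
move=> ltJI; pose M := \matrix_(i < #|I|, j < #|J|) A (enum_val i) (enum_val j).
have : kermx M != 0.
  by rewrite -mxrank_eq0 mxrank_ker -lt0n subn_gt0 (leq_ltn_trans (rank_leq_col _)).
case/rowV0Pn => u /sub_kermxP uM u0.
exists (fun i => u 0 (enum_rank i)); split.
  have /existsNP[i /eqP ui] : ~ (forall i, u 0 i = 0).
    by move=> h; case/eqP: u0; apply/rowP => i; rewrite h mxE.
  by exists (enum_val i); rewrite enum_valK.
move=> j; have := congr1 (fun B : 'rV_ _ => B 0 (enum_rank j)) uM.
rewrite !mxE => e; rewrite -[RHS]e (reindex (@enum_val I predT)) /=; last first.
  by exists enum_rank => i _; rewrite ?enum_valK ?enum_rankK.
by apply: eq_bigr => i _; rewrite mxE enum_valK enum_rankK.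
Qed.

(** * Linear dependence over the field generated by one element *)

Section FiniteDim.
Variables (Fq F : fieldType) (iota : {rmorphism Fq -> F}).

Definition peval (x : F) (p : {poly Fq}) : F := (map_poly iota p).[x].

Lemma pevalE x p : peval x p = \sum_(i < size p) iota p`_i * x ^+ i.
Proof. by rewrite /peval horner_poly. Qed.

Lemma peval_is_zmod x : zmod_morphism (peval x).
Proof. by move=> p q; rewrite /peval rmorphB hornerD hornerN. Qed.
Lemma peval_is_monoid x : monoid_morphism (peval x).
Proof.
by split=> [|p q]; rewrite /peval ?rmorph1 ?hornerC // rmorphM hornerM.
Qed.
HB.instance Definition _ x :=
  GRing.isZmodMorphism.Build {poly Fq} F (peval x) (peval_is_zmod x).
HB.instance Definition _ x :=
  GRing.isMonoidMorphism.Build {poly Fq} F (peval x) (peval_is_monoid x).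

Lemma pevalC x c : peval x c%:P = iota c.
Proof. by rewrite /peval map_polyC hornerC. Qed.

Lemma pevalX x : peval x 'X = x.
Proof. by rewrite /peval map_polyX hornerX. Qed.

(* N elements of F are linearly dependent over iota(Fq)(x) *)
Definition poly_dependent (x : F) (N : nat) :=
  forall w : 'I_N -> F, exists c : 'I_N -> {poly Fq},
    (exists i, c i != 0) /\ \sum_i peval x (c i) * w i = 0.

(** Once the common powers of x are divided out of a relation over Fq[x], some constant term is
    nonzero, and the constant terms form a relation over Fq modulo x. All upper bounds on residue
    fields and on zeros rest on this. *)
Lemma poly_dependent_mod x N (w : 'I_N -> F) : x != 0 -> poly_dependent x N ->
  exists (a : 'I_N -> Fq) (g : 'I_N -> {poly Fq}), (exists i, a i != 0) /\
    \sum_i iota (a i) * w i = x * \sum_i peval x (g i) * w i.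
Proof.
move=> x0 /(_ w) [c [cn0 cw]].
have [n le_n] : exists n, forall i, (size (c i) <= n)%N.
  by exists (\max_i size (c i))%N => i; exact: leq_bigmax.
elim: n c cn0 cw le_n => [|n IH] c [i0 ci0] cw le_n.
  by have := le_n i0; rewrite leqn0 size_poly_eq0 (negbTE ci0).
have cE i : c i = drop_poly 1 (c i) * 'X + ((c i)`_0)%:P.
  rewrite -[in LHS](poly_take_drop 1 (c i)) expr1 addrC; congr (_ + _).
  by apply/polyP => -[|j]; rewrite coef_take_poly coefC.
have [[i ai]|/forallNP h] := pselect (exists i, (c i)`_0 != 0).
  exists (fun i => (c i)`_0), (fun i => - drop_poly 1 (c i)).
  split; first by exists i.
  apply/eqP; rewrite -subr_eq0 mulr_sumr -sumrB; apply/eqP; rewrite -[RHS]cw; apply: eq_bigr => j _.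
  by rewrite [in RHS](cE j) rmorphD rmorphM /= pevalX pevalC rmorphN /=; ring.
have h0 i : (c i)`_0 = 0 by apply/eqP; apply/negPn/negP; apply: h.
apply: (IH (fun i => drop_poly 1 (c i))).
- exists i0; apply: contraNneq ci0 => e.
  by rewrite (cE i0) e h0 mul0r add0r polyC0.
- apply/(mulfI x0); rewrite mulr0 -[in RHS]cw mulr_sumr; apply: eq_bigr => i _.
  by rewrite [in RHS](cE i) h0 addr0 rmorphM /= pevalX; ring.
- by move=> i; rewrite size_drop_poly leq_subLR.
Qed.

Variables (t : F) (t_tr : forall p, peval t p = 0 -> p = 0).
Variables (n : nat) (b : 'I_n -> F).
Hypothesis b_span : forall x, exists (d : {poly Fq}) (c : 'I_n -> {poly Fq}),
  d != 0 /\ peval t d * x = \sum_i peval t (c i) * b i.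

Lemma common_denominator m (y : 'I_m -> F) :
  exists (d : {poly Fq}) (c : 'I_m -> 'I_n -> {poly Fq}), d != 0 /\
    forall k, peval t d * y k = \sum_i peval t (c k i) * b i.
Proof.
have [d dP] := choice (fun k => b_span (y k)).
have [c cP] := choice dP.
exists (\prod_k d k), (fun k i => (\prod_(l | l != k) d l) * c k i); split.
  by apply/prodf_neq0 => k _; have [] := cP k.
move=> k; have [_ e] := cP k; rewrite (bigD1 k) //= rmorphM /=.
rewrite mulrAC e mulr_suml; apply: eq_bigr => i _.
by rewrite rmorphM /=; ring.
Qed.

(** Coefficients of size at most I + 1 in x are sought by solving a linear system over Fq: after
    multiplication by [d ^+ I * om], the elements x^i w_k have coordinates of size at most sW + I s
    in t. *)
Lemma exists_poly_dependent x : exists N, poly_dependent x N.+1.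
Proof.
have [d [P [d0 dP]]] := common_denominator (fun i => x * b i).
pose s := maxn (size d) (\max_i \max_j size (P i j)).
exists (n * s)%N => w; have [om [W [om0 oW]]] := common_denominator w.
pose sW := (\max_i \max_j size (W i j))%N.
(* With this I the (I + 1)(n s + 1) unknowns outnumber the n (sW + I s) equations by n s + 1. *)
pose I := (n * sW)%N.
pose V := fix V (i : nat) k j : {poly Fq} :=
  if i is i'.+1 then \sum_l V i' k l * P l j else W k j.
have sV i k j : (size (V i k j) <= sW + i * s)%N.
  elim: i j => [|i IH] j /=.
    by rewrite addn0; apply: leq_trans (leq_bigmax k); apply: leq_trans (leq_bigmax j).
  apply: (big_ind (fun p : {poly Fq} => (size p <= sW + i.+1 * s)%N)) => [|p q|l _].
  - by rewrite size_poly0.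
  - by move=> hp hq; rewrite (leq_trans (size_polyD _ _)) // geq_max hp.
  apply: (leq_trans (size_polyMleq _ _)).
  have : (size (P l j) <= s)%N.
    rewrite leq_max; apply/orP; right.
    by apply: leq_trans (leq_bigmax l); apply: leq_trans (leq_bigmax j).
  by have := IH l; lia.
have eV i k : peval t (d ^+ i * om) * (x ^+ i * w k) = \sum_j peval t (V i k j) * b j.
  elim: i => [|i IH]; first by rewrite !expr0 !mul1r oW.
  rewrite !exprS; have -> : peval t (d * d ^+ i * om) * (x * x ^+ i * w k) =
     peval t d * x * (peval t (d ^+ i * om) * (x ^+ i * w k)).
    by rewrite !rmorphM /=; ring.
  rewrite IH mulr_sumr /=.
  transitivity (\sum_l \sum_j peval t (V i k l) * (peval t (P l j) * b j)).
    apply: eq_bigr => l _; rewrite -mulr_sumr -dP; ring.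
  rewrite exchange_big; apply: eq_bigr => j _ /=.
  by rewrite rmorph_sum mulr_suml; apply: eq_bigr => l _; rewrite rmorphM mulrA.
pose U i k j := d ^+ (I - i) * V i k j.
have sU (i : 'I_I.+1) k j : (size (U i k j) <= sW + I * s)%N.
  have : (size (d ^+ (I - i)%N) <= ((I - i) * s).+1)%N.
    apply: (leq_trans (size_poly_exp_leq _ _)); rewrite ltnS mulnC leq_mul2l.
    by apply/orP; right; apply: leq_trans (leq_pred _) (leq_maxl _ _).
  have := sV i k j; have := size_polyMleq (d ^+ (I - i)) (V i k j).
  rewrite -/(U i k j).
  have : ((I - i) * s + i * s = I * s)%N by rewrite -mulnDl subnK // -ltnS.
  lia.
have [|c [[[i0 k0] c0] cU]] := @exists_left_kernel Fq ('I_I.+1 * 'I_(n * s).+1)%type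
   ('I_n * 'I_(sW + I * s))%type (fun ik jl => (U ik.1 ik.2 jl.1)`_jl.2).
  by rewrite !card_prod !card_ord /I; nia.
pose q k := \poly_(i < I.+1) c (inord i, k).
exists q; split.
  exists k0; apply: contraNneq c0 => /polyP/(_ i0).
  by rewrite coef_poly ltn_ord inord_val coef0 => ->.
have dI : peval t (d ^+ I * om) != 0.
  apply/eqP => /t_tr /eqP; rewrite mulf_eq0 (negbTE om0) orbF.
  by rewrite expf_eq0 (negbTE d0) andbF.
apply: (mulfI dI); rewrite mulr0 mulr_sumr.
transitivity (\sum_k \sum_(i < I.+1) \sum_j iota (c (i, k)) * peval t (U i k j) * b j).
  apply: eq_bigr => k _; rewrite /q poly_def rmorph_sum mulr_suml mulr_sumr.
  apply: eq_bigr => i _; rewrite inord_val -mul_polyC rmorphM rmorphXn /=.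
  rewrite pevalC pevalX.
  have -> : peval t (d ^+ I * om) * (iota (c (i, k)) * x ^+ i * w k) =
      iota (c (i, k)) * peval t (d ^+ (I - i)) * (peval t (d ^+ i * om) * (x ^+ i * w k)).
    have -> : d ^+ I = d ^+ (I - i) * d ^+ i by rewrite -exprD subnK // -ltnS.
    by rewrite !rmorphM /=; ring.
  rewrite eV mulr_sumr; apply: eq_bigr => j _.
  by rewrite /U rmorphM /=; ring.
rewrite exchange_big pair_big /=.
rewrite exchange_big /=; apply: big1 => j _; rewrite -mulr_suml.
suff -> : \sum_p iota (c (p.1, p.2)) * peval t (U p.1 p.2 j) = 0 by rewrite mul0r.
transitivity (peval t (\sum_p (c p) *: U p.1 p.2 j)).
  rewrite rmorph_sum; apply: eq_bigr => -[i k] _ /=.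
  by rewrite -mul_polyC [in RHS]rmorphM /= pevalC.
suff -> : \sum_p (c p) *: U p.1 p.2 j = 0 by rewrite rmorph0.
apply/polyP => l; rewrite coef0 coef_sum.
have [ltl|gel] := ltnP l (sW + I * s)%N.
  by rewrite -[RHS](cU (j, Ordinal ltl)); apply: eq_bigr => p _; rewrite coefZ.
apply: big1 => p _; rewrite coefZ nth_default ?mulr0 //.
exact: leq_trans gel.
Qed.
End FiniteDim.

(** * Existence of poles *)

Section ValuationRings.
Variables (Fq F : fieldType) (iota : {rmorphism Fq -> F}).

Definition subalg_set (A : set F) :=
  [/\ forall c, A (iota c), forall a b, A a -> A b -> A (a - b)
    & forall a b, A a -> A b -> A (a * b)].

Section Closure.
Variables (A : set F) (sA : subalg_set A).

Lemma subalgC c : A (iota c). Proof. by case: sA. Qed.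
Lemma subalgB a b : A a -> A b -> A (a - b). Proof. by case: sA => _ + _; apply. Qed.
Lemma subalgM a b : A a -> A b -> A (a * b). Proof. by case: sA => _ _; apply. Qed.
Lemma subalg0 : A 0. Proof. by rewrite -(rmorph0 iota); apply: subalgC. Qed.
Lemma subalg1 : A 1. Proof. by rewrite -(rmorph1 iota); apply: subalgC. Qed.
Lemma subalgD a b : A a -> A b -> A (a + b).
Proof.
by move=> Aa Ab; rewrite -[b]opprK -[- b]sub0r; do 2?apply: subalgB; rewrite //; exact: subalg0.
Qed.
Lemma subalgX a n : A a -> A (a ^+ n).
Proof.
by move=> Aa; elim: n => [|n IH]; rewrite ?exprS; [exact: subalg1|exact: subalgM].
Qed.
Lemma subalg_sum (I : Type) (r : seq I) (P : pred I) (f : I -> F) :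
  (forall i, P i -> A (f i)) -> A (\sum_(i <- r | P i) f i).
Proof. by move=> Af; elim/big_ind: _ => //; [exact: subalg0|exact: subalgD]. Qed.
Lemma subalg_peval x p : A x -> A (peval iota x p).
Proof.
move=> Ax; rewrite pevalE; apply: subalg_sum => i _.
by apply: subalgM; [exact: subalgC|exact: subalgX].
Qed.
End Closure.

Variable y : F.
Hypothesis y_tr : forall p, peval iota y p = 0 -> p = 0.

Let y0 : y != 0.
Proof.
apply/eqP => y0; have := @y_tr 'X; rewrite pevalX y0 => /(_ erefl)/eqP.
by rewrite polyX_eq0.
Qed.

Let good A := [/\ subalg_set A, A y & ~ A y^-1].

Lemma exists_maximal_subalg :
  exists A, good A /\ forall B, good B -> A `<=` B -> B `<=` A.
Proof.
pose P (A : set F) := A = set0 \/ good A.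
have goodS : good [set peval iota y p | p in setT].
  split; first split.
  - by move=> c; exists c%:P; rewrite ?pevalC.
  - by move=> _ _ [p _ <-] [q _ <-]; exists (p - q); rewrite ?rmorphB.
  - by move=> _ _ [p _ <-] [q _ <-]; exists (p * q); rewrite ?rmorphM.
  - by exists 'X; rewrite ?pevalX.
  - case=> p _ e; have := @y_tr ('X * p - 1).
    rewrite rmorphB rmorphM rmorph1 /= pevalX e divff // subrr => /(_ erefl)/eqP.
    rewrite subr_eq0 => /eqP e1; have := congr1 (fun q : {poly Fq} => q`_0) e1.
    by rewrite coefXM coef1 /= => /esym/eqP; rewrite oner_eq0.
have [C CP totC|A [[A0|gA] maxA]] := @Zorn_bigcup F P.
- have [h|/existsNP[X0 /not_implyP[CX0 X0n0]]] := pselect (forall X, C X -> X = set0).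
    by left; rewrite -subset0 => x [X CX]; rewrite (h X CX).
  have gC X : C X -> X !=set0 -> good X.
    by move=> CX [x Xx]; case: (CP _ CX) => // e; rewrite e in Xx.
  have [|sX0 X0y X0y'] := gC _ CX0; first by apply/set0P/eqP.
  have both a b : (\bigcup_(X in C) X) a -> (\bigcup_(X in C) X) b ->
      exists X, [/\ C X, subalg_set X, X a & X b].
    move=> [X CX Xa] [Z CZ Zb].
    have [XZ|ZX] := totC _ _ CX CZ.
      exists Z; split; rewrite //; [|exact: XZ].
      by have [] := gC _ CZ (ex_intro _ _ Zb).
    exists X; split; rewrite //; [|exact: ZX].
    by have [] := gC _ CX (ex_intro _ _ Xa).
  right; split; first split.
  - by move=> c; exists X0 => //; apply: subalgC.
  - by move=> a b /both h/h[X [CX sX Xa Xb]]; exists X => //; apply: subalgB.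
  - by move=> a b /both h/h[X [CX sX Xa Xb]]; exists X => //; apply: subalgM.
  - by exists X0.
  - by move=> [X CX Xy]; have [] := gC _ CX (ex_intro _ _ Xy).
- case: (maxA [set peval iota y p | p in setT]); last by right.
  rewrite A0; split; first exact: sub0set.
  by move=> /(_ y); apply; exists 'X; rewrite ?pevalX.
- exists A; split=> // B gB AB; apply: contrapT => nBA.
  by apply: (maxA B); [split|right].
Qed.

Section Maximal.
Variables (A : set F) (gA : good A).
Hypothesis maxA : forall B, good B -> A `<=` B -> B `<=` A.
Let sA : subalg_set A. Proof. by case: gA. Qed.

Let coefs (p : {poly F}) := forall i, A (y^-1 * p`_i).

(** By maximality, adjoining [z] puts 1/y in the ring; multiplying by y writes 1 as a polynomial in
    [z] with coefficients in yA. *)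
Let adjoin z : ~ A z -> exists p, coefs p /\ p.[z] = 1.
Proof.
move=> Az; pose B := [set p.[z] | p in [set p : {poly F} | forall i, A p`_i]].
have sB : subalg_set B.
  split.
  - move=> c; exists (iota c)%:P; rewrite ?hornerC //= => i; rewrite coefC.
    by case: ifP => _; [exact: subalgC|exact: subalg0].
  - move=> _ _ [p Ap <-] [q Aq <-]; exists (p - q); rewrite ?hornerD ?hornerN //=.
    by move=> i; rewrite coefB; apply: subalgB.
  - move=> _ _ [p Ap <-] [q Aq <-]; exists (p * q); rewrite ?hornerM //= => i.
    by rewrite coefM; apply: subalg_sum => // j _; apply: subalgM.
have AB : A `<=` B.
  move=> a Aa; exists a%:P; rewrite ?hornerC //= => i; rewrite coefC.
  by case: ifP => _ //; exact: subalg0.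
have Bz : B z.
  exists 'X; rewrite ?hornerX //= => i; rewrite coefX.
  by case: eqP => _; [exact: subalg1|exact: subalg0].
have [p Ap e] : B y^-1.
  apply: contrapT => nBy; apply: Az; apply: (maxA _ AB) => //.
  by split=> //; apply: AB; case: gA.
exists (y *: p); split=> [i|]; first by rewrite coefZ mulKf.
by rewrite hornerZ e divff.
Qed.

(** Chevalley's descent: the relation of smaller degree lowers the degree of the other one, until a
    constant relation puts 1/y in A. The bound [N] on the sum of the degrees carries the
    induction. *)
Let adjoin_absurd N z n m p q : z != 0 -> (n + m <= N)%N ->
  coefs p -> p.[z] = 1 -> (size p <= n.+1)%N ->
  coefs q -> q.[z^-1] = 1 -> (size q <= m.+1)%N -> False.
Proof.
elim: N z n m p q => [|N IH] z n m p q z0 nm cp pz sp cq qz sq.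
  have n0 : n = 0%N by lia.
  rewrite n0 in sp; move: pz; rewrite (size1_polyC sp) hornerC => p1.
  by have := cp 0%N; rewrite p1 mulr1; case: gA.
wlog mn : z n m p q z0 nm cp pz sp cq qz sq / (m <= n)%N.
  move=> h; have [mn|/ltnW nm'] := leqP m n; first exact: (h z n m p q).
  by apply: (h z^-1 m n q p); rewrite ?invrK ?invr_eq0 // addnC.
case: n => [|n] in nm sp mn *.
  move: pz; rewrite (size1_polyC sp) hornerC => p1.
  by have := cp 0%N; rewrite p1 mulr1; case: gA.
(* The relation p(z) = 1 is multiplied by 1 - q_0 and q_0 is added; the top power is then eliminated
   through (1 - q_0) z^(n+1) = sum of q_(i+1) z^(n-i), which is q(1/z) = 1 multiplied by z^(n+1). *)
pose p' := (q`_0)%:P + (1 - q`_0) *: take_poly n.+1 p +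
  p`_n.+1 *: \sum_(i < m) q`_i.+1 *: 'X^(n - i).
have Ay : A y by case: gA.
have Ac r i : coefs r -> A r`_i.
  by move=> /(_ i)/(subalgM sA Ay); rewrite mulVKf.
apply: (IH z n m p' q) => //.
- move=> i; rewrite !coefD !coefZ coefC coef_take_poly.
  rewrite !mulrDr; apply: subalgD => //; first apply: subalgD => //.
  + by case: ifP => _; rewrite ?mulr0; [apply: cq|apply: subalg0].
  + rewrite mulrCA; apply: subalgM => //.
      by apply: subalgB; rewrite //; [apply: subalg1|apply: Ac].
    by case: ifP => _; rewrite ?mulr0; [apply: cp|apply: subalg0].
  + rewrite mulrCA; apply: subalgM => //; first exact: Ac.
    rewrite coef_sum mulr_sumr; apply: subalg_sum => // j _.
    rewrite coefZ coefXn mulrA; apply: subalgM => //.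
    by case: eqP => _; [apply: subalg1|apply: subalg0].
- rewrite !hornerD !hornerZ hornerC horner_sum.
  have E1 : (take_poly n.+1 p).[z] = 1 - p`_n.+1 * z ^+ n.+1.
    rewrite -pz -[in p.[z]](poly_take_drop n.+1 p) hornerD hornerM hornerXn.
    have -> : drop_poly n.+1 p = (p`_n.+1)%:P.
      apply/polyP => i; rewrite coef_drop_poly coefC; case: eqP => [->//|/eqP i0].
      by rewrite nth_default //; apply: leq_trans sp _; lia.
    by rewrite hornerC addrK.
  have E2 : \sum_(i < m) (q`_i.+1 *: 'X^(n - i)).[z] = z ^+ n.+1 * (1 - q`_0).
    rewrite -qz (horner_coef_wide _ sq) big_ord_recl expr0 mulr1 addrC addKr.
    rewrite mulr_sumr; apply: eq_bigr => i _.
    rewrite hornerZ hornerXn exprVn lift0 mulrCA; congr (_ * _).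
    have im : (i <= n)%N by have := ltn_ord i; lia.
    by rewrite -expfB_cond ?subSS // (negbTE z0) add0n.
  by rewrite E1 E2; ring.
- rewrite (leq_trans (size_polyD _ _)) // geq_max; apply/andP; split.
    rewrite (leq_trans (size_polyD _ _)) // geq_max.
    rewrite (leq_trans (size_polyC_leq1 _)) //=.
    by rewrite (leq_trans (size_scale_leq _ _)) // size_take_poly.
  rewrite (leq_trans (size_scale_leq _ _)) //.
  apply: (leq_trans (size_sum _ _ _)); apply/bigmax_leqP => i _.
  rewrite (leq_trans (size_scale_leq _ _)) // size_polyXn ltnS.
  exact: leq_subr.
Qed.

Lemma maximal_valuation_ring z : A z \/ A z^-1.
Proof.
have [->|z0] := eqVneq z 0; first by left; apply: subalg0.
have [Az|/adjoin[p [cp pz]]] := pselect (A z); first by left.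
right; apply: contrapT => /adjoin[q [cq qz]].
by apply: (adjoin_absurd z0 (leqnn _) cp pz (leqnSn _) cq qz (leqnSn _)).
Qed.
End Maximal.
End ValuationRings.

(** * Discreteness of the valuation ring *)

Section DiscreteValuation.
Variables (Fq F : fieldType) (iota : {rmorphism Fq -> F}).
Hypothesis fdep : forall x, exists N, poly_dependent iota x N.+1.
Variables (A : set F) (sA : subalg_set iota A).
Hypothesis vA : forall z, A z \/ A z^-1.

Let U z := [/\ z != 0, A z & A z^-1].
Let m z := z = 0 \/ (A z /\ ~ A z^-1).

Let mA z : m z -> A z. Proof. by case=> [->|[]//]; apply: (subalg0 sA). Qed.

Let mM a z : A a -> m z -> m (a * z).
Proof.
move=> Aa [->|[Az Az']]; first by rewrite mulr0; left.
have [->|a0] := eqVneq a 0; first by rewrite mul0r; left.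
right; split; first exact: (subalgM sA).
move=> h; apply: Az'; have := subalgM sA Aa h.
by rewrite invfM mulrA divff // mul1r.
Qed.

Let mD_aux u w : w != 0 -> m w -> A (u / w) -> m (u + w).
Proof.
move=> w0 [/eqP|[Aw Aw'] Auw]; first by rewrite (negbTE w0).
have e : u + w = (u / w + 1) * w by rewrite mulrDl mul1r divfK.
have A1 : A (u / w + 1) by apply: (subalgD sA) => //; apply: (subalg1 sA).
by rewrite e; apply: mM => //; right.
Qed.

Let mD u w : m u -> m w -> m (u + w).
Proof.
move=> mu mw.
have [->|w0] := eqVneq w 0; first by rewrite addr0.
have [->|u0] := eqVneq u 0; first by rewrite add0r.
have [h|] := vA (u / w); first exact: mD_aux.
by rewrite invf_div addrC => h; apply: mD_aux.
Qed.

Let m_sum (I : Type) (r : seq I) (P : pred I) (f : I -> F) :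
  (forall i, P i -> m (f i)) -> m (\sum_(i <- r | P i) f i).
Proof. by move=> Am; elim/big_ind: _ => //; left. Qed.

Let mNU z : m z -> U z -> False.
Proof. by case=> [->|[Az Az']] [] //; rewrite eqxx. Qed.

Let UC c : c != 0 -> U (iota c).
Proof.
move=> c0; split; rewrite ?fmorph_eq0 //; first exact: (subalgC sA).
by rewrite -fmorphV; apply: (subalgC sA).
Qed.

Let nmP z : z != 0 -> ~ m z -> A z^-1.
Proof.
move=> z0 nmz; case: (vA z) => // Az; apply: contrapT => h.
by apply: nmz; right.
Qed.

(* The ratios s i / s j being in the maximal ideal, such a chain is linearly
   independent over the field generated by x. *)
Let chain_absurd N x (s : 'I_N.+1 -> F) : poly_dependent iota x N.+1 ->
  x != 0 -> m x -> (forall i, s i != 0) -> (forall i, m (s i)) ->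
  (forall i, A (x / s i)) -> (forall i j : 'I_N.+1, (i < j)%N -> m (s i / s j)) ->
  False.
Proof.
move=> dep x0 mx s0 ms Axs mss.
have [a [g [[i0 ai0] e]]] := poly_dependent_mod s x0 dep.
(* After division by [s j], for the last nonzero coefficient [a j], all other terms lie in the
   maximal ideal, whereas [iota (a j)] is a unit. *)
have [j aj maxj] := @arg_maxnP _ i0 (fun i => a i != 0) (fun i : 'I_N.+1 => val i) ai0.
apply: (@mNU (iota (a j))); last exact: UC.
have -> : iota (a j) = - \sum_(i < N.+1 | (i < j)%N) iota (a i) * (s i / s j) +
    (x / s j) * \sum_i peval iota x (g i) * s i.
  apply: (mulIf (s0 j)).
  have -> (S : F) : (S + x / s j * \sum_i peval iota x (g i) * s i) * s j =
      S * s j + \sum_i iota (a i) * s i.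
    by rewrite e; field.
  apply/eqP; rewrite mulNr mulr_suml addrC eq_sym subr_eq; apply/eqP.
  rewrite [LHS](bigD1 j) //=; congr (_ + _).
  rewrite big_mkcond [RHS]big_mkcond /=; apply: eq_bigr => i _.
  case: (ltngtP i j) => ij.
  - have -> : i != j by apply: contraTneq ij => ->; rewrite ltnn.
    by rewrite -mulrA divfK.
  - case: eqVneq => // _; have [->|/maxj] := eqVneq (a i) 0.
      by rewrite rmorph0 mul0r.
    by rewrite /= leqNgt ij.
  - by have /val_inj-> := ij; rewrite eqxx.
apply: mD.
  rewrite -sumrN; apply: m_sum => i ij; rewrite -mulNr.
  by apply: mM; [rewrite -rmorphN; apply: (subalgC sA)|apply: mss].
apply: mM => //; apply: m_sum => i _; apply: mM => //.
by apply: (subalg_peval sA); apply: mA.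
Qed.

Variable y : F.
Hypothesis (y0 : y != 0) (Ay : A y) (Ay' : ~ A y^-1).

(** Chains starting at [y] whose successive ratios lie in the maximal ideal have bounded length. The
    last term [p] of a longest one generates that ideal, since a [z] in it with [p / z] in it would
    prolong the chain. *)
Let exists_uniformizer : exists2 p, p != 0 /\ m p &
  forall z, z != 0 -> m z -> A (z / p).
Proof.
have my : m y by right.
pose P n := exists s : nat -> F, [/\ s 0%N = y, forall i, (i <= n)%N -> s i != 0,
  forall i, (i <= n)%N -> m (s i) & forall i, (i < n)%N -> m (s i / s i.+1)].
have chain (s : nat -> F) n : [/\ s 0%N = y, forall i, (i <= n)%N -> s i != 0,
  forall i, (i <= n)%N -> m (s i) & forall i, (i < n)%N -> m (s i / s i.+1)] ->
  forall i j, (i < j)%N -> (j <= n)%N -> m (s i / s j).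
  move=> [_ s0 ms mss] i; elim=> // j IH; rewrite ltnS leq_eqVlt => /orP[/eqP->|ij] jn.
    exact: mss.
  have -> : s i / s j.+1 = s i / s j * (s j / s j.+1).
    by rewrite mulrA divfK // s0 // ltnW.
  by apply: mM; [apply/mA/IH => //; apply: ltnW|apply: mss].
have [N dep] := fdep y.
have nPN : ~ P N.
  move=> [s sP]; have [s_0 s0 ms mss] := sP.
  apply: (@chain_absurd N y (fun i : 'I_N.+1 => s i)) => //.
  - by move=> i; rewrite s0 // -ltnS.
  - by move=> i; apply: ms; rewrite -ltnS.
  - move=> [[|i] iN] /=; first by rewrite s_0 divff //; apply: (subalg1 sA).
    by rewrite -s_0; apply/mA/(chain _ _ sP).
  - by move=> i j ij; apply: (chain _ _ sP); rewrite // -ltnS.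
have exP : exists n, `[< ~ P n >] by exists N; apply/asboolP.
case: (ex_minnP exP) => -[|n] /asboolP nP minP.
  by exfalso; apply: nP; exists (fun=> y).
have /contrapT[s sP] : ~ ~ P n.
  by move=> h; have /minP := introT (asboolP _) h; rewrite ltnn.
have [s_0 s0 ms mss] := sP.
exists (s n) => [|z z0 mz]; first by split; [apply: s0|apply: ms].
rewrite -[_ / _]invrK invf_div; apply: nmP; first by rewrite mulf_neq0 ?invr_eq0 ?s0.
move=> mz'; apply: nP; exists (fun i => if (i <= n)%N then s i else z).
split=> //=; first by move=> i _; case: leqP => // /s0.
- by move=> i _; case: leqP => // /ms.
- move=> i iSn; have [->|ne] := eqVneq i n; first by rewrite leqnn ltnn.
  have iltn : (i < n)%N by rewrite ltn_neqAle ne.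
  by rewrite iltn (ltnW iltn); apply: mss.
Qed.

Lemma exists_place_of_ring : exists v : place F, v y > 0.
Proof.
have [p [p0 mp] pP] := exists_uniformizer.
have Ap : A p by apply: mA.
have pX0 k : p ^+ k != 0 by rewrite expf_neq0.
have mpX k : m (p ^+ k.+1) by rewrite exprSr; apply: mM => //; apply: (subalgX sA).
(* Otherwise every power of [p] divides [z], and z, p^N, ..., p is a chain of the excluded length N
   + 1. *)
have dec z : z != 0 -> A z -> exists k, U (z / p ^+ k).
  move=> z0 Az; apply: contrapT => /forallNP nU.
  have step k : A (z / p ^+ k) -> m (z / p ^+ k).
    move=> h; apply: contrapT => nm; apply: (nU k); split=> //.
      by rewrite mulf_neq0 ?invr_eq0.
    by apply: nmP => //; rewrite mulf_neq0 ?invr_eq0.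
  have mk k : m (z / p ^+ k).
    elim: k => [|k IH]; first by apply: step; rewrite expr0 divr1.
    apply: step; rewrite exprS invfM mulrCA mulrC.
    by apply: pP => //; rewrite mulf_neq0 ?invr_eq0.
  have mz : m z by have := mk 0%N; rewrite expr0 divr1.
  have [N dep] := fdep z.
  apply: (@chain_absurd N z (fun i : 'I_N.+1 => if i == 0%N :> nat then z
                                               else p ^+ (N.+1 - i))) => //.
  - by move=> i; case: ifP.
  - move=> i; case: ifP => // i0; have -> : (N.+1 - i = (N - i).+1)%N.
      by rewrite subSn // -ltnS.
    exact: mpX.
  - move=> i; case: ifP => _; last exact: mA.
    by rewrite divff //; apply: (subalg1 sA).
  - move=> i j ij; have -> /= : (j == 0%N :> nat) = false by apply/eqP; lia.
    case: ifP => _; first exact: mk.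
    have jN : (j <= N)%N by rewrite -ltnS.
    have -> : p ^+ (N.+1 - i) / p ^+ (N.+1 - j) = p ^+ (j - i).-1.+1.
      rewrite -expfB_cond ?(negbTE p0); last by lia.
      by congr (_ ^+ _); lia.
    exact: mpX.
have UM a b : U a -> U b -> U (a * b).
  move=> [a0 Aa Aa'] [b0 Ab Ab']; split; rewrite ?mulf_neq0 //.
    exact: (subalgM sA).
  by rewrite invfM; apply: (subalgM sA).
have UV a : U a -> U a^-1.
  by move=> [a0 Aa Aa']; split; rewrite ?invr_eq0 ?invrK.
have decz z : exists k : int, z != 0 -> U (z / p ^ k).
  have [->|z0] := eqVneq z 0; first by exists 0.
  case: (vA z) => Az; first by have [k Uk] := dec _ z0 Az; exists k.
  have [|k Uk] := dec z^-1 _ Az; first by rewrite invr_eq0.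
  exists (- k%:Z) => _; have := UV _ Uk.
  by rewrite invf_div invrK -invr_expz -exprnP invrK mulrC.
have [f fP] := choice decz.
pose val z := if z == 0 then 0 else f z.
have pz k : p ^ k != 0 by rewrite expfz_neq0.
have Upos k : U (p ^ k) -> k = 0.
  case: k => [[|k]|k] // Uk; first by case: (mNU (mpX k)).
  rewrite NegzE -invr_expz -exprnP in Uk; have := UV _ Uk; rewrite invrK => h.
  by case: (mNU (mpX k)).
have valU z k : z != 0 -> U (z / p ^ k) -> val z = k.
  move=> z0 Uk; rewrite /val (negbTE z0); apply/eqP; rewrite -subr_eq0.
  apply/eqP/Upos; have := UM _ _ Uk (UV _ (fP _ z0)).
  rewrite invf_div expfzDr // -invr_expz; congr U.
  by field; rewrite z0 !pz.
have Uval z : z != 0 -> U (z / p ^ (val z)).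
  by move=> z0; rewrite /val (negbTE z0); apply: fP.
have Ak (k : int) : 0 <= k -> A (p ^ k).
  by case: k => // k _; rewrite -exprnP; apply: (subalgX sA).
have Aval z k : z != 0 -> A (z / p ^ k) <-> k <= val z.
  move=> z0; have [_ Az Az'] := Uval z z0; split=> [Ak'|kz].
    rewrite leNgt; apply/negP => lt.
    have h : m (p ^ (k - val z)).
      have -> : k - val z = (absz (k - val z)).-1.+1 by lia.
      exact: mpX.
    have := mM (subalgM sA Ak' Az') h.
    have -> : z / p ^ k * (z / p ^ val z)^-1 * p ^ (k - val z) = 1.
      by rewrite expfzDr // -invr_expz invf_div; field; rewrite z0 !pz.
    case=> [/eqP|[_]]; first by rewrite oner_eq0.
    by rewrite invr1; apply; apply: (subalg1 sA).
  have -> : z / p ^ k = (z / p ^ val z) * p ^ (val z - k).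
    by rewrite expfzDr // -invr_expz; field; rewrite !pz.
  by apply: (subalgM sA) => //; apply: Ak; rewrite subr_ge0.
have v0 : val 0 = 0 by rewrite /val eqxx.
have vM a b : a != 0 -> b != 0 -> val (a * b) = val a + val b.
  move=> a0 b0; apply: valU; rewrite ?mulf_neq0 //.
  have -> : a * b / p ^ (val a + val b) = (a / p ^ val a) * (b / p ^ val b).
    by rewrite expfzDr //; field; rewrite !pz.
  by apply: UM; apply: Uval.
have vD a b : a + b != 0 -> Num.min (val a) (val b) <= val (a + b).
  move=> ab0; have [->|a0] := eqVneq a 0; first by rewrite add0r ge_min lexx orbT.
  have [->|b0] := eqVneq b 0; first by rewrite addr0 ge_min lexx.
  apply/Aval => //; rewrite mulrDl; apply: (subalgD sA); apply/Aval => //.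
    by rewrite ge_min lexx.
  by rewrite ge_min lexx orbT.
have vp : exists z, val z = 1.
  exists p; apply: valU => //; rewrite -exprnP expr1 divff //.
  by split; rewrite ?oner_neq0 ?invr1 //; apply: (subalg1 sA).
exists (Place v0 vM vD vp) => /=; rewrite lt_neqAle; apply/andP; split; last first.
  by apply/Aval; rewrite // expr0z divr1.
apply/eqP => vy; apply: Ay'; have := Uval _ y0.
by rewrite -vy expr0z divr1 => -[].
Qed.
End DiscreteValuation.

Section Poles.
Variables (Fq F : fieldType) (iota : {rmorphism Fq -> F}).
Hypothesis fdep : forall x, exists N, poly_dependent iota x N.+1.

Lemma exists_zero y : ~ constants iota y -> exists v : place F, 0 < v y.
Proof.
move=> y_tr.
have ty p : peval iota y p = 0 -> p = 0.
  move=> e; apply/eqP/negPn/negP => p0; apply: y_tr; exists p => //.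
  by apply/rootP.
have y0 : y != 0.
  by apply/eqP => y0; apply: y_tr; rewrite y0; apply: algebraic0.
have [A [[sA Ay Ay'] maxA]] := exists_maximal_subalg ty.
apply: (exists_place_of_ring fdep sA) => // z.
by apply: (@maximal_valuation_ring _ _ iota y ty A) => //; split.
Qed.

Lemma exists_pole x : ~ constants iota x -> exists v : place F, v x < 0.
Proof.
move=> x_tr; have [|v] := @exists_zero x^-1.
  by move=> /algebraic_inv; rewrite invrK.
by rewrite pvalV oppr_gt0; exists v.
Qed.
End Poles.

(** * Residue fields and zeros *)

Lemma bounded_finite_set (T : choiceType) (A : set T) N :
  (forall s : seq T, uniq s -> (forall x, x \in s -> A x) -> (size s <= N)%N) ->
  finite_set A.
Proof.
move=> bd; apply: contrapT => /(@infinite_set_fset _ _ N.+1)[B BA].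
by rewrite leqNgt ltnS bd // => x; apply: BA.
Qed.

Section Residues.
Variables (Fq : finFieldType) (F : fieldType) (iota : {rmorphism Fq -> F}).
Local Notation q := #|Fq|.
Local Notation k := (constants iota).
Let kq : set F := [set iota c | c in setT].

Lemma constants_subfield : subfield_set k.
Proof.
split; [exact: algebraic1|by move=> x y; apply: algebraic_sub
  |by move=> x y; apply: algebraic_mul|by move=> x; apply: algebraic_inv].
Qed.

Lemma image_subfield : subfield_set kq.
Proof.
split; first by exists 1; rewrite ?rmorph1.
- by move=> _ _ [c _ <-] [d _ <-]; exists (c - d); rewrite ?rmorphB.
- by move=> _ _ [c _ <-] [d _ <-]; exists (c * d); rewrite ?rmorphM.
- by move=> _ [c _ <-]; exists c^-1; rewrite ?fmorphV.
Qed.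

Lemma image_constants : kq `<=` k.
Proof. by move=> _ [c _ <-]; apply: algebraic_id. Qed.

Let image_seq x : kq x <-> x \in [seq iota c | c <- enum Fq].
Proof.
split=> [[c _ <-]|/mapP[c _ ->]]; last by exists c.
by apply/mapP; exists c; rewrite ?mem_enum.
Qed.

Let uniq_image : uniq [seq iota c | c <- enum Fq].
Proof. by rewrite map_inj_uniq ?enum_uniq //; apply: fmorph_inj. Qed.

Let size_image : size [seq iota c | c <- enum Fq] = q.
Proof. by rewrite size_map -cardE. Qed.

Lemma card_field_gt1 : (1 < q)%N. Proof. exact: finNzRing_gt1. Qed.

Lemma pval_iota (v : place F) c : v (iota c) = 0.
Proof.
have e : v (iota c) = q%:Z * v (iota c).
  by rewrite -pvalX -rmorphXn /= expf_card.
by have := card_field_gt1; move: e; nia.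
Qed.

Lemma pval_peval_pole (v : place F) x p : v x < 0 -> p != 0 ->
  peval iota x p != 0 /\ v (peval iota x p) = (size p).-1%:Z * v x.
Proof.
move=> vx; have x0 : x != 0 by apply/eqP => e; rewrite e pval0 in vx.
elim/poly_ind: p => [|p c IH]; first by rewrite eqxx.
rewrite size_MXaddC rmorphD rmorphM /= pevalX pevalC.
have [->|p0] := eqVneq p 0.
  rewrite !mul0r !add0r rmorph0 mul0r add0r size_poly0 /= polyC_eq0 => c0.
  by rewrite fmorph_eq0 c0 pval_iota (negbTE c0) mul0r.
have [pe0 ve] := IH p0; move=> _ /=.
have px0 : peval iota x p * x != 0 by rewrite mulf_neq0.
have vpx : v (peval iota x p * x) = (size p)%:Z * v x.
  rewrite pvalM // ve -[in RHS](prednK (n := size p)); first by lia.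
  by rewrite lt0n size_poly_eq0.
have [|h1 h2] := @pval_dom _ v _ (iota c) px0; last by rewrite h1 h2 vpx.
have sp : (0 < size p)%N by rewrite lt0n size_poly_eq0.
by rewrite /pval_ge pval_iota vpx; apply/orP; right; nia.
Qed.

Lemma pge0_peval (v : place F) x p : 0 <= v x -> 0 <= v (peval iota x p).
Proof.
move=> vx; rewrite pge_int pevalE; apply: pge_sum => i _.
by rewrite -[0]addr0; apply: pgeM; rewrite -pge_int ?pval_iota // pvalX; nia.
Qed.

(** A nonzero polynomial in an element with a pole at [v] has a pole of known order or is a unit
    there, hence is not 0; so an algebraic element has no pole, and neither has its inverse. *)
Lemma pval_constant (v : place F) c : k c -> v c = 0.
Proof.
have ge0 a : k a -> 0 <= v a.
  move=> [p p0 /rootP pa]; rewrite leNgt; apply/negP => /pval_peval_pole.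
  by move=> /(_ p p0)[]; rewrite [peval _ _ _]pa eqxx.
move=> kc; have := ge0 _ (algebraic_inv kc); have := ge0 _ kc.
by rewrite pvalV; lia.
Qed.

Section Valuation.
Variable v : place F.
Definition vring : set F := [set z | 0 <= v z].
Definition vmax : set F := [set z | pval_ge v 1 z].

Lemma vring_subspace : subspace_set k vring.
Proof.
rewrite /vring; split=> [|x y|a x ka] /=; rewrite ?pge_int ?pge0 //.
  exact: pgeB.
by move=> px; rewrite -[0]addr0; apply: pgeM; rewrite // -pge_int pval_constant.
Qed.

Lemma vmax_subspace : subspace_set k vmax.
Proof.
rewrite /vmax; split=> [|x y|a x ka] /=; rewrite ?pge0 //.
  exact: pgeB.
by move=> px; rewrite -[1]add0r; apply: pgeM; rewrite // -pge_int pval_constant.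
Qed.
End Valuation.

Hypothesis fdep : forall x, exists N, poly_dependent iota x N.+1.

(** A relation modulo a uniformizer is a relation in the residue field. *)
Let vring_dependent v : exists N, dependent_mod kq (vring v) (vmax v) N.+1.
Proof.
have [x x0 vx] := pval_uniform v 1; have [N dep] := fdep x.
exists N => w Vw; have [a [g [[i ai] e]]] := poly_dependent_mod w x0 dep.
exists (fun i => iota (a i)); split; first by move=> j; exists (a j).
  by exists i; rewrite fmorph_eq0.
rewrite e /vmax /= -[1]addr0; apply: pgeM; first by rewrite -vx pge_val.
apply: pge_sum => j _; rewrite -[0]addr0; apply: pgeM; rewrite -pge_int.
  by apply: pge0_peval; rewrite vx.
exact: Vw.
Qed.

Definition place_degree (v : place F) := residue_dim k v.

Lemma residue_dimP v : is_residue_dim k v (place_degree v).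
Proof.
rewrite /place_degree /residue_dim; apply: xgetPex; have [N dep] := vring_dependent v.
have [|d [_ [b [Vb bP]]]] := @exists_basis_mod _ k (vring v) (vmax v) N
  constants_subfield (vring_subspace v) (vmax_subspace v).
  move=> w Vw; have [c [kc c0 Wc]] := dep w Vw.
  by exists c; split=> // i; apply: image_constants.
by exists d, b.
Qed.

Variables (t : F) (t_tr : ~ k t).

(** Nonzero constants have valuation 0, so the constants embed in the residue field of any place;
    the transcendental [t] guarantees that a place exists. *)
Lemma constants_finite : finite_set k.
Proof.
have [v _] := exists_zero fdep t_tr; have [N dep] := vring_dependent v.
have s0 : subspace_set kq [set 0 : F].
  split=> // [_ _ -> ->|a _ _ ->]; [exact: subrr|exact: mulr0].
have sk : subspace_set kq k.
  have [k1 kB kM _] := constants_subfield; split=> //; first exact: algebraic0.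
  by move=> a x /image_constants; apply: kM.
have [|d [_ [b bP]]] := @exists_basis_mod _ kq k [set 0] N image_subfield sk s0.
  move=> w kw; have [|c [kc c0 Wc]] := dep w.
    by move=> i; rewrite /vring /= pval_constant.
  exists c; split=> //; have ks : k (\sum_i c i * w i).
    by apply: (subspace_sum _ sk) => i _; have [_ _] := sk; apply.
  apply/eqP; move: Wc; rewrite /vmax /pval_ge /= pval_constant //.
  by case: eqP.
have [s [us sk' exs _] _] := basis_reps image_subfield sk s0 uniq_image image_seq bP.
apply/finite_seqP; exists s; apply/seteqP; split=> [x /exs[r rs]|x xs] /=.
  by move/eqP; rewrite subr_eq0 => /eqP->.
exact: sk'.
Qed.

Definition card_constants : nat := #|` fset_set k|.

Lemma card_constants_gt1 : (1 < card_constants)%N.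
Proof.
rewrite /card_constants -[2%N]/(size [:: 0; 1 : F]); apply: uniq_leq_size.
  by rewrite /= inE eq_sym oner_neq0.
move=> x; rewrite in_fset_set ?inE; last exact: constants_finite.
move=> /orP[]/eqP->; rewrite /=; [exact: algebraic0|exact: algebraic1].
Qed.

Lemma residue_reps v : exists2 s, is_reps (vring v) (vmax v) s &
  size s = (card_constants ^ place_degree v)%N.
Proof.
have [b Vb bP] := residue_dimP v.
apply: (basis_reps constants_subfield (vring_subspace v) (vmax_subspace v)
  (fset_uniq _) _ (conj Vb bP)).
by move=> x; rewrite in_fset_set ?inE //; apply: constants_finite.
Qed.

Lemma place_degree_gt0 v : (0 < place_degree v)%N.
Proof.
have [s sP ss] := residue_reps v.
have := @reps_count _ _ _ _ _ [:: 0; 1 : F] (vmax_subspace v) sP.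
rewrite /= inE eq_sym oner_neq0 => /(_ erefl).
rewrite ss; case: place_degree => // h; rewrite expn0 in h; exfalso.
suff : (1 < 1)%N by []; apply: h.
  by move=> r; rewrite !inE => /orP[]/eqP->; rewrite /vring /= ?pval0 ?place1.
have h1 : ~ vmax v 1 by rewrite /vmax /= pgeE ?oner_neq0 // place1.
move=> r r'; rewrite !inE => /orP[]/eqP-> /orP[]/eqP->; rewrite ?subr0 ?sub0r //.
by rewrite /vmax /= pgeN => /h1.
Qed.

(* An effective divisor is the list of its places, with multiplicities. *)
Definition ddeg (s : seq (place F)) : nat := (\sum_(v <- s) place_degree v)%N.

(** The Chinese remainder theorem in counting form. One more copy of [v] replaces each r by the
    elements r + c h, where c runs over residues at [v] and h vanishes at [v] to exactly the order
    already reached, and at least to the required order at the rest of [base]. *)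
Lemma exists_incongruent (base s : seq (place F)) : {subset s <= base} ->
  exists R : seq F, [/\ uniq R, size R = (card_constants ^ ddeg s)%N,
    forall r v, r \in R -> v \in base -> 0 <= v r
  & forall r r', r \in R -> r' \in R ->
      (forall v, v \in base -> pval_ge v (count_mem v s)%:Z (r - r')) -> r = r'].
Proof.
elim: s => [|v s IH] sub.
  exists [:: 0]; split=> //; first by rewrite /ddeg big_nil.
    by move=> r w; rewrite inE => /eqP->; rewrite pval0.
  by move=> r r'; rewrite !inE => /eqP-> /eqP->.
have vb : v \in base by apply: sub; rewrite inE eqxx.
have [|R [uR sR intR incR]] := IH.
  by move=> w ws; apply: sub; rewrite inE ws orbT.
have [C [uC vC _ incC] sC] := residue_reps v.
pose e := count_mem v s.
pose B := (\sum_(w <- base) \sum_(c <- C) `|w c| + \sum_(w <- base) count_mem w s)%N.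
have [u u0 vu] := pval_uniform v e%:Z.
have [|ep ep1 epw] := @weak_approx _ v [seq w <- base | w != v].
  by rewrite mem_filter eqxx.
have [ep0 vep] := pge_unit ep1.
(* The factor [ep] is 1 modulo [v], so [v h = e]. It vanishes at the other places of [base], where
   the exponent outweighs the poles of [u] and of the c and supplies the multiplicities in [s]. *)
pose h := ep ^+ (B + \sum_(w <- base) `|w u|)%N * u.
have h0 : h != 0 by rewrite mulf_neq0 ?expf_neq0.
have vh : v h = e by rewrite pvalM ?expf_neq0 // pvalX vep mulr0 add0r vu.
have sumle (T : eqType) (l : seq T) (g : T -> nat) x : x \in l -> (g x <= \sum_(y <- l) g y)%N.
  elim: l => // y l IHl; rewrite inE big_cons => /orP[/eqP->|/IHl h1].
    exact: leq_addr.
  exact: leq_trans h1 (leq_addl _ _).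
have wh w c : w \in base -> c \in C -> pval_ge w (count_mem w s)%:Z (c * h).
  move=> wb cC; have [->|c0] := eqVneq c 0; first by rewrite mul0r pge0.
  rewrite pgeE; last exact: mulf_neq0.
  rewrite pvalM //; have [->|wv] := eqVneq w v.
    by rewrite vh /e; have := vC _ cC; rewrite /vring /= => hc; rewrite lerDr.
  rewrite pvalM ?expf_neq0 // pvalX.
  have we : 0 < w ep by apply: epw; rewrite mem_filter wv.
  have h1 := sumle _ base (fun w : place F => `|w u|%N) _ wb.
  have h2 := sumle _ base (fun w : place F => count_mem w s) _ wb.
  have h3 := sumle _ base (fun w : place F => \sum_(c <- C) `|w c|)%N _ wb.
  have h4 := sumle _ C (fun c => `|w c|%N) _ cC.
  rewrite /= in h1 h2 h3 h4; rewrite /B.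
  move: h1 h2 h3 h4.
  move: (\sum_(w <- base) `|w u|)%N (\sum_(w <- base) count_mem w s)%N.
  move: (\sum_(w <- base) \sum_(c <- C) `|w c|)%N (\sum_(c <- C) `|w c|)%N (w ep) we.
  move: (w u) (w c) (count_mem w s) => a b n S1 S2 x x0 S3 S4 h1 h2 h3 h4.
  have x1 : 1 <= x by clear -x0; lia.
  have S0 : 0 <= (S1 + S4 + S3)%N%:Z by [].
  have := ler_peMr S0 x1.
  move: ((S1 + S4 + S3)%N%:Z * x) => X; clear -h1 h2 h3 h4; lia.
clearbody h; clear B sumle.
have incRC r c r' c' : r \in R -> c \in C -> r' \in R -> c' \in C ->
    (forall w, w \in base ->
      pval_ge w (count_mem w (v :: s))%:Z (r + c * h - (r' + c' * h))) ->
    r = r' /\ c = c'.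
  move=> rR cC r'R c'C cong; have rr_card : r = r'.
    apply: incR => // w wb.
    have -> : r - r' = (r + c * h - (r' + c' * h)) - (c * h - c' * h) by ring.
    apply: pgeB; last by apply: pgeB; apply: wh.
    by apply: pge_le (cong _ wb); rewrite lez_nat leq_addl.
  split=> //; apply: incC => //; rewrite /vmax /=.
  have -> : c - c' = (r + c * h - (r' + c' * h)) * h^-1.
    by rewrite rr_card; field.
  have -> : 1 = (count_mem v (v :: s))%:Z + - e%:Z by rewrite /= eqxx PoszD addrK.
  by apply: pgeM; [apply: cong|rewrite -vh -pvalV pge_val].
exists [seq r + c * h | r <- R, c <- C]; split.
- apply: allpairs_uniq => //= -[r c] [r' c'] /allpairsP[[r1 c1] /= [r1R c1C [-> ->]]].
  move=> /allpairsP[[r2 c2] /= [r2R c2C [-> ->]]] eq12.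
  have [|-> ->//] := incRC r1 c1 r2 c2 r1R c1C r2R c2C.
  by move=> w wb; rewrite eq12 subrr pge0.
- by rewrite size_allpairs sR sC /ddeg big_cons -expnD addnC.
- move=> _ w /allpairsP[[r c] /= [rR cC ->]] wb; rewrite pge_int; apply: pgeD.
    by rewrite -pge_int; apply: intR.
  by apply: pge_le (wh _ _ wb cC).
- move=> _ _ /allpairsP[[r c] /= [rR cC ->]] /allpairsP[[r' c'] /= [r'R c'C ->]] cong.
  by have [-> ->] := incRC _ _ _ _ rR cC r'R c'C cong.
Qed.

(** With V the elements integral on [s], relations modulo x bound the Fq-dimension of V/xV by N,
    while the residues prescribed along [s] give Q^deg(s) elements of V that are incongruent modulo
    xV. *)
Lemma zeros_bound x N (s : seq (place F)) : poly_dependent iota x N.+1 -> x != 0 ->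
  (forall v, v \in s -> (count_mem v s)%:Z <= v x) ->
  (card_constants ^ ddeg s <= q ^ N)%N.
Proof.
move=> dep x0 sx; have [R [uR <- intR incR]] := exists_incongruent (fun v (vs : v \in s) => vs).
pose V : set F := [set z | forall v, v \in s -> 0 <= v z].
pose W : set F := [set z | V (z / x)].
have vx v : v \in s -> 0 <= v x by move=> /sx; lia.
have sV : subspace_set kq V.
  split=> [v vs|a b Va Vb v vs|a b [c _ <-] Vb v vs]; rewrite ?pval0 // pge_int.
    by apply: pgeB; rewrite -pge_int; [apply: Va|apply: Vb].
  by rewrite -[0]addr0; apply: pgeM; rewrite -pge_int ?pval_iota //; apply: Vb.
have sW : subspace_set kq W.
  have [V0 VB VM] := sV; rewrite /W; split=> /= [|a b|c a kc]; rewrite ?mul0r //.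
    by rewrite mulrBl; apply: VB.
  by rewrite -mulrA; apply: VM.
have [|d [dN [b bP]]] := @exists_basis_mod _ kq V W N image_subfield sV sW.
  move=> w Vw; have [a [g [[i ai] e]]] := poly_dependent_mod w x0 dep.
  exists (fun i => iota (a i)); split; first by move=> j; exists (a j).
    by exists i; rewrite fmorph_eq0.
  rewrite e /W /= [x * _]mulrC mulfK // => v vs; rewrite pge_int.
  apply: pge_sum => j _; rewrite -[0]addr0; apply: pgeM; rewrite -pge_int.
    by apply: pge0_peval; apply: vx.
  exact: Vw.
have [S SP sS] := basis_reps image_subfield sV sW uniq_image image_seq bP.
rewrite size_image in sS; apply: (@leq_trans (q ^ d)); last first.
  by rewrite leq_exp2l ?card_field_gt1.
rewrite -sS; apply: (reps_count sW SP uR) => [r rR v vs|r r' rR r'R Wr].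
  exact: intR.
apply: incR => // v vs.
have -> : r - r' = x * ((r - r') / x) by field.
rewrite -[_%:Z]addr0; apply: pgeM; first by rewrite pgeE // sx.
by rewrite -pge_int; apply: Wr.
Qed.

Lemma ddeg_ge_size s : (size s <= ddeg s)%N.
Proof.
rewrite /ddeg; elim: s => [|v s IH]; first by rewrite big_nil.
by rewrite big_cons /=; have := place_degree_gt0 v; lia.
Qed.

Lemma zeros_finite x : x != 0 -> finite_set [set v : place F | 0 < v x].
Proof.
move=> x0; have [N dep] := fdep x; apply: (@bounded_finite_set _ _ (q ^ N)) => s us sx.
apply: leq_trans (zeros_bound (s := s) dep x0 _); last first.
  by move=> v vs; rewrite count_uniq_mem // vs; have /= := sx v vs; lia.
apply: leq_trans (ddeg_ge_size s) _; apply: ltnW; apply: ltn_expl.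
exact: card_constants_gt1.
Qed.

Lemma pval_finite_support x : x != 0 -> finite_set [set v : place F | v x != 0].
Proof.
move=> x0; apply: (@sub_finite_set _ _ ([set v : place F | 0 < v x] `|`
                                        [set v : place F | 0 < v x^-1])).
  by move=> v /=; rewrite pvalV; lia.
by rewrite finite_setU; split; apply: zeros_finite; rewrite ?invr_eq0.
Qed.
End Residues.

(** * Riemann-Roch spaces *)

(** A Bernoulli estimate: if a > b, then (a/b)^l outgrows the constant [c]. *)
Lemma geometric_dominated a b c :
  (forall l, a ^ l.+1 <= c * b ^ l)%N -> (a <= b)%N.
Proof.
move=> h; rewrite leqNgt; apply/negP => ba.
have step l : (b ^ l * (b + l) <= b * b.+1 ^ l)%N.
  elim: l => [|l IH]; first by rewrite !expn0; lia.
  rewrite !expnS; move: (b ^ l)%N (b.+1 ^ l)%N IH => x z IH.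
  have : (b.+1 * (x * (b + l)) <= b.+1 * (b * z))%N by rewrite leq_mul2l IH orbT.
  by nia.
have [b0|b0] := posnP b; first by have := h 1%N; rewrite b0 expn1 muln0; nia.
have h1 := step (c * b)%N; have h2 := h (c * b)%N.
have h3 : (b.+1 ^ (c * b) <= a ^ (c * b))%N by rewrite leq_exp2r ?muln_gt0 //; lia.
have x0 : (0 < b ^ (c * b))%N by rewrite expn_gt0 b0.
have h4 : (b ^ (c * b) * c.+1 <= b.+1 ^ (c * b))%N.
  by rewrite -(leq_pmul2l b0) mulnCA mulnS [(b * c)%N]mulnC.
have h5 : (a ^ (c * b) <= a ^ (c * b).+1)%N by rewrite leq_exp2l //; lia.
move: h2 h3 h4 h5 x0; clear; rewrite mulnS mulnC; lia.
Qed.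

Section Counting.
Variable T : choiceType.

Lemma exists_multiset (f : T -> nat) : finite_set [set x | f x != 0%N] ->
  exists s : seq T, forall x, count_mem x s = f x.
Proof.
move=> fin; pose S := fset_set [set x | f x != 0%N].
exists (flatten [seq nseq (f x) x | x <- S]) => x.
rewrite count_flatten -map_comp sumnE big_map /=.
under eq_bigr => y _ do rewrite count_nseq /=.
have [xS|xS] := boolP (x \in S).
  rewrite (big_fsetD1 x) //= eqxx mul1n big_seq big1 ?addn0 // => y.
  by rewrite !inE => /andP[/negbTE->].
have -> : f x = 0%N.
  apply/eqP; apply: contraNT xS => fx; rewrite /S in_fset_set // inE; exact: fx.
rewrite big_seq big1 // => y yS; case: eqP => //= e.
by rewrite -e yS in xS.
Qed.
End Counting.

Section RiemannSpaces.
Variables (Fq : finFieldType) (F : fieldType) (iota : {rmorphism Fq -> F}).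
Local Notation q := #|Fq|.
Local Notation k := (constants iota).
Local Notation Q := (card_constants iota).
Local Notation ddeg := (ddeg iota).
Local Notation place := (place F).
Hypothesis fdep : forall x, exists N, poly_dependent iota x N.+1.
Variables (t : F) (t_tr : ~ k t).

Lemma exists_effective (f : place -> nat) : finite_set [set v | f v != 0%N] ->
  exists s : seq place, forall v, count_mem v s = f v.
Proof. exact: (@exists_multiset (place : choiceType)). Qed.

Lemma eq_ddeg (s s' : seq place) :
  (forall v, count_mem v s = count_mem v s') -> ddeg s = ddeg s'.
Proof. by move=> e; apply: perm_big; apply/allP => v _; rewrite /= e. Qed.

Lemma ddeg_cat (s s' : seq place) : ddeg (s ++ s') = (ddeg s + ddeg s')%N.
Proof. by rewrite /ddeg big_cat. Qed.

Definition dmul l (s : seq place) := flatten (nseq l s).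

Lemma count_dmul v l s : count_mem v (dmul l s) = (l * count_mem v s)%N.
Proof. by rewrite /dmul; elim: l => //= l IH; rewrite count_cat IH mulSn. Qed.

Lemma ddeg_dmul l s : ddeg (dmul l s) = (l * ddeg s)%N.
Proof. by rewrite /dmul; elim: l => [|l IH] /=; rewrite ?ddeg_cat ?IH // /ddeg big_nil. Qed.

Definition dcount (s : seq place) : place -> int := fun v => (count_mem v s)%:Z.

Definition rr_space (D : place -> int) : set F := [set x | forall v, pval_ge v (- D v) x].
(** An infinite space would get the value 0, since [fset_set] sends infinite sets to the empty one;
    hence the finiteness hypotheses below. *)
Definition rr_card D : nat := #|` fset_set (rr_space D)|.

Lemma size_rr_space D s : finite_set (rr_space D) -> uniq s -> (forall x, x \in s -> rr_space D x) ->
  (size s <= rr_card D)%N.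
Proof.
move=> fD us sD; apply: uniq_leq_size => // x /sD Dx.
by rewrite in_fset_set ?inE.
Qed.

Lemma rr_space0_finite : finite_set (rr_space (fun=> 0)).
Proof.
apply: sub_finite_set (constants_finite fdep t_tr) => x Dx.
apply: contrapT => /(exists_pole fdep)[v vx].
by have := Dx v; rewrite oppr0 -pge_int leNgt vx.
Qed.

(** L(D + v)/L(D) embeds in the residue field by the residue of [x * u], where [v u = D v + 1].
    Subtracting from [x] a chosen element of [S] with the same residue gives an injection of [S]
    into residues times L(D). *)
Let rr_space_step D v : finite_set (rr_space D) ->
  forall S, uniq S -> (forall x, x \in S -> rr_space (fun w => D w + dcount [:: v] w) x) ->
  (size S <= rr_card D * Q ^ place_degree iota v)%N.
Proof.
move=> fD S uS SD; have [C [uC vC exC incC] sC] := residue_reps fdep t_tr v.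
have [u u0 vu] := pval_uniform v (D v + 1).
have exr x : exists r, x \in S -> r \in C /\ pval_ge v 1 (x * u - r).
  have [xS|] := boolP (x \in S); last by exists 0.
  have [|r rC rx] := exC (x * u); last by exists r.
  rewrite /vring /= pge_int; apply: (pge_le _ (pgeM (SD _ xS v) (pge_val v u))).
  by rewrite vu /dcount /= eqxx; clear; lia.
have [f fP] := choice exr.
have ex0 r : exists x0, (exists2 x, x \in S & f x = r) -> x0 \in S /\ f x0 = r.
  by have [[x xS fx]|h] := pselect (exists2 x, x \in S & f x = r);
    [exists x|exists 0 => /h].
have [g gP] := choice ex0.
have diff x x' : x \in S -> x' \in S -> f x = f x' -> rr_space D (x - x').
  move=> xS x'S e w; have [->|/eqP wv] := eqVneq w v.
    have -> : x - x' = ((x * u - f x) - (x' * u - f x')) * u^-1 by rewrite e; field.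
    have -> : - D v = 1 + v u^-1 by rewrite pvalV vu; ring.
    apply: pgeM; last exact: pge_val.
    by apply: pgeB; [have [] := fP _ xS|have [] := fP _ x'S].
  have e0 : dcount [:: v] w = 0.
    by rewrite /dcount /=; case: eqP => // ev; case: wv.
  have := SD _ xS w; have := SD _ x'S w; rewrite e0 addr0 => h1 h2.
  exact: pgeB.
have gS x : x \in S -> g (f x) \in S /\ f (g (f x)) = f x.
  by move=> xS; apply: gP; exists x.
rewrite -sC mulnC -(size_map (fun x => (f x, x - g (f x)))) /rr_card.
rewrite -(size_allpairs (fun a b => (a, b)) C (enum_fset (fset_set (rr_space D)))).
apply: uniq_leq_size.
  rewrite map_inj_in_uniq // => x x' xS x'S [e].
  by rewrite e => /(congr1 (fun z => z + g (f x'))); rewrite !subrK.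
move=> _ /mapP[x xS ->]; apply/allpairsP; exists (f x, x - g (f x)) => /=.
split=> //; first by have [] := fP _ xS.
have [h1 h2] := gS _ xS.
by rewrite in_fset_set // inE; apply: diff.
Qed.

Lemma rr_space_add D s : finite_set (rr_space D) ->
  finite_set (rr_space (fun v => D v + dcount s v)) /\
  (rr_card (fun v => (D v + dcount s v)%R) <= rr_card D * Q ^ ddeg s)%N.
Proof.
move=> fD; elim: s => [|v s [fs rs]].
  have -> : (fun v => D v + dcount [::] v) = D.
    by apply/funext => v; rewrite /dcount addr0.
  by rewrite /ddeg big_nil expn0 muln1.
have -> : (fun w => D w + dcount (v :: s) w) =
    (fun w => D w + dcount s w + dcount [:: v] w).
  by apply/funext => w; rewrite /dcount /= addn0 PoszD; ring.
have st := @rr_space_step _ v fs; split; first exact: bounded_finite_set st.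
have fin : finite_set (rr_space (fun w => D w + dcount s w + dcount [:: v] w)).
  exact: bounded_finite_set st.
have -> : ddeg (v :: s) = (place_degree iota v + ddeg s)%N by rewrite /ddeg big_cons.
rewrite expnD [(Q ^ _ * _)%N]mulnC mulnA.
apply: (@leq_trans (rr_card (fun w => (D w + dcount s w)%R) * Q ^ place_degree iota v)).
  by apply: st => [|x]; rewrite ?fset_uniq // in_fset_set // inE.
by rewrite leq_mul2r rs orbT.
Qed.

Lemma rr_space_sub_finite D D' : (forall v, D v <= D' v) -> finite_set (rr_space D') ->
  finite_set (rr_space D).
Proof.
move=> DD'; apply: sub_finite_set => x Dx v.
by apply: pge_le (Dx v); rewrite lerN2.
Qed.

Lemma rr_space_effective_finite s : finite_set (rr_space (dcount s)).
Proof.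
have [+ _] := rr_space_add s rr_space0_finite.
by under [fun v => 0 + _]eq_fun do rewrite add0r.
Qed.

Lemma rr_space_diff_finite s s' : finite_set (rr_space (fun v => dcount s v - dcount s' v)).
Proof.
apply: rr_space_sub_finite (rr_space_effective_finite s) => v.
by rewrite gerBl /dcount lez_nat.
Qed.

Definition poly_free x n (u : 'I_n -> F) := forall p : 'I_n -> {poly Fq},
  \sum_i peval iota x (p i) * u i = 0 -> forall i, p i = 0.

Lemma exists_poly_basis x : exists n (u : 'I_n -> F),
  poly_free x u /\ poly_dependent iota x n.+1.
Proof.
pose P n := exists u : 'I_n -> F, poly_free x u.
have [N dep] := fdep x.
have exP : exists n, `[< ~ P n >].
  exists N.+1; apply/asboolP => -[u uf].
  by have [c [[i /eqP ci] e]] := dep u; apply: ci; apply: uf e i.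
case: (ex_minnP exP) => -[|n] /asboolP nP minP.
  by exfalso; apply: nP; exists (fun=> 0) => p _ [].
have /contrapT[u uf] : ~ ~ P n.
  by move=> h; have /minP := introT (asboolP _) h; rewrite ltnn.
exists n, u; split=> // w; apply: contrapT => h; apply: nP; exists w => p e i.
by apply/eqP/negPn/negP => pi; apply: h; exists p; split=> //; exists i.
Qed.

Lemma exists_poles (x : F) : x != 0 ->
  exists s : seq place, forall v, count_mem v s = absz (Num.min 0 (v x)).
Proof.
move=> x0; apply: exists_effective.
apply: sub_finite_set (pval_finite_support fdep t_tr x0) => v /=.
by apply: contraNneq => ->.
Qed.

(** The divisor [c] gathers the poles of the [u i] and does not depend on [l]; a coefficient of
    degree at most [l] in x adds at most [l] times the poles of x. *)
Lemma poly_combinations (x : F) n (u : 'I_n -> F) (s : seq place) : x != 0 -> poly_free x u ->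
  (forall v, count_mem v s = absz (Num.min 0 (v x))) ->
  exists c : seq place, forall l,
    (q ^ (n * l.+1) <= rr_card (fun v => (dcount c v + dcount (dmul l s) v)%R))%N.
Proof.
move=> x0 uf sP.
have u0 i : u i != 0.
  apply/eqP => ui; have /(_ i) : forall j, (fun j => (j == i)%:R) j = 0 :> {poly Fq}.
    apply: uf; rewrite (bigD1 i) //= ui mulr0 add0r big1 // => j /negbTE->.
    by rewrite rmorph0 mul0r.
  by rewrite eqxx => /eqP; rewrite oner_eq0.
have [f fP] := choice (fun i => exists_poles (u0 i)).
pose c := flatten [seq f i | i <- enum 'I_n].
have cu i v : - (count_mem v c)%:Z <= v (u i).
  have : (count_mem v (f i) <= count_mem v c)%N.
    rewrite /c count_flatten -map_comp sumnE big_map big_enum /=.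
    by rewrite (bigD1 i) //= leq_addr.
  by rewrite fP; lia.
exists c => l.
pose val (a : {ffun 'I_n * 'I_l.+1 -> Fq}) :=
  \sum_i peval iota x (\poly_(j < l.+1) a (i, inord j)) * u i.
have inj : injective val.
  move=> a b e; apply/ffunP => -[i j].
  have /(_ i)/eqP : forall i, \poly_(j < l.+1) a (i, inord j) -
      \poly_(j < l.+1) b (i, inord j) = 0 :> {poly Fq}.
    apply: uf; move/eqP: e; rewrite -subr_eq0 /val -sumrB => /eqP e.
    rewrite -[RHS]e; apply: eq_bigr => i' _.
    by rewrite rmorphB /= mulrBl.
  rewrite subr_eq0 => /eqP/polyP/(_ j).
  by rewrite !coef_poly ltn_ord inord_val.
have -> : (q ^ (n * l.+1) = size [seq val a | a <- enum {: {ffun 'I_n * 'I_l.+1 -> Fq}}])%N.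
  by rewrite size_map -cardE card_ffun card_prod !card_ord.
apply: size_rr_space.
- by have [] := rr_space_add (dmul l s) (rr_space_effective_finite c).
- by rewrite map_inj_uniq ?enum_uniq.
move=> _ /mapP[a _ ->] v; apply: pge_sum => i _.
rewrite opprD addrC; apply: pgeM; last first.
  by apply: pge_le (pge_val _ _); rewrite cu.
rewrite pevalE; apply: pge_sum => j _; rewrite -[- _]add0r; apply: pgeM.
  by rewrite -pge_int pval_iota.
apply: pge_le (pge_val _ _); rewrite pvalX /dcount count_dmul sP.
have : (j <= l)%N by rewrite -ltnS; apply: leq_trans (ltn_ord j) (size_poly _ _).
clear; nia.
Qed.
End RiemannSpaces.

(** * Degree of principal divisors and the Riemann inequality *)

Section Riemann.
Variables (Fq : finFieldType) (F : fieldType) (iota : {rmorphism Fq -> F}).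
Local Notation q := #|Fq|.
Local Notation k := (constants iota).
Local Notation Q := (card_constants iota).
Local Notation ddeg := (ddeg iota).
Local Notation place := (place F).
Hypothesis fdep : forall x, exists N, poly_dependent iota x N.+1.
Variables (t : F) (t_tr : ~ k t).

Let Q1 : (1 < Q)%N := card_constants_gt1 fdep t_tr.

Lemma nonconstant_neq0 (x : F) : ~ k x -> x != 0.
Proof. by move=> xk; apply/eqP => x0; apply: xk; rewrite x0; apply: algebraic0. Qed.

(** The q^(n(l+1)) combinations lie in a space of at most |L(c)| Q^(l deg s) elements; letting l
    grow removes the factor |L(c)|. *)
Lemma poly_free_poles (x : F) n (u : 'I_n -> F) (s : seq place) : x != 0 ->
  poly_free iota x u -> (forall v, count_mem v s = absz (Num.min 0 (v x))) ->
  (q ^ n <= Q ^ ddeg s)%N.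
Proof.
move=> x0 uf sP; have [c cP] := poly_combinations fdep t_tr x0 uf sP.
apply: (@geometric_dominated _ _ (rr_card (dcount c))) => l.
rewrite -!expnM (leq_trans (cP l)) // mulnC -[(ddeg s * l)%N]mulnC -ddeg_dmul mulnC.
by have [_] := rr_space_add fdep t_tr (dmul l s) (rr_space_effective_finite fdep t_tr c).
Qed.

Lemma exists_zeros (x : F) : x != 0 ->
  exists s : seq place, forall v, count_mem v s = absz (Num.max 0 (v x)).
Proof.
move=> x0; have [|s sP] := @exists_poles _ _ _ fdep _ t_tr x^-1.
  by rewrite invr_eq0.
by exists s => v; rewrite sP pvalV; lia.
Qed.

Let zeros_le_poles (x : F) (z p : seq place) : ~ k x ->
  (forall v, count_mem v z = absz (Num.max 0 (v x))) ->
  (forall v, count_mem v p = absz (Num.min 0 (v x))) -> (ddeg z <= ddeg p)%N.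
Proof.
move=> xk zP pP; have x0 := nonconstant_neq0 xk.
have [n [u [uf dep]]] := exists_poly_basis fdep x.
rewrite -(leq_exp2l (m := Q)) //; apply: leq_trans (poly_free_poles x0 uf pP).
apply: (zeros_bound fdep t_tr dep x0) => v vz.
have : (0 < count_mem v z)%N by rewrite -has_count has_pred1.
by rewrite zP; clear; lia.
Qed.

Let zeros_eq_poles (x : F) (z p : seq place) : x != 0 ->
  (forall v, count_mem v z = absz (Num.max 0 (v x))) ->
  (forall v, count_mem v p = absz (Num.min 0 (v x))) -> ddeg z = ddeg p.
Proof.
move=> x0 zP pP; have [kx|xk] := pselect (k x).
  by apply: eq_ddeg => v; rewrite zP pP (pval_constant _ kx).
apply/eqP; rewrite eqn_leq (zeros_le_poles xk zP pP) /=.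
apply: (@zeros_le_poles x^-1).
- by move=> /algebraic_inv; rewrite invrK.
- by move=> v; rewrite pP pvalV; clear; lia.
- by move=> v; rewrite zP pvalV; clear; lia.
Qed.

Lemma ddeg_principal (x : F) (s1 s2 : seq place) : x != 0 ->
  (forall v : place, v x = (count_mem v s1)%:Z - (count_mem v s2)%:Z) -> ddeg s1 = ddeg s2.
Proof.
move=> x0 e; have [z zP] := exists_zeros x0; have [p pP] := exists_poles fdep t_tr x0.
apply/eqP; rewrite -(eqn_add2r (ddeg p)) -[in X in _ == X](zeros_eq_poles x0 zP pP).
rewrite -!ddeg_cat; apply/eqP/eq_ddeg => v.
by rewrite !count_cat zP pP; have := e v; clear; lia.
Qed.

Lemma rr_principal (z : F) D : z != 0 ->
  finite_set (rr_space (fun v : place => D v + v z)) ->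
  (rr_card D <= rr_card (fun v : place => (D v + v z)%R))%N.
Proof.
move=> z0 fin; have finD : finite_set (rr_space D).
  apply: sub_finite_set (finite_image (fun x => x * z) fin) => x Dx.
  exists (x / z); last by rewrite divfK.
  move=> v; rewrite opprD; apply: pgeM; first exact: Dx.
  by rewrite -pvalV pge_val.
rewrite /rr_card -(size_map (fun x => x / z)); apply: uniq_leq_size.
  rewrite map_inj_uniq ?fset_uniq // => x y /(congr1 (fun w => w * z)).
  by rewrite !divfK.
move=> _ /mapP[x + ->]; rewrite !in_fset_set // !inE => Dx v.
rewrite opprD; apply: pgeM; first exact: Dx.
by rewrite -pvalV pge_val.
Qed.

(* By the pigeonhole principle two powers of t agree in the finite residue field. *)
Lemma exists_vanishing_poly (v : place) : 0 <= v t ->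
  exists2 p : {poly Fq}, p != 0 & pval_ge v 1 (peval iota t p).
Proof.
move=> vt; have [C CP sC] := residue_reps fdep t_tr v.
have pX n : peval iota t 'X^n = t ^+ n by rewrite rmorphXn /= pevalX.
have [inj|] := pselect (forall i j : 'I_(size C).+1, vmax v (t ^+ i - t ^+ j) -> i = j).
  have v1 : ~ vmax v 1 by rewrite /vmax /= pgeE ?oner_neq0 // place1.
  have tinj : injective (fun i : 'I_(size C).+1 => t ^+ i).
    by move=> i j e; apply: inj; rewrite e subrr /vmax /= pge0.
  have := @reps_count _ _ _ _ C [seq t ^+ i | i : 'I_(size C).+1]
    (vmax_subspace iota v) CP.
  rewrite size_map -cardE card_ord ltnn map_inj_uniq ?enum_uniq // => h.
  suff : false by []; apply: h => //.
    by move=> _ /mapP[i _ ->]; rewrite /vring /= pvalX; clear -vt; nia.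
  by move=> _ _ /mapP[i _ ->] /mapP[j _ ->] /inj->.
move=> /existsNP[i /existsNP[j /not_implyP[tij ij]]].
exists ('X^i - 'X^j); last by rewrite rmorphB /= !pX.
rewrite subr_eq0; apply/eqP => /polyP/(_ i); rewrite !coefXn eqxx.
case: eqP => [/val_inj //|_ /eqP]; by rewrite oner_eq0.
Qed.

Lemma peval_neq0 p : p != 0 -> peval iota t p != 0.
Proof.
by move=> p0; apply/eqP => e; apply: t_tr; exists p => //; apply/rootP.
Qed.

(** A large space L(c + l (t)_oo) is carried by a function z into L(s1 + e) with e effective.
    Passing from there to L(s1 - s2) costs at most the factor Q^(deg s2 + deg e), and deg e = l deg
    (t)_oo + deg c - deg s1. *)
Lemma riemann_inequality : exists g : nat, forall s1 s2 : seq place,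
  (Q ^ ddeg s1 <= Q ^ (g + ddeg s2) *
    rr_card (fun v => ((count_mem v s1)%:Z - (count_mem v s2)%:Z)%R))%N.
Proof.
have t0 := nonconstant_neq0 t_tr.
have [n [u [uf dep]]] := exists_poly_basis fdep t.
have [st stP] := exists_poles fdep t_tr t0.
have [zt ztP] := exists_zeros t0.
have [c cP] := poly_combinations fdep t_tr t0 uf stP.
have dst : (Q ^ ddeg st <= q ^ n)%N.
  rewrite -(zeros_eq_poles t0 ztP stP); apply: (zeros_bound fdep t_tr dep t0) => v vz.
  have : (0 < count_mem v zt)%N by rewrite -has_count has_pred1.
  by rewrite ztP; clear; lia.
(* The constant is the degree of the poles of a basis over Fq(t); it is fixed before [s1] and
   [s2]. *)
exists (ddeg c) => s1 s2.
have exf (v : place) : exists p : {poly Fq}, p != 0 /\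
    (0 <= v t -> pval_ge v 1 (peval iota t p)).
  have [/exists_vanishing_poly[p p0 vp]|_] := boolP (0 <= v t); first by exists p.
  by exists 1; rewrite oner_neq0.
have [f fP] := choice exf.
(* A polynomial in t that vanishes at least to the order [s1] wherever t is integral. The remaining
   places are poles of t, where a large l compensates. *)
pose z := peval iota t (\prod_(v <- s1) f v).
have z0 : z != 0.
  apply: peval_neq0; rewrite prodf_seq_neq0; apply/allP => v _ /=.
  by have [] := fP v.
have zs1 (v : place) : 0 <= v t -> (count_mem v s1)%:Z <= v z.
  move=> vt; rewrite /z; elim: (s1) => [|w s IH].
    by rewrite big_nil rmorph1 place1.
  have fw : peval iota t (f w) != 0 by apply: peval_neq0; have [] := fP w.
  have fs : peval iota t (\prod_(j <- s) f j) != 0.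
    apply: peval_neq0; rewrite prodf_seq_neq0; apply/allP => v' _ /=.
    by have [] := fP v'.
  rewrite big_cons rmorphM pvalM //= PoszD; apply: lerD => //.
  have [->|_] := eqVneq w v; last exact: pge0_peval.
  by have [_ /(_ vt)] := fP v; rewrite pgeE //; apply: peval_neq0; have [] := fP v.
have [zz zzP] := exists_zeros z0; have [zp zpP] := exists_poles fdep t_tr z0.
have dz := zeros_eq_poles z0 zzP zpP.
pose l := (\sum_(v <- st) (count_mem v s1 + absz (v z)))%N.
have lP (v : place) : v \in st -> (count_mem v s1 + absz (v z) <= l)%N.
  rewrite /l; elim: (st) => // w s IH; rewrite inE big_cons => /orP[/eqP->|/IH h].
    exact: leq_addr.
  exact: leq_trans h (leq_addl _ _).
(* The multiplicity of l (t)_oo + c + div z - s1. The subtraction is truncated; [efE] shows that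
   nothing is lost. *)
pose ef (v : place) :=
  (count_mem v (dmul l st) + count_mem v c + count_mem v zz - count_mem v s1
   - count_mem v zp)%N.
have efE v : (ef v + count_mem v s1 + count_mem v zp =
    count_mem v (dmul l st) + count_mem v c + count_mem v zz)%N.
  rewrite /ef count_dmul.
  have h : (count_mem v s1)%:Z <= (l * count_mem v st)%N%:Z + v z.
    have [/zs1|vt] := boolP (0 <= v t).
      by clear; move: (l * _)%N; lia.
    have vst : (0 < count_mem v st)%N by rewrite stP; move: vt; clear; lia.
    have := lP v; rewrite -has_pred1 has_count => /(_ vst).
    by move: vst; clear; nia.
  move: h (zzP v) (zpP v); clear.
  by move: (l * _)%N; lia.
have [e eP] : exists e : seq place, forall v, count_mem v e = ef v.
  apply: exists_effective.
  apply: (@sub_finite_set _ _ [set` (dmul l st ++ c ++ zz)]); last exact: finite_seq.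
  move=> v /=; rewrite -lt0n => efv; rewrite -has_pred1 has_count !count_cat.
  by apply: leq_trans efv _; rewrite /ef; clear; lia.
have dE : (ddeg e + ddeg s1 + ddeg zp = l * ddeg st + ddeg c + ddeg zz)%N.
  rewrite -ddeg_dmul -!ddeg_cat; apply: eq_ddeg => v.
  by rewrite !count_cat eP efE.
have fin12 := rr_space_diff_finite fdep t_tr s1 s2.
have [fin1 le1] := rr_space_add fdep t_tr (s2 ++ e) fin12.
have divE : (fun v : place => dcount s1 v - dcount s2 v + dcount (s2 ++ e) v) =
    (fun v : place => (dcount c v + dcount (dmul l st) v) + v z).
  apply/funext => v; rewrite /dcount count_cat eP.
  by move: (efE v) (zzP v) (zpP v); clear; lia.
rewrite divE in fin1 le1.
have le2 := leq_trans (rr_principal z0 fin1) le1.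
have le3 := leq_trans (cP l) le2.
have le4 : (Q ^ (l * ddeg st) <= q ^ (n * l.+1))%N.
  rewrite mulnC expnM; apply: (@leq_trans ((q ^ n) ^ l)); first by case: (l) => // l'; rewrite leq_exp2r.
  by rewrite -expnM leq_exp2l ?card_field_gt1 // leq_mul2l leqnSn orbT.
have le5 := leq_trans le4 le3.
rewrite -(leq_pmul2l (m := Q ^ ddeg e)) ?expn_gt0 ?(ltnW Q1) //.
have : (ddeg e + ddeg s1 = l * ddeg st + ddeg c)%N by move: dE dz; clear; lia.
rewrite -expnD => ->; rewrite expnD.
apply: (@leq_trans (rr_card (fun v => (dcount s1 v - dcount s2 v)%R) * Q ^ ddeg (s2 ++ e) * Q ^ ddeg c)).
  by rewrite leq_mul2r le5 orbT.
rewrite ddeg_cat !expnD; apply: eq_leq.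
rewrite -/(rr_card (fun v => (dcount s1 v - dcount s2 v)%R)); move: (rr_card _) => X.
move: (Q ^ _)%N (Q ^ _)%N (Q ^ _)%N => x y z'; clear; nia.
Qed.
End Riemann.

(** * Additive polynomials *)

Section AdditivePolynomials.
Variables (Fq : finFieldType) (F : fieldType) (iota : {rmorphism Fq -> F}).
Local Notation q := #|Fq|.

Lemma coef_poly_XaY (P : {poly F}) a b :
  (poly_XaY P)`_a`_b = P`_(a + b) *+ 'C(a + b, b).
Proof.
rewrite /poly_XaY coef_comp_poly coef_sum.
have term i : ((P^:P)`_i * (('X + 'Y) ^+ i)`_a)`_b =
    if i == (a + b)%N then P`_i *+ 'C(i, b) else 0.
  rewrite coef_map /= mul_polyC coefZ exprDn coef_sum coef_sum.
  have tj (j : 'I_i.+1) : (('X ^+ (i - j) * 'Y ^+ j *+ 'C(i, j) : {poly {poly F}})`_a)`_b =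
      if (j == b :> nat) && (i == a + b)%N then 'C(i, b)%:R else 0.
    rewrite !coefMn -polyC_exp coefMC coefXn -[(_ == _)%:R]polyC_natr mul_polyC.
    rewrite coefZ coefXn; have := ltn_ord j; rewrite ltnS => ji.
    have [->|jb] := eqVneq (b : nat) j; last by rewrite mulr0 mul0rn.
    have -> : (a == i - j)%N = (i == a + j)%N by clear -ji; lia.
    by case: eqP => _; rewrite ?mul0r ?mul0rn // mulr1.
  rewrite (eq_bigr _ (fun j _ => tj j)); have [e|ne] := eqVneq i (a + b)%N.
    have lb : (b < i.+1)%N by rewrite e; clear; lia.
    rewrite (bigD1 (Ordinal lb)) //= eqxx big1 ?addr0 ?mulr_natr // => j jb.
    by case: eqP => // ejb; case/eqP: jb; apply: val_inj.
  by rewrite big1 ?mulr0 // => j _; rewrite andbF.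
under eq_bigr => i _ do rewrite term.
have [lt|ge] := ltnP (a + b)%N (size P^:P).
  rewrite (bigD1 (Ordinal lt)) //= eqxx big1 ?addr0 // => i /eqP ne.
  by case: eqP => // e; case: ne; apply: val_inj.
rewrite nth_default ?mul0rn; last by move: ge; rewrite size_map_polyC.
by apply: big1 => i _; case: eqP => // e; move: (ltn_ord i) ge; rewrite e ltnNge => /negP.
Qed.

Lemma additive_coef_binomial (P : {poly F}) a b : additive_poly P ->
  (0 < a)%N -> (0 < b)%N -> P`_(a + b) *+ 'C(a + b, b) = 0.
Proof.
move=> aP a0 b0; rewrite -coef_poly_XaY aP coefD coefC coef_map /= coefD coefC.
by rewrite (gtn_eqF a0) (gtn_eqF b0) coef0 addr0.
Qed.

(** Compare the coefficients of X^(p^k) in (1 + X)^(p^k m) = (1 + X^(p^k))^m. *)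
Lemma bin_pchar p k m : p \in [pchar F] -> (1 < m)%N ->
  ('C(p ^ k * m, p ^ k))%:R = m%:R :> F.
Proof.
move=> pF m1; have p0 : (0 < p ^ k)%N by rewrite expn_gt0 prime_gt0 // (pcharf_prime pF).
have e : (1 + 'X) ^+ (p ^ k * m) = (1 + 'X^(p ^ k)) ^+ m :> {poly F}.
  rewrite exprM exprDn_pchar ?expr1n // (eq_pnat _ (pchar_poly _)).
  by rewrite (eq_pnat _ (pcharf_eq pF)) pnatX pnat_id ?(pcharf_prime pF).
have := congr1 (fun P : {poly F} => P`_(p ^ k)) e; rewrite /= !exprDn !coef_sum.
have lt1 : (p ^ k < (p ^ k * m).+1)%N by rewrite ltnS leq_pmulr // ltnW.
have lt2 : (1 < m.+1)%N by rewrite ltnS ltnW.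
rewrite (bigD1 (Ordinal lt1)) //= expr1n mul1r coefMn coefXn eqxx big1 ?addr0; last first.
  move=> i ne; rewrite expr1n mul1r coefMn coefXn; case: eqP => [e'|]; last by rewrite mul0rn.
  by case/eqP: ne; apply: val_inj.
rewrite (bigD1 (Ordinal lt2)) //= expr1n mul1r expr1 coefMn coefXn eqxx bin1 big1 ?addr0 //.
move=> i ne; rewrite expr1n mul1r coefMn -exprM coefXn; case: eqP => [e'|]; last by rewrite mul0rn.
case/eqP: ne; apply: val_inj => /=; apply/eqP; move/eqP: e'.
by rewrite -{1}[(p ^ k)%N]muln1 eqn_pmul2l // eq_sym.
Qed.

(** Write i = p^k m with m prime to p. Additivity excludes m > 1, because the binomial coefficient
    of i over p^k is m in F. Commuting with scalars gives c^i = c on Fq, which makes i a power of q.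
    Hence the exponents q^j of [height_j] cover all nonlinear coefficients. *)
Lemma qlinear_coef (P : {poly F}) i : additive_poly P ->
  (forall c, P \Po (iota c *: 'X) = iota c *: P) ->
  (0 < i)%N -> P`_i != 0 -> exists j, i = (q ^ j)%N.
Proof.
move=> aP lin i0 Pi; have [p pp pFq] := finPcharP Fq.
have pF : p \in [pchar F] := rmorph_pchar iota pFq.
have ci (c : Fq) : c ^+ i = c.
  have := congr1 (fun R : {poly F} => R`_i) (lin c).
  have -> : (P \Po (iota c *: 'X))`_i = P`_i * iota c ^+ i.
    rewrite coef_comp_poly.
    have [lt|ge] := ltnP i (size P).
      rewrite (bigD1 (Ordinal lt)) //= exprZn coefZ coefXn eqxx mulr1 big1 ?addr0 //.
      move=> l /eqP ne; rewrite exprZn coefZ coefXn; case: eqP => [e|]; last by rewrite !mulr0.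
      by case: ne; apply: val_inj.
    by rewrite nth_default ?eqxx // in Pi.
  rewrite coefZ mulrC => /(mulIf Pi) /=; rewrite -rmorphXn => e.
  exact: (fmorph_inj iota e).
have [m pm ei] := pfactor_coprime pp i0.
have m1 : m = 1%N.
  apply/eqP; rewrite eqn_leq; apply/andP; split; last by move: i0; rewrite ei; case: (m).
  rewrite leqNgt; apply/negP => m1.
  set k := logn p i in ei.
  have pk0 : (0 < p ^ k)%N by rewrite expn_gt0 prime_gt0.
  have := @additive_coef_binomial P (p ^ k * m - p ^ k) (p ^ k) aP.
  have le : (p ^ k <= p ^ k * m)%N by rewrite leq_pmulr // ltnW.
  rewrite subnK // subn_gt0 -{1}[(p ^ k)%N]muln1 ltn_pmul2l // => /(_ m1 pk0)/eqP.
  rewrite -mulr_natr bin_pchar // mulnC -ei mulf_eq0 (negbTE Pi) /=.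
  by rewrite -(dvdn_pcharf pF) => h; rewrite prime_coprime // h in pm.
rewrite m1 mul1n in ei; move: (logn p i) ei => k ei.
have [f qf f0] : exists2 f, q = (p ^ f)%N & (0 < f)%N.
  exists (logn p q); first exact: card_pprimeChar pFq.
  rewrite lt0n; apply/eqP => e0; have := card_pprimeChar pFq.
  by rewrite e0 expn0 => e1; have := card_field_gt1 Fq; rewrite e1.
have cq e (c : Fq) : c ^+ (q ^ e) = c.
  by elim: e => [|e IH]; rewrite ?expr1 // expnSr exprM IH expf_card.
(* Otherwise X^(p^(k mod f)) - X is nonzero of degree below q and vanishes on all of Fq. *)
have s0 : (k %% f = 0)%N.
  apply/eqP; rewrite -leqn0 leqNgt; apply/negP => s0; have sf := ltn_pmod k f0.
  have cs (c : Fq) : c ^+ (p ^ (k %% f)) = c.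
    rewrite -[RHS]ci ei {2}(divn_eq k f) expnD exprM [(_ * f)%N]mulnC expnM -qf.
    by rewrite cq.
  have ps : (1 < p ^ (k %% f))%N.
    by apply: leq_trans (prime_gt1 pp) _; rewrite -{1}[p]expn1 leq_exp2l ?prime_gt1.
  have sz : size ('X^(p ^ (k %% f)) - 'X : {poly Fq}) = (p ^ (k %% f)).+1.
    by rewrite size_polyDl ?size_polyXn // size_polyN size_polyX ltnS.
  have nz : 'X^(p ^ (k %% f)) - 'X != 0 :> {poly Fq} by rewrite -size_poly_eq0 sz.
  have := @max_poly_roots _ _ (enum Fq) nz.
  rewrite sz -cardE enum_uniq => /(_ _ isT); rewrite qf ltnS leq_exp2l ?prime_gt1 // leqNgt sf.
  suff al : all (root ('X^(p ^ (k %% f)) - 'X)) (enum Fq) by move=> /(_ al).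
  by apply/allP => c _; rewrite /root !hornerE cs subrr.
exists (k %/ f)%N; rewrite ei {1}(divn_eq k f) s0 addn0 mulnC expnM -qf //.
Qed.
End AdditivePolynomials.

(** * The ring A *)

Section FunctionField.
Variables (Fq : finFieldType) (K : fieldType) (iota : {rmorphism Fq -> K}).
Local Notation q := #|Fq|.

Section Extension.
Variable L : fieldExtType K.

Definition const_emb : {rmorphism Fq -> L} := in_alg L \o iota.

Lemma peval_ext x p : peval const_emb (in_alg L x) p = in_alg L (peval iota x p).
Proof. by rewrite /peval -[RHS]horner_map /= -map_poly_comp. Qed.

Lemma constants_ext x : constants const_emb (in_alg L x) -> constants iota x.
Proof.
move=> [p p0 /rootP px]; exists p => //; apply/rootP.
have := peval_ext x p; rewrite [LHS]px => /esym/eqP.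
by rewrite fmorph_eq0 => /eqP.
Qed.

Hypothesis hK : is_function_field iota.

Lemma exists_transcendental : exists t : L, ~ constants const_emb t.
Proof.
by have [[t [tr _]] _] := hK; exists (in_alg L t) => /constants_ext.
Qed.

(** Products of generators of K over Fq(t) and a basis of L over K generate L over Fq(t). *)
Lemma ext_poly_dependent x : exists N, poly_dependent const_emb x N.+1.
Proof.
have [[t [t_tr [n [b b_span]]]] _] := hK.
have tK p : peval iota t p = 0 -> p = 0.
  move=> e; apply/eqP/negPn/negP => p0; apply: t_tr; exists p => //.
  by apply/rootP.
have tL p : peval const_emb (in_alg L t) p = 0 -> p = 0.
  by rewrite peval_ext => /eqP; rewrite fmorph_eq0 => /eqP/tK.
pose e := vbasis {:L}; pose I := ('I_n * 'I_(\dim {:L}))%type.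
pose bb (k : 'I_#|{: I}|) := let ij := enum_val k in b ij.1 *: e`_ij.2.
apply: (exists_poly_dependent tL (b := bb)) => y.
have [d [c [d0 cP]]] := common_denominator b_span (fun j => coord e j y).
exists d, (fun k => let ij := enum_val k in c ij.2 ij.1); split=> //.
rewrite peval_ext {1}(coord_vbasis (memvf y)) mulr_sumr.
transitivity (\sum_(ij : I) peval const_emb (in_alg L t) (c ij.2 ij.1) *
    (b ij.1 *: e`_ij.2)).
  rewrite -(pair_bigA _ (fun i j => peval const_emb (in_alg L t) (c j i) *
    (b i *: e`_j))) exchange_big /=; apply: eq_bigr => j _.
  rewrite mulr_algl scalerA cP scaler_suml; apply: eq_bigr => i _.
  by rewrite peval_ext mulr_algl scalerA.
by rewrite (big_enum_val (A := predT)).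
Qed.
End Extension.

Variable infty : place K.
Local Notation A := (regring infty).

Lemma exists_regconst c : exists a : A, regval a = iota c.
Proof.
suff h : iota c \in regular_away infty by exists (Regring h).
by apply/asboolP => v _; rewrite pval_iota.
Qed.

Lemma normA_infinite (a : A) :
  ~ finite_set [set [set b + a * c | c in [set: A]] | b in [set: A]] -> normA a = 0%N.
Proof.
by move=> h; rewrite /normA /fset_set; case: pselect => // _; rewrite cardfs0.
Qed.

(** The quotient A/aA is a vector space over Fq, and a nonzero value of [normA] says that it is
    finite. This makes the truncated logarithm in [degA] exact. *)
Lemma normA_pow (a : A) : normA a != 0%N -> exists d, normA a = (q ^ d)%N.
Proof.
move=> na0; pose co b : set A := [set b + a * c | c in [set: A]].
have fin : finite_set [set co b | b in [set: A]].
  by apply: contrapT => /normA_infinite e; rewrite e in na0.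
pose V : set K := range (@regval K infty).
pose W : set K := [set regval (a * c) | c in [set: A]].
pose kq : set K := [set iota c | c in setT].
have coP b b' : co b = co b' <-> W (regval b - regval b').
  split=> [e|[c _ e]].
    have [c _ ec] : co b' b by rewrite -e; exists 0; rewrite // mulr0 addr0.
    exists c => //; have -> : a * c = b - b' by rewrite -ec addrC addKr.
    by [].
  have eb : b = b' + a * c.
    apply: val_inj; change (regval b = regval b' + regval (a * c)).
    by rewrite e addrC subrK.
  apply/seteqP; split=> _ [d _ <-].
    by exists (c + d); rewrite // mulrDr addrA -eb.
  by exists (d - c); rewrite // eb mulrBr; ring.
have sV : subspace_set kq V.
  split; first by exists 0.
    by move=> _ _ [b _ <-] [c _ <-]; exists (b - c).
  move=> _ _ [c _ <-] [b _ <-]; have [c' <-] := exists_regconst c.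
  by exists (c' * b).
have sW : subspace_set kq W.
  split; first by exists 0; rewrite // mulr0.
    by move=> _ _ [b _ <-] [c _ <-]; exists (b - c); rewrite // mulrBr.
  move=> _ _ [c _ <-] [b _ <-]; have [c' <-] := exists_regconst c.
  by exists (c' * b); rewrite // mulrCA.
(* Among more combinations than cosets two agree modulo aA, and their difference is a relation. *)
have dep : dependent_mod kq V W (normA a).+1.
  move=> w Vw; pose comb (c : {ffun 'I_(normA a).+1 -> Fq}) := \sum_i iota (c i) * w i.
  have exb c : exists b : A, regval b = comb c.
    have [b _ <-] : V (comb c).
      by apply: (subspace_sum _ sV) => i _; have [_ _] := sV; apply=> //; exists (c i).
    by exists b.
  have [f fP] := choice exb.
  have [inj|] := pselect (injective (co \o f)).
    have : (#|{: {ffun 'I_(normA a).+1 -> Fq}}| <= normA a)%N.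
      rewrite cardE -(size_map (co \o f)) /normA; apply: uniq_leq_size.
        by rewrite map_inj_uniq ?enum_uniq.
      by move=> _ /mapP[c _ ->]; rewrite in_fset_set // inE; exists (f c).
    rewrite card_ffun card_ord leqNgt; case/negP.
    by apply: leq_trans (ltn_expl _ (card_field_gt1 Fq)); rewrite ltnS leqnSn.
  move=> /existsNP[c /existsNP[c' /not_implyP[/= /coP]]]; rewrite !fP => Wcc ne.
  exists (fun i => iota (c i - c' i)); split.
  - by move=> i; exists (c i - c' i).
  - apply: contrapT => /forallNP h; apply: ne; apply/ffunP => i.
    by move/negP/negPn: (h i); rewrite fmorph_eq0 subr_eq0 => /eqP.
  - congr W: Wcc; rewrite /comb -sumrB; apply: eq_bigr => i _.
    by rewrite rmorphB mulrBl.
have [d [_ [b bP]]] := exists_basis_mod (image_subfield iota) sV sW dep.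
have kqP x : kq x <-> x \in [seq iota c | c <- enum Fq].
  split=> [[c _ <-]|/mapP[c _ ->]]; last by exists c.
  by apply/mapP; exists c; rewrite ?mem_enum.
have ukq : uniq [seq iota c | c <- enum Fq].
  by rewrite map_inj_uniq ?enum_uniq //; apply: fmorph_inj.
have [s [us Vs exs inj] ss] := basis_reps (image_subfield iota) sV sW ukq kqP bP.
rewrite size_map -cardE in ss; exists d; rewrite -ss /normA.
have exl x : exists y : A, x \in s -> regval y = x.
  have [/Vs[y _ <-]|_] := boolP (x \in s); first by exists y.
  by exists 0.
have [g gP] := choice exl.
rewrite -(size_map (co \o g)); apply/perm_size/uniq_perm.
- exact: fset_uniq.
- rewrite map_inj_in_uniq // => x y xs ys /= /coP.
  by rewrite !gP //; apply: inj.
move=> X; rewrite in_fset_set //; apply/idP/mapP => [|[x xs ->]].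
  rewrite inE => -[y _ <-]; have [|x xs Wx] := exs (regval y); first by exists y.
  by exists x => //=; apply/coP; rewrite gP.
by rewrite inE; exists (g x).
Qed.
End FunctionField.

(** * Drinfeld modules *)

Lemma coef_comp_scaleX (F : fieldType) (P : {poly F}) c i :
  (P \Po (c *: 'X))`_i = P`_i * c ^+ i.
Proof.
rewrite coef_comp_poly; under eq_bigr => l _ do rewrite exprZn coefZ coefXn.
have [lt|ge] := ltnP i (size P).
  rewrite (bigD1 (Ordinal lt)) //= eqxx mulr1 big1 ?addr0 // => l /eqP ne.
  by case: eqP => [e|]; rewrite ?mulr0 //; case: ne; apply: val_inj.
rewrite [P`_i]nth_default // mul0r big1 // => l _.
by case: eqP => [e|]; rewrite ?mulr0 //; move: (ltn_ord l); rewrite -e ltnNge ge.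
Qed.

Section DrinfeldModule.
Variables (Fq : finFieldType) (K : fieldType) (iota : {rmorphism Fq -> K}).
Variables (infty : place K) (L : fieldExtType K) (r : nat).
Local Notation q := #|Fq|.
Local Notation A := (regring infty).
Local Notation gam := (A_to_L infty L).
Local Notation cemb := (const_emb iota L).
Hypotheses (hK : is_function_field iota) (r0 : (0 < r)%N).
Variables (phi : drinfeld q gam) (rk : has_rank phi r).

Let q1 : (1 < q)%N := card_field_gt1 Fq.

Lemma phi_coef0 a : (phi a)`_0 = 0.
Proof. by rewrite dphi_low // ltnW. Qed.

Lemma phi_coef1 a : (phi a)`_1 = gam a.
Proof. by rewrite dphi_low. Qed.

Lemma gam_regconst a c : regval a = iota c -> gam a = cemb c.
Proof. by move=> e; rewrite /A_to_L /= e. Qed.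

Lemma gam_eq0 a : (gam a == 0) = (a == 0).
Proof. by rewrite fmorph_eq0 -[RHS](inj_eq val_inj). Qed.

(** A constant satisfies a^q = a and composition multiplies degrees, so the degree d of [phi a]
    satisfies d^q = d and is at most 1. *)
Lemma phi_regconst a c : regval a = iota c -> phi a = gam a *: 'X.
Proof.
move=> e; have aq : a ^+ q = a.
  apply: val_inj; rewrite rmorphXn; change (regval a ^+ q = regval a).
  by rewrite e -rmorphXn /= expf_card.
have dX n : (size (phi (a ^+ n))).-1 = ((size (phi a)).-1 ^ n)%N.
  elim: n => [|n IH]; first by rewrite expr0 dphi1 size_polyX.
  by rewrite exprS dphiM size_comp_poly IH expnS.
have /esym := dX q; rewrite aq => sz.
have s2 : (size (phi a) <= 2)%N.
  move: sz; case: (size (phi a)) => [|[|[|n]]] //= sz.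
  have /eqP : (n.+2 ^ q = n.+2 ^ 1)%N by rewrite expn1.
  by rewrite eqn_exp2l // => /eqP e1; move: q1; rewrite e1.
apply/polyP => -[|[|i]]; rewrite coefZ coefX /= ?mulr1 ?mulr0.
- exact: phi_coef0.
- exact: phi_coef1.
- by rewrite nth_default // (leq_trans s2).
Qed.

Lemma phi_comm a b : phi a \Po phi b = phi b \Po phi a.
Proof. by rewrite -!dphiM mulrC. Qed.

Lemma phi_linear a c : phi a \Po (cemb c *: 'X) = cemb c *: phi a.
Proof.
have [b be] := exists_regconst iota infty c.
by rewrite -(gam_regconst be) -(phi_regconst be) phi_comm (phi_regconst be)
  comp_polyZ comp_polyX.
Qed.

Lemma phi_support a i : (0 < i)%N -> (phi a)`_i != 0 -> exists j, i = (q ^ j)%N.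
Proof.
apply: (@qlinear_coef _ _ cemb); first exact: dphi_additive.
exact: phi_linear.
Qed.

(** An infinite quotient would have [normA a = 0], and the rank would make [phi a] constant, against
    its linear coefficient. *)
Lemma normA_degA (a : A) : a != 0 -> normA a = (q ^ degA q a)%N.
Proof.
move=> a0; have na : normA a != 0%N.
  apply/eqP => na; have := rk a0; rewrite na exp0n // => sz.
  have := phi_coef1 a; rewrite nth_default; last by move: sz; case: size => [|[]].
  by move/esym/eqP; rewrite gam_eq0 (negbTE a0).
have [d e] := normA_pow iota na.
by rewrite /degA e trunc_expnK.
Qed.

Lemma size_phi (a : A) : a != 0 -> size (phi a) = (q ^ (r * degA q a)).+1.
Proof.
move=> a0; have := rk a0; rewrite normA_degA // -expnM mulnC => sz.
rewrite -sz prednK // lt0n; apply/eqP => s0; move: sz; rewrite s0 /= => /esym/eqP.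
by rewrite expn_eq0 gtn_eqF // ltnW.
Qed.

Lemma phi_neq0 (a : A) : a != 0 -> phi a != 0.
Proof. by move=> a0; rewrite -size_poly_eq0 size_phi. Qed.

Lemma nonconstant_neq0A (S : A) : nonconstant iota S -> S != 0.
Proof.
by move=> nS; apply/eqP => S0; apply: (nS 0); rewrite S0 rmorph0.
Qed.

Lemma nonconstant_transcendental (S : A) :
  nonconstant iota S -> ~ constants cemb (gam S).
Proof.
move=> nS kS; have [_ geo] := hK.
by have [c e] := geo _ (constants_ext kS); apply: (nS c).
Qed.

(** If [phi S] were linear, commuting with it would give (S^i - S) a_i = 0 for each coefficient a_i
    of any [phi a]; as S is transcendental, [phi] would be trivial. *)
Lemma degA_gt0 (S : A) : nonconstant iota S -> (0 < degA q S)%N.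
Proof.
move=> nS; rewrite lt0n; apply/eqP => d0; have S0 := nonconstant_neq0A nS.
have g0 : gam S != 0 by rewrite gam_eq0.
have e : phi S = gam S *: 'X.
  have sz := size_phi S0; rewrite d0 muln0 expn0 in sz.
  apply/polyP => -[|[|i]]; rewrite coefZ coefX /= ?mulr1 ?mulr0.
  - exact: phi_coef0.
  - exact: phi_coef1.
  - by rewrite nth_default // sz.
have [a /eqP na] := dphi_nontrivial phi; apply: na.
apply/polyP => -[|[|i]]; rewrite coefZ coefX /= ?mulr1 ?mulr0.
- exact: phi_coef0.
- exact: phi_coef1.
apply/eqP/negPn/negP => ai; apply: (nonconstant_transcendental nS).
exists ('X^(i.+2) - 'X).
  rewrite subr_eq0; apply/eqP => /polyP/(_ 1%N); rewrite coefXn coefX /= => /esym/eqP.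
  by rewrite oner_eq0.
have := congr1 (fun P : {poly L} => P`_i.+2) (phi_comm a S); rewrite e.
rewrite coef_comp_scaleX comp_polyZ comp_polyX coefZ mulrC => /(mulIf ai) gi.
by apply/rootP; rewrite rmorphB /= map_polyXn map_polyX !hornerE gi subrr.
Qed.

(** The source of the independence of c_v from the chosen element of A. *)
Lemma lead_phi_comm (S S' : A) : nonconstant iota S -> nonconstant iota S' ->
  lead_coef (phi S) * lead_coef (phi S') ^+ (q ^ (r * degA q S)) =
  lead_coef (phi S') * lead_coef (phi S) ^+ (q ^ (r * degA q S')).
Proof.
move=> nS nS'; have [S0 S'0] := (nonconstant_neq0A nS, nonconstant_neq0A nS').
have := congr1 lead_coef (phi_comm S S').
by rewrite !lead_coef_comp !size_phi //= ltnS expn_gt0 ltnW.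
Qed.

Section Generators.
Variables (m : nat) (T : 'I_m -> A).
Hypothesis gen : generates iota T.

Lemma regring_ind (P : A -> Prop) :
  P 1 -> (forall a b, P a -> P b -> P (a - b)) -> (forall a b, P a -> P b -> P (a * b)) ->
  (forall a c, regval a = iota c -> P a) -> (forall i, P (T i)) -> forall a, P a.
Proof.
move=> P1 PB PM Pc PT a.
pose S : {pred A} := fun a => `[< P a >]; suff : a \in S by move=> /asboolP.
apply: gen.
- split; first by apply/asboolP.
    by move=> x y /asboolP Px /asboolP Py; apply/asboolP/PB.
  by move=> x y /asboolP Px /asboolP Py; apply/asboolP/PM.
- by move=> c b /Pc Pb; apply/asboolP.
- by move=> i; apply/asboolP.
Qed.

Lemma exists_generator : exists i : 'I_m, True.
Proof.
apply: contrapT => /forallNP h; have [a /eqP na] := dphi_nontrivial phi; apply: na.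
have [c e] : exists c, regval a = iota c.
  elim/regring_ind: a => [|a b [c ec] [d ed]|a b [c ec] [d ed]|a c e|i].
  - by exists 1; rewrite rmorph1.
  - by exists (c - d); rewrite rmorphB -ec -ed.
  - by exists (c * d); rewrite rmorphM -ec -ed.
  - by exists c.
  - by case: (h i).
exact: phi_regconst e.
Qed.
End Generators.
End DrinfeldModule.

(** * Minimal models *)

(** The coefficientwise form carries additivity over to rescaled modules over the completion. *)
Lemma additive_polyP (F : fieldType) (P : {poly F}) : additive_poly P <->
  P`_0 = 0 /\ forall a b, (0 < a)%N -> (0 < b)%N -> P`_(a + b) *+ 'C(a + b, b) = 0.
Proof.
have E a b : (P%:P + P^:P)`_a`_b = (if a == 0%N then P`_b else 0) +
    (if b == 0%N then P`_a else 0).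
  rewrite coefD coefC coef_map /= coefD coefC; congr (_ + _).
  by case: eqP => _; rewrite ?coef0.
split=> [aP|[P0 PC]].
  split; last by move=> a b a0 b0; rewrite -coef_poly_XaY aP E !gtn_eqF // addr0.
  have := E 0%N 0%N; rewrite -aP coef_poly_XaY bin0 mulr1n /= => h.
  by apply: (addrI P`_0); rewrite addr0 -h.
apply/polyP => a; apply/polyP => b; rewrite coef_poly_XaY E.
case: a b => [|a] [|b] /=; rewrite ?addn0 ?add0n ?bin0 ?binn ?mulr1n ?P0 ?addr0 ?add0r //.
exact: PC.
Qed.

Section IntegralPolynomials.
Variables (F : fieldType) (v : place F).

Definition integral_poly (P : {poly F}) := forall k, pval_ge v 0 P`_k.

Lemma integral_polyB P Q : integral_poly P -> integral_poly Q -> integral_poly (P - Q).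
Proof. by move=> iP iQ k; rewrite coefB; apply: pgeB. Qed.

Lemma integral_polyM P Q : integral_poly P -> integral_poly Q -> integral_poly (P * Q).
Proof.
move=> iP iQ k; rewrite coefM; apply: pge_sum => j _.
by rewrite -[0]addr0; apply: pgeM.
Qed.

Lemma integral_poly_comp P Q :
  integral_poly P -> integral_poly Q -> integral_poly (P \Po Q).
Proof.
move=> iP iQ; have iQX n : integral_poly (Q ^+ n).
  elim: n => [|n IH]; last by rewrite exprS; apply: integral_polyM.
  move=> k; rewrite coefC; case: eqP => _; last exact: pge0.
  by rewrite -pge_int place1.
move=> k; rewrite coef_comp_poly; apply: pge_sum => j _.
by rewrite -[0]addr0; apply: pgeM; [exact: iP|exact: iQX].
Qed.
End IntegralPolynomials.

Lemma pval_mulX (F : fieldType) (v : place F) (x y : F) m n :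
  x != 0 -> y != 0 -> x * y ^+ m = y * x ^+ n ->
  v x + m%:Z * v y = v y + n%:Z * v x.
Proof.
by move=> x0 y0 /(congr1 v); rewrite !pvalM ?expf_neq0 // !pvalX.
Qed.

Lemma local_disc_indep_aux (R : realType) (d : R) (x y : nat) (a b : int) :
  a + x%:Z * b = b + y%:Z * a -> 1 < x%:R :> R -> 1 < y%:R :> R ->
  d * a%:~R / (x%:R - 1) = d * b%:~R / (y%:R - 1) :> R.
Proof.
move=> e1 g g'; rewrite -!mulrA; congr (_ * _); move: e1.
move/(congr1 (fun z : int => z%:~R : R)).
rewrite !intrD !intrM -!pmulrn => e.
have x1 : x%:R - 1 != 0 :> R by rewrite subr_eq0 gt_eqF.
have y1 : y%:R - 1 != 0 :> R by rewrite subr_eq0 gt_eqF.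
apply/eqP; rewrite (eqr_div _ _ x1 y1); apply/eqP.
by move: e; rewrite !mulrBr !mulr1; move: (_%:~R) (_%:~R) => a1 b1; lra.
Qed.

Lemma c_disc_aux (R : realType) (D d : nat) (a n : int) : 1 < D%:R :> R ->
  - (D%:R - 1)^-1 * (- (d%:Z * (a + (D%:Z - 1) * n)))%:~R =
  d%:R * a%:~R / (D%:R - 1) + d%:R * n%:~R :> R.
Proof.
move=> D1; rewrite intrN !intrM intrD intrM intrB -!pmulrn; field.
by rewrite subr_eq0 gt_eqF.
Qed.

Section LocalModels.
Variable R : realType.
Variables (Fq : finFieldType) (K : fieldType) (iota : {rmorphism Fq -> K}).
Variables (infty : place K) (L : fieldExtType K) (r : nat).
Local Notation q := #|Fq|.
Local Notation A := (regring infty).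
Local Notation gam := (A_to_L infty L).
Hypotheses (hK : is_function_field iota) (r0 : (0 < r)%N).
Variables (phi : drinfeld q gam) (rk : has_rank phi r).
Variables (m : nat) (T : 'I_m -> A).
Hypothesis gen : generates iota T.

(** Integrality of u^-1 phi(u x) for [v u = n], on the generators. The truncation of [k.-1] at k = 0
    is harmless, the constant coefficient being 0. *)
Definition scaled_integral (v : place L) (n : int) :=
  forall i k, pval_ge v (- (k.-1)%:Z * n) (phi (T i))`_k.

Lemma dphiB a b : phi (a - b) = phi a - phi b.
Proof. by apply: (addIr (phi b)); rewrite subrK -dphiD subrK. Qed.

(** Conjugation by u respects differences and composition, so integrality spreads from the
    generators to all of A; finiteness of the place covers the constants. *)
Lemma scaled_integral_all v n : finite_places infty v -> scaled_integral v n ->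
  forall a k, pval_ge v (- (k.-1)%:Z * n) (phi a)`_k.
Proof.
move=> fv sc; have [u u0 vu] := pval_uniform v n.
pose sca (P : {poly L}) := u^-1 *: (P \Po (u *: 'X)).
have scaE P k : (sca P)`_k = u^-1 * (P`_k * u ^+ k).
  by rewrite coefZ coef_comp_scaleX.
have scaP (P : {poly L}) : P`_0 = 0 ->
    integral_poly v (sca P) <-> forall k, pval_ge v (- (k.-1)%:Z * n) P`_k.
  move=> P0; split=> iP [|k].
  - by rewrite P0 pge0.
  - have := iP k.+1; rewrite scaE => h.
    have -> : P`_k.+1 = (u^-1 * (P`_k.+1 * u ^+ k.+1)) * (u ^+ k)^-1.
      by rewrite exprS; field; rewrite u0 expf_neq0.
    rewrite -[- _ * n]add0r; apply: pgeM => //.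
    by apply: pge_le (pge_val _ _); rewrite pvalV pvalX vu mulNr.
  - by rewrite scaE P0 mul0r mulr0 pge0.
  - rewrite scaE; have -> : u^-1 * (P`_k.+1 * u ^+ k.+1) = P`_k.+1 * u ^+ k.
      by rewrite exprS; field; rewrite u0.
    have -> : 0 = - (k.+1.-1)%:Z * n + k%:Z * n by rewrite mulNr addNr.
    by apply: pgeM; [exact: iP|rewrite -vu -pvalX pge_val].
have sca_comp P Q : sca (P \Po Q) = sca P \Po sca Q.
  rewrite /sca comp_polyZ; congr (_ *: _).
  rewrite -!comp_polyA; congr (_ \Po _).
  by rewrite comp_polyZ comp_polyX scalerA divff // scale1r.
move=> a; apply/scaP; first exact: phi_coef0.
elim/(regring_ind gen): a => [|a b|a b|a c e|i].
- move=> k; rewrite dphi1 scaE coefX; case: eqP => [->|_]; last by rewrite mul0r mulr0 pge0.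
  by rewrite mul1r expr1 mulVf // -pge_int place1.
- move=> ia ib; rewrite dphiB /sca comp_polyB scalerBr; exact: integral_polyB.
- by rewrite dphiM sca_comp; apply: integral_poly_comp.
- move=> k; rewrite (phi_regconst phi e) scaE coefZ coefX.
  case: eqP => [->|_]; last by rewrite mulr0 mul0r mulr0 pge0.
  by rewrite mulr1 expr1 mulrCA mulVf // mulr1 -pge_int; apply: fv.
- by apply/scaP; [exact: phi_coef0|exact: sc].
Qed.

Definition local_disc (S : A) (v : place L) : R :=
  (pdeg iota v)%:R * (v (lead_coef (phi S)))%:~R / ((q ^ (r * degA q S))%:R - 1).

Lemma qpow_gt1 (S : A) : nonconstant iota S -> 1 < (q ^ (r * degA q S))%:R :> R.
Proof.
move=> nS; rewrite natrX exprn_egt1 ?ltr1n ?card_field_gt1 //.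
by rewrite muln_eq0 negb_or -!lt0n r0 (degA_gt0 hK r0 rk nS).
Qed.

Lemma phi_lead_neq0 (S : A) : S != 0 -> lead_coef (phi S) != 0.
Proof. by move=> S0; rewrite lead_coef_eq0 (phi_neq0 iota r0 rk). Qed.

Lemma local_disc_indep (S S' : A) v : nonconstant iota S -> nonconstant iota S' ->
  local_disc S v = local_disc S' v.
Proof.
move=> nS nS'; have S0 := nonconstant_neq0A nS; have S'0 := nonconstant_neq0A nS'.
have e := pval_mulX v (phi_lead_neq0 S0) (phi_lead_neq0 S'0)
  (lead_phi_comm r0 rk nS nS').
have [g g'] := (qpow_gt1 nS, qpow_gt1 nS').
exact: (local_disc_indep_aux _ e g g').
Qed.

Lemma scaled_lead v n S : finite_places infty v -> nonconstant iota S ->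
  scaled_integral v n ->
  - ((q ^ (r * degA q S))%N%:Z - 1) * n <= v (lead_coef (phi S)).
Proof.
move=> fv nS /(scaled_integral_all fv)/(_ S (size (phi S)).-1).
have S0 := nonconstant_neq0A nS.
rewrite -lead_coefE pgeE ?phi_lead_neq0 //.
rewrite (size_phi iota r0 rk S0) /=; apply: le_trans.
have : (0 < q ^ (r * degA q S))%N by rewrite expn_gt0 ltnW ?card_field_gt1.
by move: (q ^ _)%N => D D0; rewrite le_eqVlt; apply/orP; left; apply/eqP; congr (- _ * _); clear -D0; lia.
Qed.

Hypothesis hTnc : forall i, nonconstant iota (T i).

(** A large n works, since the linear coefficients are integral already, and the leading coefficient
    of one generator bounds n from below. The shift by M turns this into a minimum over natural
    numbers. *)
Lemma exists_min_scaled v : finite_places infty v ->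
  exists n, scaled_integral v n /\ forall n', scaled_integral v n' -> n <= n'.
Proof.
move=> fv.
pose N := (\sum_i \sum_(k < size (phi (T i))) absz (v (phi (T i))`_k)%R)%N.
have scN : scaled_integral v N%:Z.
  move=> i [|[|k]]; rewrite ?(phi_coef0 phi) ?pge0 //.
    by rewrite (phi_coef1 phi) mul0r -pge_int; apply: fv.
  rewrite /pval_ge; apply/orP; case: eqP => [|c0]; [by left|right].
  have lt : (k.+2 < size (phi (T i)))%N.
    by rewrite ltnNge; apply/negP => ge; apply: c0; rewrite nth_default.
  have : (absz (v (phi (T i))`_k.+2)%R <= N)%N.
    apply: (@leq_trans (\sum_(k < size (phi (T i))) absz (v (phi (T i))`_k)%R)%N).
      by rewrite (bigD1 (Ordinal lt)) //= leq_addr.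
    by rewrite /N (bigD1 i) //= leq_addr.
  by move: (v _) N => a N' /=; clear; nia.
have [i0 _] := exists_generator phi gen.
have [M low] : exists M : nat, forall n, scaled_integral v n -> - M%:Z <= n.
  exists `|v (lead_coef (phi (T i0)))|%N => n sn; have := scaled_lead fv (@hTnc i0) sn.
  have : (1 < q ^ (r * degA q (T i0)))%N.
    by rewrite -{1}(expn0 q) ltn_exp2l ?card_field_gt1 // muln_gt0 r0 (degA_gt0 hK r0 rk).
  move: (q ^ _)%N (v _) => D l; clear => D1 h.
  have [|n0] := lerP 0 n; first by lia.
  by nia.
have exP : exists k : nat, `[< scaled_integral v (k%:Z - M%:Z) >].
  by exists (N + M)%N; apply/asboolP; rewrite PoszD addrK.
case: (ex_minnP exP) => k /asboolP sk mink.
exists (k%:Z - M%:Z); split=> // n' sn'; have := low _ sn' => ge.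
have ek : n' = (absz (n' + M%:Z))%:Z - M%:Z by move: ge; clear; lia.
have := mink (absz (n' + M%:Z)).
rewrite -ek => /(_ (introT (asboolP _) sn')); move: ge; clear; lia.
Qed.

Section Completion.
Variables (v : place L) (Lv : completion v).
Local Notation emb := (cemb Lv).
Local Notation w := (cplace Lv).

Lemma model_scaling (psi : A -> {poly Lv}) alpha : alpha != 0 ->
  (forall a, psi a \Po (alpha *: 'X) = alpha *: map_poly emb (phi a)) ->
  [/\ forall a k, (psi a)`_k = alpha * emb (phi a)`_k / alpha ^+ k,
      forall a k, (phi a)`_k != 0 -> w (psi a)`_k = v (phi a)`_k - (k%:Z - 1) * w alpha
    & forall a, size (psi a) = size (phi a)].
Proof.
move=> a0 e; have c a k : (psi a)`_k = alpha * emb (phi a)`_k / alpha ^+ k.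
  have := congr1 (fun P : {poly Lv} => P`_k) (e a).
  rewrite coef_comp_scaleX coefZ coef_map /= => <-.
  by rewrite mulfK // expf_neq0.
split=> // [a k c0|a].
  rewrite c !pvalM ?mulf_neq0 ?invr_eq0 ?expf_neq0 ?fmorph_eq0 //.
  by rewrite pvalV pvalX cplaceE; ring.
have := congr1 (fun P : {poly Lv} => size P) (e a).
have s2 : size (alpha *: 'X) = 2%N by rewrite size_scale // size_polyX.
by rewrite (size_comp_poly2 _ s2) size_scale // size_map_poly.
Qed.

(** Here psi is alpha phi(x / alpha), so conjugation by an element of valuation [n] corresponds to
    [w alpha = - n]. *)
Lemma model_scaled (psi : drinfeld q (A_to_Lv infty Lv)) alpha n : alpha != 0 ->
  (forall a, psi a \Po (alpha *: 'X) = alpha *: map_poly emb (phi a)) ->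
  w alpha = - n -> (forall a i, 0 <= w (psi a)`_i) <->
  forall a k, pval_ge v (- (k.-1)%:Z * n) (phi a)`_k.
Proof.
move=> a0 e wa; have [c wc _] := model_scaling a0 e.
split=> h a k.
  rewrite /pval_ge; case: eqVneq => //= c0; have := h a k; rewrite wc // wa.
  case: k c0 {wc} => [|k]; first by rewrite (phi_coef0 phi) eqxx.
  by move: (v _) => x _ /=; clear; rewrite intS; lia.
have [c0|c0] := eqVneq (phi a)`_k 0.
  by rewrite c c0 rmorph0 mulr0 mul0r pval0.
rewrite wc // wa; have := h a k; rewrite pgeE //.
case: k c0 {wc} => [|k]; first by rewrite (phi_coef0 phi) eqxx.
by move: (v _) => x _ /=; clear; rewrite intS; lia.
Qed.

Lemma model_disc (psi : drinfeld q (A_to_Lv infty Lv)) alpha n S : alpha != 0 ->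
  (forall a, psi a \Po (alpha *: 'X) = alpha *: map_poly emb (phi a)) ->
  w alpha = - n -> nonconstant iota S ->
  c_disc R Fq r (pdeg iota v) w S psi = local_disc S v + (pdeg iota v)%:R * n%:~R.
Proof.
move=> a0 e wa nS; have [c wc sz] := model_scaling a0 e.
have S0 := nonconstant_neq0A nS; have p0 := phi_neq0 iota r0 rk S0.
have l0 : lead_coef (psi S) != 0.
  by rewrite lead_coef_eq0 -size_poly_eq0 sz size_poly_eq0.
have wl : w (lead_coef (psi S)) = v (lead_coef (phi S)) +
    ((q ^ (r * degA q S))%N%:Z - 1) * n.
  rewrite [lead_coef (psi S)]lead_coefE sz wc; last exact: phi_lead_neq0.
  by rewrite -lead_coefE wa mulrN opprK (size_phi iota r0 rk S0) succnK.
rewrite /c_disc /logv (negbTE l0) [fine _]/= wl /local_disc; have := qpow_gt1 nS.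
rewrite -natrX; move: (q ^ _)%N (pdeg _ _) (v _). by move=> D d a D1; exact: (c_disc_aux d a n D1).
Qed.

(** Only the valuation of alpha matters, so alpha may be taken from L itself. *)
Lemma exists_model n : exists (psi : drinfeld q (A_to_Lv infty Lv)) (alpha : Lv),
  [/\ alpha != 0, w alpha = - n
    & forall a, psi a \Po (alpha *: 'X) = alpha *: map_poly emb (phi a)].
Proof.
have [u u0 vu] := pval_uniform v (- n); pose al := emb u.
have al0 : al != 0 by rewrite fmorph_eq0.
pose f a := al *: (map_poly emb (phi a) \Po (al^-1 *: 'X)).
have fc a k : (f a)`_k = al * emb (phi a)`_k / al ^+ k.
  by rewrite coefZ coef_comp_scaleX coef_map exprVn mulrA.
have f_add a : additive_poly (f a).
  apply/additive_polyP; have [P0 PC] := (additive_polyP _).1 (dphi_additive phi a).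
  split=> [|i j i0 j0]; first by rewrite fc P0 rmorph0 mulr0 mul0r.
  rewrite fc -mulrnAl -mulrnAr -rmorphMn /= PC //.
  by rewrite rmorph0 mulr0 mul0r.
have f1 : f 1 = 'X.
  by rewrite /f dphi1 map_polyX comp_polyX scalerA divff // scale1r.
have fD a b : f (a + b) = f a + f b.
  by rewrite /f dphiD rmorphD /= comp_polyD scalerDr.
have fM a b : f (a * b) = f a \Po f b.
  rewrite /f dphiM map_comp_poly comp_polyZ; congr (_ *: _).
  rewrite -!comp_polyA; congr (_ \Po _).
  by rewrite comp_polyZ comp_polyX scalerA mulVf // scale1r.
have flow a i : (i < q)%N -> (f a)`_i = if i == 1%N then A_to_Lv infty Lv a else 0.
  move=> iq; rewrite fc dphi_low //; case: eqP => [->|_].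
    by rewrite expr1 mulrAC divff // mul1r.
  by rewrite rmorph0 mulr0 mul0r.
have fnt : exists a, f a != A_to_Lv infty Lv a *: 'X.
  have [a na] := dphi_nontrivial phi; exists a; apply: contra_neq na => ea.
  apply/polyP => k; apply: (fmorph_inj emb); rewrite coefZ coefX rmorphM /=.
  have := congr1 (fun P : {poly Lv} => P`_k) ea; rewrite fc coefZ coefX.
  case: eqP => [->|_].
    by rewrite expr1 mulrAC divff // mul1r mulr1 => ->; rewrite rmorph1 mulr1.
  rewrite rmorph0 !mulr0 => h; apply: (mulfI al0).
  by apply: (mulIf (invr_neq0 (expf_neq0 k al0))); rewrite h mulr0n rmorph0 !mulr0 mul0r.
exists (Drinfeld f_add f1 fD fM flow fnt), al; split=> [//||a /=].
  by rewrite cplaceE vu.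
rewrite /f comp_polyZ -comp_polyA comp_polyZ comp_polyX scalerA mulVf // scale1r.
by rewrite comp_polyXr.
Qed.

Lemma min_discE n S : finite_places infty v -> nonconstant iota S ->
  scaled_integral v n -> (forall n', scaled_integral v n' -> n <= n') ->
  min_disc R iota r phi Lv S = local_disc S v + (pdeg iota v)%:R * n%:~R.
Proof.
move=> fv nS sn minn; rewrite /min_disc; set X := [set _ | psi in _].
have Xn : X (local_disc S v + (pdeg iota v)%:R * n%:~R) /\
    lbound X (local_disc S v + (pdeg iota v)%:R * n%:~R).
  split.
    have [psi [al [al0 wal e]]] := exists_model n.
    exists psi; last exact: model_disc e wal nS.
    split; first by exists al.
    by apply/(model_scaled al0 e wal); apply: scaled_integral_all.
  move=> _ [psi [[al al0 e] int] <-].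
  have wal : w al = - (- w al) by rewrite opprK.
  rewrite (model_disc al0 e wal nS) lerD2l ler_wpM2l ?ler0n // ler_int.
  apply: minn => i k; exact: ((model_scaled al0 e wal).1 int (T i) k).
case: xgetP => [c -> [Xc lc]|/(_ _ Xn)//].
by apply/eqP; rewrite eq_le; apply/andP; split; [apply: lc (proj1 Xn)|apply: (proj2 Xn) _ Xc].
Qed.
End Completion.
End LocalModels.

(** * Local heights *)

Lemma geometric_small (R : realType) (c rho e : R) : 2 <= rho -> 0 < e ->
  exists N, forall n, (N <= n)%N -> c * rho^-1 ^+ n <= e.
Proof.
move=> rho2 e0; have z1 : `|rho^-1| < 1.
  have r0 : 0 < rho by apply: lt_le_trans rho2.
  rewrite gtr0_norm ?invr_gt0 // invf_lt1 //.
  by apply: lt_le_trans rho2; rewrite ltr1n.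
have /cvgrPdist_le /(_ _ e0) := cvg_geometric c z1.
move=> [N _ NP]; exists N => n Nn; have := NP n Nn.
rewrite /= sub0r normrN; apply: le_trans; exact: ler_norm.
Qed.

Lemma limn_le_geometric (R : realType) (u : nat -> R) (b c rho : R) :
  2 <= rho -> 0 <= b -> (forall n, u n <= b + c * rho^-1 ^+ n) -> limn u <= b.
Proof.
move=> rho2 b0 ub; have [cu|ncu] := pselect (cvgn u); last by rewrite (dvgP ncu).
apply/ler_addgt0Pr => e e0; have [N NP] := geometric_small c rho2 e0.
apply: limr_le => //; exists N => // n /= Nn.
by apply: le_trans (ub n) _; rewrite lerD2l NP.
Qed.

Lemma le_of_pow_le (R : realType) (a b e rho : R) : 2 <= rho ->
  (forall n, rho ^+ n * a <= rho ^+ n * b + e) -> a <= b.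
Proof.
move=> rho2 h; apply/ler_addgt0Pr => d d0.
have [N NP] := geometric_small e rho2 d0.
have r0 : 0 < rho ^+ N by rewrite exprn_gt0 //; apply: lt_le_trans rho2.
have h1 : a <= b + e * rho^-1 ^+ N.
  rewrite -(ler_pM2l r0) mulrDr exprVn [_ * (e / _)]mulrC divfK ?h //.
  by rewrite gt_eqF.
by apply: le_trans h1 _; rewrite lerD2l NP.
Qed.

(** * Growth of polynomials at a place *)

Section PolynomialGrowth.
Variables (F : fieldType) (v : place F).

Definition lpos (y : F) : int := Num.max 0 (- v y).

Lemma lpos_ge0 y : 0 <= lpos y.
Proof. by rewrite /lpos le_max lexx. Qed.

Lemma logv_plusE (R : realType) d y : logv_plus R d v y = d%:R * (lpos y)%:~R.
Proof.
rewrite /logv_plus /logv /lpos; case: eqVneq => [->|_].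
  by rewrite pval0 oppr0 maxxx mulr0 maxeNy.
rewrite -EFin_max /= -mulrN intrM -pmulrn; have [vy|vy] := leP 0 (- v y).
  by rewrite max_r // mulr_ge0 ?ler0n ?ler0z.
by rewrite mulr0 max_l // mulr_ge0_le0 ?ler0n // lerz0 ltW.
Qed.

Lemma poly_growth_le (P : {poly F}) : exists C : nat, forall y,
  lpos P.[y] <= (size P).-1%:Z * lpos y + C%:Z.
Proof.
exists (\sum_(i < size P) absz (v P`_i)%R)%N => y; set C := (\sum_(i < _) _)%N.
rewrite {1}/lpos ge_max; apply/andP; split.
  by have := lpos_ge0 y; clear; nia.
have : pval_ge v (- ((size P).-1%:Z * lpos y + C%:Z)) P.[y].
  rewrite horner_coef; apply: pge_sum => i _.
  have iC : (absz (v P`_i)%R <= C)%N by rewrite /C (bigD1 i) //= leq_addr.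
  rewrite opprD addrC; apply: pgeM; apply: pge_le (pge_val _ _).
    by move: iC; clear; lia.
  rewrite pvalX; have : (i <= (size P).-1)%N by have := ltn_ord i; clear; lia.
  by rewrite /lpos; move: (v y) (size P).-1 (i : nat) => a n j; clear; nia.
have [->|P0] := eqVneq P.[y] 0; last by rewrite pgeE //; clear; lia.
by move=> _; rewrite pval0 oppr0; have := lpos_ge0 y; clear; nia.
Qed.

Lemma poly_growth_ge (P : {poly F}) : (1 < size P)%N -> exists C : nat, forall y,
  (size P).-1%:Z * lpos y <= lpos P.[y] + C%:Z.
Proof.
move=> sP; pose M := (\sum_(i < size P) absz (v P`_i)%R)%N.
(* The leading term dominates as soon as -v(y) > 2M, since coefficient valuations differ by at most
   2M; smaller y are absorbed by the first summand, the leading coefficient by the second. *)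
exists ((size P).-1 * M.*2 + M)%N => y.
have le_M (i : 'I_(size P)) : (absz (v P`_i)%R <= M)%N by rewrite /M (bigD1 i) //= leq_addr.
clearbody M; have [small|big] := lerP (lpos y) (M.*2)%:Z.
  have := lpos_ge0 P.[y]; have := lpos_ge0 y; move: small; clear.
  by move: (size P).-1 M (lpos y) (lpos _) => n M a b; nia.
have yM : v y < - (M.*2)%:Z by move: big; rewrite /lpos; clear; lia.
have y0 : y != 0 by apply/eqP => e; rewrite e pval0 in yM; move: yM; clear; lia.
have P0 : P != 0 by rewrite -size_poly_gt0 ltnW.
pose n := (size P).-1.
have nS : size P = n.+1 by rewrite /n prednK // ltnW.
have nE : (size P).-1 = n by [].
have l0 : P`_n != 0 by rewrite /n -lead_coefE lead_coef_eq0.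
rewrite nE; clearbody n; have ln : (n < size P)%N by rewrite nS.
have hn : P.[y] = P`_n * y ^+ n + \sum_(i < n) P`_i * y ^+ i.
  by rewrite horner_coef nS big_ord_recr /= addrC.
have [||_ vP] := @pval_dom _ v (P`_n * y ^+ n) (\sum_(i < n) P`_i * y ^+ i).
- by rewrite mulf_neq0 // expf_neq0.
- apply: pge_sum => i _; have [->|c0] := eqVneq P`_i 0; first by rewrite mul0r pge0.
  rewrite pgeE ?mulf_neq0 ?expf_neq0 // !pvalM ?expf_neq0 // !pvalX.
  have := le_M (Ordinal ln); have iP : (i < size P)%N by rewrite nS (leq_trans (ltn_ord i)) ?leqnSn.
  have := le_M (Ordinal iP); have := ltn_ord i; rewrite /=.
  move=> h1 h2 h3; clear -h1 h2 h3 yM.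
  by move: (v P`_i) (v P`_n) (v y) (nat_of_ord i) yM h1 h2 h3 => a b c j; nia.
rewrite hn; have := le_M (Ordinal ln); rewrite /= /lpos vP pvalM ?expf_neq0 // pvalX.
move=> h1; clear -h1 yM.
by move: (v P`_n) (v y) yM h1 => a b; nia.
Qed.
End PolynomialGrowth.

Lemma limn_ge0 (R : realType) (u : nat -> R) : (forall n, 0 <= u n) -> 0 <= limn u.
Proof.
move=> u0; have [cu|ncu] := pselect (cvgn u); last by rewrite (dvgP ncu).
by apply: limr_ge => //; exists 0%N.
Qed.

Section LocalHeights.
Variable R : realType.
Variables (Fq : finFieldType) (K : fieldType) (iota : {rmorphism Fq -> K}).
Variables (infty : place K) (L : fieldExtType K) (r : nat).
Local Notation q := #|Fq|.
Local Notation A := (regring infty).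
Local Notation gam := (A_to_L infty L).
Hypotheses (hK : is_function_field iota) (r0 : (0 < r)%N).
Variables (phi : drinfeld q gam) (rk : has_rank phi r).
Variables (m : nat) (T : 'I_m -> A).
Hypothesis gen : generates iota T.
Hypothesis hTnc : forall i, nonconstant iota (T i).

Local Notation deg S := (q ^ (r * degA q S))%N.

Definition local_height_j (v : place L) : R := fine
  (\big[maxe/-oo]_(i < m) \big[maxe/-oo]_(1 <= j < (r * degA q (T i)).+1)
     (((q%:R ^+ j - 1)^-1)%:E * logv R (pdeg iota v) v (phi (T i))`_(q ^ j)))%E.

(** The error at an infinite place; it does not involve phi, which keeps the final constant
    uniform. *)
Definition generator_logp (v : place L) : R :=
  \sum_(i < m) (pdeg iota v)%:R * (lpos v (gam (T i)))%:~R.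

Section Place.
Variable v : place L.
Local Notation d := (pdeg iota v).

Definition coef_height i j : R :=
  ((q ^ j)%:R - 1)^-1 * - (d%:R * (v (phi (T i))`_(q ^ j))%:~R).

Let q1 : (1 < q)%N := card_field_gt1 Fq.

Let den_gt0 j : (0 < j)%N -> 0 < (q ^ j)%:R - 1 :> R.
Proof. by move=> j0; rewrite subr_gt0 ltr1n -{1}(expn0 q) ltn_exp2l. Qed.

Let termE i j : (0 < j)%N ->
  (((q%:R ^+ j - 1)^-1)%:E * logv R d v (phi (T i))`_(q ^ j))%E =
  if (phi (T i))`_(q ^ j) == 0 then -oo%E else (coef_height i j)%:E.
Proof.
move=> j0; rewrite /logv -natrX /coef_height; case: eqP => _.
  by rewrite gt0_muleNy // lte_fin invr_gt0 den_gt0.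
by rewrite -EFinM intrN intrM -pmulrn.
Qed.

Definition in_range i j := [&& (0 < j)%N, (j <= r * degA q (T i))%N
  & (phi (T i))`_(q ^ j) != 0].

Lemma lead_in_range i : in_range i (r * degA q (T i)) /\
  (phi (T i))`_(deg (T i)) = lead_coef (phi (T i)).
Proof.
have T0 := nonconstant_neq0A (@hTnc i).
have l : (phi (T i))`_(deg (T i)) = lead_coef (phi (T i)).
  by rewrite lead_coefE (size_phi iota r0 rk T0) succnK.
split=> //; rewrite /in_range leqnn l (phi_lead_neq0 iota r0 rk T0) muln_gt0 r0.
by rewrite (degA_gt0 hK r0 rk (@hTnc i)).
Qed.

(** The extended maximum is not -oo because leading coefficients are nonzero, so [fine] returns a
    true maximum. *)
Lemma local_height_jP : (exists i j, in_range i j /\ local_height_j v = coef_height i j) /\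
  forall i j, in_range i j -> coef_height i j <= local_height_j v.
Proof.
rewrite /local_height_j; set M := (X in fine X).
have attM : M = -oo%E \/ exists i j, in_range i j /\ M = (coef_height i j)%:E.
  rewrite /M; elim/big_ind: _ => [|x y hx hy|i _]; first by left.
    by rewrite maxEle; case: ifP.
  rewrite big_nat_cond; elim/big_ind: _ => [|x y hx hy|j /andP[/andP[j0 jr] _]].
  - by left.
  - by rewrite maxEle; case: ifP.
  rewrite termE //; case: eqP => [_|/eqP c0]; first by left.
  by right; exists i, j; rewrite /in_range j0 -ltnS jr c0.
have ubM i j : in_range i j -> ((coef_height i j)%:E <= M)%E.
  case/and3P => j0 jr c0; apply: (bigmax_sup i) => //.
  apply: (bigmax_sup_seq _ j) => //; first by rewrite mem_index_iota j0.
  by rewrite termE // (negbTE c0).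
have [i0 _] := exists_generator phi gen.
have [rng0 _] := lead_in_range i0.
case: attM ubM => [->|[i [j [rij ->]]] ub].
  by move=> /(_ _ _ rng0); rewrite leeNy_eq.
split; first by exists i, j.
by move=> i' j' /ub; rewrite lee_fin.
Qed.

(** The leading coefficient of a generator contributes exactly -c_v to the maximum lambda_v. *)
Lemma local_disc_local_height_j_ge0 (S : A) : nonconstant iota S -> 0 <= local_disc R iota r phi S v + local_height_j v.
Proof.
move=> nS; have [i0 _] := exists_generator phi gen.
have [rng0 le0] := lead_in_range i0; have := local_height_jP.2 _ _ rng0.
rewrite (local_disc_indep R hK r0 rk v nS (@hTnc i0)) /coef_height le0 /local_disc.
by rewrite mulrN mulrC -subr_ge0 opprK addrC.
Qed.

Lemma local_height_j_eq0 : (forall i k, (phi (T i))`_k != 0 -> v (phi (T i))`_k = 0) -> local_height_j v = 0.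
Proof.
move=> h; have [[i [j [/and3P[_ _ c0] ->]]] _] := local_height_jP.
by rewrite /coef_height h // mulr0 oppr0 mulr0.
Qed.

(* log^+ of y / alpha where log|alpha| = - local_height_j *)
Definition scaled_logp (y : L) : R :=
  if y == 0 then 0 else Num.max 0 (local_height_j v - d%:R * (v y)%:~R).

Lemma scaled_logp_ge0 y : 0 <= scaled_logp y.
Proof. by rewrite /scaled_logp; case: eqP => // _; rewrite le_max lexx. Qed.

Lemma scaled_logp_ge y : y != 0 -> local_height_j v - d%:R * (v y)%:~R <= scaled_logp y.
Proof. by move=> y0; rewrite /scaled_logp (negbTE y0) le_max lexx orbT. Qed.

Lemma generator_logp_ge0 : 0 <= generator_logp v.
Proof.
by apply: sumr_ge0 => i _; rewrite mulr_ge0 ?ler0n // ler0z lpos_ge0.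
Qed.

Lemma generator_logp_ge i : - (d%:R * (v (gam (T i)))%:~R) <= generator_logp v.
Proof.
rewrite /generator_logp (bigD1 i) //= -[X in X <= _]addr0; apply: lerD; last first.
  by apply: sumr_ge0 => j _; rewrite mulr_ge0 ?ler0n // ler0z lpos_ge0.
by rewrite -mulrN -intrN ler_wpM2l ?ler0n // ler_int /lpos le_max lexx orbT.
Qed.

Lemma pval_horner_term (P : {poly L}) y : P.[y] != 0 ->
  exists k, P`_k * y ^+ k != 0 /\ v (P`_k * y ^+ k) <= v P.[y].
Proof.
move=> P0; apply: contrapT => /forallNP h.
have : pval_ge v (v P.[y] + 1) P.[y].
  rewrite {2}horner_coef; apply: pge_sum => k _; rewrite /pval_ge.
  case: eqP => //= /eqP c0; rewrite leNgt; apply/negP => lt; apply: (h k).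
  by split=> //; rewrite -ltzD1.
by rewrite pgeE //; clear; lia.
Qed.

Lemma deg_ge2 (S : A) : nonconstant iota S -> 2 <= (deg S)%:R :> R.
Proof.
by move=> nS; have := qpow_gt1 R hK r0 rk nS; rewrite ltr1n (ler_nat R 2).
Qed.

(** For k = q^j > 1 the bound log|a_k| <= (k - 1) lambda_v gives |a_k y^k / alpha| <= |y / alpha|^k;
    the linear coefficient T_i accounts for [generator_logp]. No actual alpha is needed, only the
    number lambda_v. *)
Lemma scaled_logp_step i y :
  scaled_logp (phi (T i)).[y] <= (deg (T i))%:R * scaled_logp y + generator_logp v.
Proof.
suff key (D : R) : D = (deg (T i))%:R -> scaled_logp (phi (T i)).[y] <= D * scaled_logp y + generator_logp v.
  exact: key.
move=> eD; have D2 : 2 <= D by rewrite eD; exact: deg_ge2 (@hTnc i).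
have leD k : (k <= deg (T i))%N -> k%:R <= D by rewrite eD ler_nat.
clear eD; have Z0 := scaled_logp_ge0 y; have k0 := generator_logp_ge0; have DZ : scaled_logp y <= D * scaled_logp y by apply: ler_peMl => //; lra.
rewrite {1}/scaled_logp; case: eqVneq => [_|Py0]; first lra.
rewrite ge_max; apply/andP; split; first lra.
have [k [c0 vk]] := pval_horner_term Py0.
have [a0 yk0] : (phi (T i))`_k != 0 /\ y ^+ k != 0.
  by move: c0; rewrite mulf_eq0 negb_or => /andP[].
case: k => [|k] in c0 vk a0 yk0 *; first by rewrite phi_coef0 eqxx in a0.
have y0 : y != 0 by move: yk0; rewrite expf_eq0.
have Zy := scaled_logp_ge y0.
have vR : d%:R * ((v (phi (T i))`_k.+1)%:~R + k.+1%:R * (v y)%:~R)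
    <= d%:R * (v (phi (T i)).[y])%:~R :> R.
  apply: ler_wpM2l; first exact: ler0n.
  by rewrite pmulrn -intrM -intrD ler_int -pvalX -pvalM.
case: k => [|k] in c0 vk a0 yk0 vR *.
  rewrite phi_coef1 mul1r mulrDr in vR; have := generator_logp_ge i; lra.
have [|[|j] e] := phi_support iota _ a0; [by []|by []|].
have rng : in_range i j.+1.
  rewrite /in_range /= -e a0 andbT.
  have := a0; apply: contraNT; rewrite -ltnNge => lt.
  rewrite nth_default // (size_phi iota r0 rk) ?e; last exact: nonconstant_neq0A (@hTnc i).
  by rewrite ltn_exp2l.
have := local_height_jP.2 _ _ rng; rewrite /coef_height -e ler_pdivrMl; last by rewrite e den_gt0.
have kD : k.+2%:R <= D.
  by apply: leD; rewrite e leq_exp2l //; case/and3P: rng.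
have kZ : k.+2%:R * scaled_logp y <= D * scaled_logp y by apply: ler_wpM2r.
have kX : k.+2%:R * (local_height_j v - d%:R * (v y)%:~R) <= k.+2%:R * scaled_logp y by apply: ler_wpM2l.
move: vR kZ kX; rewrite mulrDr; clear -k0.
move: (v _)%:~R (v _)%:~R (v _)%:~R (k.+2%:R : R) (d%:R : R) (scaled_logp y) (local_height_j v) (generator_logp v) k0 => a b c k1 d z l kp k0 h1 h2 h3 h4.
lra.
Qed.
End Place.
End LocalHeights.

Section LocalHeightBounds.
Variable R : realType.
Variables (Fq : finFieldType) (K : fieldType) (iota : {rmorphism Fq -> K}).
Variables (infty : place K) (L : fieldExtType K) (r : nat).
Local Notation q := #|Fq|.
Local Notation A := (regring infty).
Local Notation gam := (A_to_L infty L).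
Hypotheses (hK : is_function_field iota) (r0 : (0 < r)%N).
Variables (phi : drinfeld q gam) (rk : has_rank phi r).
Variables (m : nat) (T : 'I_m -> A).
Hypothesis gen : generates iota T.
Hypothesis hTnc : forall i, nonconstant iota (T i).
Variable v : place L.
Local Notation d := (pdeg iota v).
Local Notation deg S := (q ^ (r * degA q S))%N.
Local Notation scaled_logp := (scaled_logp R iota r phi T v).
Local Notation generator_logp := (generator_logp R iota T v).
Local Notation local_height_j := (local_height_j R iota r phi T v).

Lemma phi_exprS S N : phi (S ^+ N.+1) = phi S \Po phi (S ^+ N).
Proof. by rewrite exprS dphiM. Qed.

Lemma size_phi_exp (S : A) N : S != 0 -> (size (phi (S ^+ N))).-1 = (deg S ^ N)%N.
Proof.
move=> S0; elim: N => [|N IH]; first by rewrite expr0 dphi1 size_polyX.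
by rewrite phi_exprS size_comp_poly IH (size_phi iota r0 rk S0) succnK expnS.
Qed.

(** The subtracted [generator_logp] makes the induction close, by D >= 2. *)
Lemma scaled_logp_iter i (D : R) N y : D = (deg (T i))%:R ->
  scaled_logp (phi (T i ^+ N)).[y] <= D ^+ N * (scaled_logp y + generator_logp) - generator_logp.
Proof.
move=> eD; have D2 : 2 <= D.
  by rewrite eD; exact: (deg_ge2 R hK r0 rk (@hTnc i)).
have st z : scaled_logp (phi (T i)).[z] <= D * scaled_logp z + generator_logp.
  by rewrite eD; exact: (scaled_logp_step R hK r0 rk gen hTnc).
clear eD; elim: N => [|N IH].
  by rewrite expr0 dphi1 hornerX mul1r addrK.
rewrite phi_exprS horner_comp; apply: le_trans (st _) _.
have k0 := generator_logp_ge0 R iota T v; rewrite [D ^+ N.+1]exprS.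
move: (D ^+ N) IH => X IH.
have h1 : D * scaled_logp (phi (T i ^+ N)).[y] <= D * (X * (scaled_logp y + generator_logp) - generator_logp).
  by rewrite ler_wpM2l //; lra.
have h2 : 2 * generator_logp <= D * generator_logp by rewrite ler_wpM2r.
move: h1 h2; rewrite mulrBr mulrA; lra.
Qed.

Lemma lpos_iter i (D : R) : D = (deg (T i))%:R -> exists C : R, 0 <= C /\ forall N y,
  D ^+ N * (lpos v y)%:~R <= (lpos v (phi (T i ^+ N)).[y])%:~R + C * D ^+ N - C.
Proof.
move=> eD; have T0 := nonconstant_neq0A (@hTnc i).
have D2 : 2 <= D by rewrite eD; exact: (deg_ge2 R hK r0 rk (@hTnc i)).
have sz := size_phi iota r0 rk T0.
have [|C CP] := @poly_growth_ge _ v (phi (T i)).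
  by rewrite sz ltnS expn_gt0 ltnW ?card_field_gt1.
have st z : D * (lpos v z)%:~R <= (lpos v (phi (T i)).[z])%:~R + C%:R.
  have := CP z; rewrite sz succnK -(ler_int R) intrD intrM -!pmulrn eD; exact.
exists C%:R; split; first exact: ler0n.
have C0 : 0 <= C%:R :> R by exact: ler0n.
clear eD; elim=> [|N IH] y.
  by rewrite expr0 dphi1 hornerX !mul1r mulr1 addrK.
rewrite phi_exprS horner_comp [D ^+ N.+1]exprS.
have := st (phi (T i ^+ N)).[y]; move: (IH y); move: (D ^+ N) => X h1 h2.
have h3 : D * (X * (lpos v y)%:~R) <=
    D * ((lpos v (phi (T i ^+ N)).[y])%:~R + C%:R * X - C%:R).
  by rewrite ler_wpM2l //; lra.
have h4 : 2 * C%:R <= D * C%:R by rewrite ler_wpM2r.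
move: h2 h3 h4; rewrite mulrBr mulrDr -mulrA; move: (C%:R) (lpos v _)%:~R (lpos v _)%:~R (lpos v _)%:~R.
move=> c a b e; lra.
Qed.

(** The error |lambda_v| depends on phi; it will be divided by D^N. *)
Lemma lpos_le_scaled_logp y : d%:R * (lpos v y)%:~R <= scaled_logp y + `|local_height_j|.
Proof.
have Z0 := scaled_logp_ge0 R iota r phi T v y; have n0 := normr_ge0 local_height_j.
have nl := ler_norm (- local_height_j); rewrite normrN in nl.
have [y0|y0] := eqVneq y 0.
  by rewrite y0 /lpos pval0 oppr0 maxxx mulr0; rewrite y0 in Z0; lra.
have := scaled_logp_ge R iota r phi T v y0.
rewrite /lpos; have [vy|vy] := leP 0 (- v y).
  by rewrite intrN mulrN; lra.
by rewrite mulr0; lra.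
Qed.

(** The values at all [a] are needed, since the local height may be computed with any S. For a
    generator T_i, phi_(T_i^N) commutes with [phi a]: its growth is bounded below at phi_a(x) and
    above at x. Division by D^N removes the constant of the polynomial [phi a], so C does not depend
    on [a]. *)
Lemma lpos_phi_bound : exists C : R, forall a x,
  d%:R * (lpos v (phi a).[x])%:~R <= (size (phi a)).-1%:R * (scaled_logp x + generator_logp) + C.
Proof.
have [i _] := exists_generator phi gen.
suff key (D : R) : D = (deg (T i))%:R -> exists C : R, forall a x,
    d%:R * (lpos v (phi a).[x])%:~R <= (size (phi a)).-1%:R * (scaled_logp x + generator_logp) + C.
  exact: (key _ erefl).
move=> eD; have D2 : 2 <= D by rewrite eD; exact: (deg_ge2 R hK r0 rk (@hTnc i)).
have [C [C0 CP]] := lpos_iter eD; have ZP N y := @scaled_logp_iter i D N y eD.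
clear eD; exists (d%:R * C) => a x; have [Ca CaP] := poly_growth_le v (phi a).
apply: (@le_of_pow_le _ _ _ ((size (phi a)).-1%:R * `|local_height_j| + d%:R * Ca%:R) _ D2) => N.
have com : (phi (T i ^+ N)).[(phi a).[x]] = (phi a).[(phi (T i ^+ N)).[x]].
  by rewrite -!horner_comp -!dphiM mulrC.
have h1 := CP N (phi a).[x]; rewrite com in h1.
have h2 : (lpos v (phi a).[(phi (T i ^+ N)).[x]])%:~R <=
    (size (phi a)).-1%:R * (lpos v (phi (T i ^+ N)).[x])%:~R + Ca%:R :> R.
  have := CaP (phi (T i ^+ N)).[x].
  by rewrite -(ler_int R) intrD intrM -!pmulrn.
have h3 := lpos_le_scaled_logp (phi (T i ^+ N)).[x].
have h4 := ZP N x; have k0 := generator_logp_ge0 R iota T v.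
have d0 : 0 <= d%:R :> R by exact: ler0n.
have s0 : 0 <= (size (phi a)).-1%:R :> R by exact: ler0n.
move: (D ^+ N) h1 h2 h3 h4 k0 d0 s0.
move: ((size (phi a)).-1%:R : R) (d%:R : R) (Ca%:R : R) => s e ca X.
move: (lpos v _)%:~R (lpos v _)%:~R (lpos v _)%:~R (scaled_logp x) (scaled_logp _) generator_logp => p1 p2 p3 z zN k.
clear -C0 => h1 h2 h3 h4 k0 d0 s0.
have g1 : e * (X * p3) <= e * (p2 + C * X - C) by rewrite ler_wpM2l.
have g2 : e * p2 <= e * (s * p1 + ca) by rewrite ler_wpM2l.
have g3 : s * (e * p1) <= s * (zN + `|local_height_j|) by rewrite ler_wpM2l.
have g4 : s * zN <= s * (X * (z + k)) by rewrite ler_wpM2l //; lra.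
have g5 : 0 <= e * C by rewrite mulr_ge0.
lra.
Qed.

Lemma normA_expV (S : A) N : nonconstant iota S ->
  (normA S)%:R ^- (r * N) = (deg S)%:R^-1 ^+ N :> R.
Proof.
move=> nS; rewrite (normA_degA iota r0 rk (nonconstant_neq0A nS)) exprM -natrX.
by rewrite -expnM mulnC exprVn.
Qed.

Lemma local_height_le (S : A) x : nonconstant iota S ->
  local_height R iota r phi S v x <= scaled_logp x + generator_logp.
Proof.
move=> nS; have [C CP] := lpos_phi_bound; have S0 := nonconstant_neq0A nS.
have rho2 := deg_ge2 R hK r0 rk nS.
have Z0 := scaled_logp_ge0 R iota r phi T v x; have k0 := generator_logp_ge0 R iota T v.
apply: (limn_le_geometric (c := C) rho2); first exact: addr_ge0.
move=> N; rewrite normA_expV // logv_plusE.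
have := CP (S ^+ N) x; rewrite (size_phi_exp N S0) natrX.
move: ((deg S)%:R : R) rho2 => rho rho2 h; have rN : 0 < rho ^+ N.
  by rewrite exprn_gt0 //; apply: lt_le_trans rho2.
rewrite -(ler_pM2l rN) exprVn mulVKf ?gt_eqF // mulrDr.
by rewrite [_ * (C / _)]mulrC divfK // gt_eqF.
Qed.

(** From v(a_k) >= -(k - 1) n and v(x) >= n each term a_k x^k has valuation at least n, so all
    values phi_a(x) stay bounded. *)
Lemma local_height_eq0 (S : A) n x : nonconstant iota S -> finite_places infty v ->
  scaled_integral phi T v n -> pval_ge v n x ->
  local_height R iota r phi S v x = 0.
Proof.
move=> nS fv sc nx; have S0 := nonconstant_neq0A nS.
have rho2 := deg_ge2 R hK r0 rk nS.
have int a : pval_ge v n (phi a).[x].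
  rewrite horner_coef; apply: pge_sum => -[[|k] /= lt] _.
    by rewrite phi_coef0 mul0r pge0.
  have := scaled_integral_all gen fv sc a k.+1.
  have xk : pval_ge v (k.+1%:Z * n) (x ^+ k.+1).
    elim: {lt} k => [|k IH]; first by rewrite mul1r expr1.
    by rewrite exprS intS mulrDl mul1r; apply: pgeM.
  move=> h; have := pgeM h xk; congr (pval_ge v _ _).
  by rewrite /= intS; ring.
have bd a : (lpos v (phi a).[x])%:~R <= `|n|%:~R :> R.
  rewrite ler_int; have := int a; rewrite /lpos /pval_ge; case: eqP => [->|_] /=.
    by rewrite pval0; clear; lia.
  by clear; lia.
apply/eqP; rewrite eq_le; apply/andP; split.
  apply: (limn_le_geometric (c := d%:R * `|n|%:~R) rho2) => // N.
  rewrite normA_expV // logv_plusE add0r mulrC ler_wpM2r //.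
  by apply: ler_wpM2l; [exact: ler0n|exact: bd].
apply: limn_ge0 => N; rewrite normA_expV // logv_plusE; apply: mulr_ge0.
  by rewrite exprn_ge0 // invr_ge0; apply: le_trans rho2.
by rewrite mulr_ge0 ?ler0n // ler0z lpos_ge0.
Qed.
End LocalHeightBounds.

(** * Points of small height *)

Lemma fsum_seq (R : realType) (I : choiceType) (X : seq I) (Y : set I) (f : I -> R) :
  uniq X -> (forall i, Y i -> f i != 0 -> i \in X) ->
  \sum_(i \in Y) f i = \sum_(i <- X | i \in Y) f i.
Proof.
move=> uX YX; rewrite fsbig_mkcond.
rewrite -(@fsbig_widen _ _ _ _ [set` X] setT) //; last first.
  move=> i [_ /= iX]; rewrite patchE; case: ifPn => // iY.
  apply/eqP/negPn/negP => fi; apply: iX; apply: YX => //.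
  by rewrite inE in iY.
rewrite -fsbig_seq // [RHS]big_mkcond; apply: eq_bigr => i _.
by rewrite patchE.
Qed.

Definition int_above (R : realType) (y : R) : int := Num.floor y + 1.

Lemma int_aboveP (R : realType) (y : R) :
  y <= (int_above y)%:~R /\ (int_above y)%:~R <= y + 1.
Proof.
rewrite /int_above; split; first by rewrite ltW // floorD1_gt.
by rewrite intrD lerD2r floor_le.
Qed.

Lemma int_above_scaled (R : realType) (d y : R) : 0 < d ->
  y <= d * (int_above (y / d))%:~R /\ d * (int_above (y / d))%:~R <= y + d.
Proof.
move=> d0; have [h1 h2] := int_aboveP (y / d); split.
  by rewrite mulrC -ler_pdivrMr.
have -> : y + d = d * (y / d + 1) by field; rewrite gt_eqF.
by rewrite ler_pM2l.
Qed.

Lemma ddeg_sum (Fq : finFieldType) (F : fieldType) (iota : {rmorphism Fq -> F})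
    (X s : seq (place F)) : uniq X -> {subset s <= X} ->
  (\sum_(v <- X) place_degree iota v * count_mem v s)%N = ddeg iota s.
Proof.
move=> uX; elim: s => [|w s IH] sX.
  by rewrite /ddeg big_nil big1 // => v _; rewrite muln0.
rewrite /ddeg big_cons -/(ddeg iota s) -IH; last first.
  by move=> v vs; apply: sX; rewrite inE vs orbT.
under eq_bigr => v _ do rewrite /= mulnDr.
rewrite big_split /=; congr (_ + _)%N.
have wX : w \in X by apply: sX; rewrite inE eqxx.
rewrite (bigD1_seq w) //= eqxx muln1 big1 ?addn0 // => v vw.
by rewrite eq_sym (negbTE vw) muln0.
Qed.

Section SmallPoint.
Variable R : realType.
Variables (Fq : finFieldType) (K : fieldType) (iota : {rmorphism Fq -> K}).
Variables (infty : place K) (L : fieldExtType K) (r : nat).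
Local Notation q := #|Fq|.
Local Notation A := (regring infty).
Local Notation gam := (A_to_L infty L).
Local Notation cemb := (const_emb iota L).
Local Notation Q := (card_constants cemb).
Hypotheses (hK : is_function_field iota) (r0 : (0 < r)%N).
Variables (m : nat) (T : 'I_m -> A).
Hypothesis gen : generates iota T.
Hypothesis hTnc : forall i, nonconstant iota (T i).

Let fdep (x : L) : exists N, poly_dependent cemb x N.+1.
Proof. exact: ext_poly_dependent hK x. Qed.

Variable t : L.
Hypothesis t_tr : ~ constants cemb t.
Variable g : nat.
Hypothesis gP : forall s1 s2 : seq (place L),
  (Q ^ ddeg cemb s1 <= Q ^ (g + ddeg cemb s2) *
    rr_card (fun v => ((count_mem v s1)%:Z - (count_mem v s2)%:Z)%R))%N.

Local Notation d v := (pdeg iota v).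
Local Notation fin := (finite_places infty (L := L)).
Definition infinite_places : set (place L) := [set v | ~ finite_places infty v].

Lemma pdeg_gt0 (v : place L) : (0 < d v)%N.
Proof. exact: (place_degree_gt0 fdep t_tr). Qed.

Lemma infinite_place_pole (v : place L) : infinite_places v -> exists i, v (gam (T i)) < 0.
Proof.
move=> iv; apply: contrapT => /forallNP h; apply: iv => a.
rewrite pge_int; elim/(regring_ind gen): a => [|a b|a b|a c e|i].
- by rewrite rmorph1 -pge_int place1.
- by rewrite rmorphB; apply: pgeB.
- by rewrite rmorphM -[0]addr0; apply: pgeM.
- by rewrite (gam_regconst L e) -pge_int (pval_iota cemb).
- by rewrite -pge_int leNgt; apply/negP/h.
Qed.

Lemma pole_infinite_place (v : place L) i : v (gam (T i)) < 0 -> infinite_places v.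
Proof. by move=> vi fv; have := fv (T i); rewrite leNgt vi. Qed.

Lemma infinite_places_finite : finite_set infinite_places.
Proof.
apply: (@sub_finite_set _ _ (\bigcup_(i in [set: 'I_m]) [set v : place L | v (gam (T i)) != 0])).
  by move=> v /infinite_place_pole[i vi]; exists i => //=; rewrite lt_eqF.
apply: bigcup_finite; first exact: finite_finset.
move=> i _; apply: (pval_finite_support fdep t_tr).
by rewrite gam_eq0; apply: nonconstant_neq0A (@hTnc i).
Qed.

Variables (phi : drinfeld q gam) (rk : has_rank phi r).
Variables (B : nat) (tors : (torsion phi #<= `I_B)%card).

(** In the error, one d(v) pays for rounding c_v / d(v) up at each infinite place; the other pays
    for rounding the extra multiplicity at [v0]. *)
Lemma exists_small_point : exists x : L, ~ torsion phi x /\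
  forall S : A, nonconstant iota S -> forall Lv : (forall v : place L, completion v),
  canonical_height R iota r phi S x <=
    height_j R iota r phi T + deg_min_disc R iota r phi S Lv +
    (\sum_(v \in infinite_places) (2 * (d v)%:R + generator_logp R iota T v) + (g + B)%:R).
Proof.
have [i0 _] := exists_generator phi gen.
have [v0 v0neg] := exists_pole fdep (nonconstant_transcendental hK (@hTnc i0)).
have v0inf := pole_infinite_place v0neg.
pose cv v := local_disc R iota r phi (T i0) v.
have exn (v : place L) : exists n, fin v -> scaled_integral phi T v n /\
    forall n', scaled_integral phi T v n' -> n <= n'.
  have [fv|nfv] := pselect (fin v); last by exists 0.
  by have [n nP] := exists_min_scaled hK r0 rk gen hTnc fv; exists n.
have [n nP] := choice exn.
have minE S (Lv : forall v : place L, completion v) v : nonconstant iota S -> fin v ->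
    min_disc R iota r phi (Lv v) S = cv v + (d v)%:R * (n v)%:~R.
  move=> nS fv; have [sn mn] := nP _ fv.
  rewrite (min_discE R hK r0 rk gen _ fv nS sn mn).
  by rewrite (local_disc_indep R hK r0 rk v nS (@hTnc i0)).
(* Outside this finite set lambda_v, c_v, n_v and D(v) all vanish, so every sum over places is a sum
   over one list. *)
pose bad : set (place L) := infinite_places `|` \bigcup_(i in [set: 'I_m])
  \bigcup_(k in `I_(size (phi (T i)))) [set v : place L | (phi (T i))`_k != 0 /\ v (phi (T i))`_k != 0].
have bad_fin : finite_set bad.
  rewrite finite_setU; split; first exact: infinite_places_finite.
  apply: bigcup_finite => [|i _]; first exact: finite_finset.
  apply: bigcup_finite => [|k _]; first exact: finite_II.
  have [c0|c0] := eqVneq (phi (T i))`_k 0.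
    by apply: sub_finite_set (finite_set0 _) => v [].
  by apply: sub_finite_set (pval_finite_support fdep t_tr c0) => v [].
pose X : seq (place L) := fset_set bad.
have uX : uniq X by exact: fset_uniq.
have XP v : v \in X <-> bad v by rewrite /X in_fset_set // inE.
have infX v : infinite_places v -> v \in X by move=> iv; apply/XP; left.
have good v : v \notin X -> fin v /\
    forall i k, (phi (T i))`_k != 0 -> v (phi (T i))`_k = 0.
  move=> vX; split.
    by apply: contrapT => nf; move/negP: vX; apply; apply: infX.
  move=> i k c0; apply/eqP/negPn/negP => vk; move/negP: vX; apply; apply/XP; right.
  exists i => //; exists k => //=.
  by rewrite ltnNge; apply: contra c0 => ge; rewrite nth_default.
have lead_i0 : lead_coef (phi (T i0)) != 0.
  exact: (phi_lead_neq0 iota r0 rk (nonconstant_neq0A (@hTnc i0))).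
have good_lead v : v \notin X -> v (lead_coef (phi (T i0))) = 0.
  by move=> /good[_ h]; rewrite lead_coefE h // -lead_coefE.
have good_cv v : v \notin X -> cv v = 0.
  by move=> vX; rewrite /cv /local_disc good_lead // mulr0 mul0r.
have good_n v : v \notin X -> n v = 0.
  move=> vX; have [fv h] := good _ vX; have [sn mn] := nP _ fv.
  have le0 : n v <= 0.
    apply: mn => i k; rewrite mulr0 /pval_ge; case: eqP => //= /eqP c0.
    by rewrite h.
  apply/eqP; rewrite eq_le le0 /=.
  have := scaled_lead r0 rk gen fv (@hTnc i0) sn; rewrite good_lead // mulNr oppr_le0.
  rewrite pmulr_rge0 // subr_gt0 ltz_nat -(ltr_nat R).
  exact: (qpow_gt1 R hK r0 rk (@hTnc i0)).
have good_lam v : v \notin X -> local_height_j R iota r phi T v = 0.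
  by move=> /good[_ h]; apply: (local_height_j_eq0 R hK r0 rk gen hTnc).
pose fb (v : place L) := `[< fin v >].
have finE (v : place L) : (v \in fin) = fb v by apply/idP/asboolP; rewrite inE.
have infE (v : place L) : (v \in infinite_places) = ~~ fb v.
  by apply/idP/idP; rewrite inE /infinite_places /= => h; [apply/asboolP|move/asboolP: h].
have v0fb : fb v0 = false by apply/asboolP.
have v0X : v0 \in X by apply: infX.
have fbX (v : place L) : v \notin X -> fb v by move=> /good[fv _]; apply/asboolP.
pose de : R := \sum_(v <- X | fb v) (cv v + (d v)%:R * (n v)%:~R).
pose H : R := \sum_(v <- X) local_height_j R iota r phi T v.
have discE (S : A) Lv : nonconstant iota S -> deg_min_disc R iota r phi S Lv = de.
  move=> nS; rewrite /deg_min_disc (fsum_seq uX) => [|v fv].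
    rewrite (eq_bigl _ _ finE); apply: eq_bigr => v /asboolP fv; exact: minE.
  apply: contraNT => vX; rewrite minE // good_cv // good_n // mulr0 addr0 //.
have heightE : height_j R iota r phi T = H.
  rewrite /height_j (fsum_seq uX) => [|v _].
    by apply: eq_bigl => v; rewrite in_setT.
  by apply: contraNT => vX; apply/eqP; exact: good_lam.
have sum_cv : \sum_(v <- X) cv v = 0.
  have [z zP] := exists_zeros fdep t_tr lead_i0.
  have [p pP] := exists_poles fdep t_tr lead_i0.
  have vE (v : place L) : v (lead_coef (phi (T i0))) = (count_mem v z)%:Z - (count_mem v p)%:Z.
    by rewrite zP pP; clear; lia.
  have sub (s : seq (place L)) : (forall v : place L, v (lead_coef (phi (T i0))) = 0 ->
      count_mem v s = 0%N) -> {subset s <= X}.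
    move=> h v; apply: contraTT => vX; rewrite -has_pred1 has_count -eqn0Ngt.
    by rewrite h // good_lead.
  have zX : {subset z <= X} by apply: sub => v e; rewrite zP e.
  have pX : {subset p <= X} by apply: sub => v e; rewrite pP e.
  have e := ddeg_principal fdep t_tr lead_i0 vE.
  rewrite -(ddeg_sum cemb uX zX) -(ddeg_sum cemb uX pX) in e.
  rewrite /cv /local_disc -mulr_suml.
  have -> : \sum_(v <- X) (d v)%:R * (v (lead_coef (phi (T i0))))%:~R = 0 :> R.
    have := congr1 (fun k : nat => k%:R : R) e; rewrite /= !natr_sum => /eqP.
    rewrite -subr_eq0 -sumrB => /eqP e'; rewrite -[RHS]e'; apply: eq_bigr => v _.
    by rewrite vE intrB -!pmulrn mulrBr !natrM.
  by rewrite mul0r.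
have dpos (v : place L) : 0 < (d v)%:R :> R by rewrite ltr0n pdeg_gt0.
have nonneg_fin (v : place L) : fb v -> 0 <= cv v + (d v)%:R * (n v)%:~R.
  move=> /asboolP fv; have [sn _] := nP _ fv.
  have := scaled_lead r0 rk gen fv (@hTnc i0) sn.
  have := qpow_gt1 R hK r0 rk (@hTnc i0); rewrite /cv /local_disc.
  move: (q ^ _)%N (v (lead_coef _)) => D l D1.
  rewrite -(ler_int R) intrM intrN intrB -!pmulrn => h.
  have D0 : 0 < D%:R - 1 :> R by rewrite subr_gt0.
  have -> : (d v)%:R * l%:~R / (D%:R - 1) + (d v)%:R * (n v)%:~R =
      (d v)%:R / (D%:R - 1) * (l%:~R + (D%:R - 1) * (n v)%:~R) :> R.
    by field; rewrite gt_eqF.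
  apply: mulr_ge0; first by rewrite divr_ge0 // ltW.
  by rewrite -(opprK (_ * _)) subr_ge0 -mulNr.
have de0 : 0 <= de by apply: sumr_ge0 => v; exact: nonneg_fin.
(* The multiplicity added at [v0] makes up for the finite places, which lower deg D by [de], and
   leaves g + B to spare. *)
pose E := int_above ((de + (g + B)%:R) / (d v0)%:R).
have [E_ge E_le] := int_above_scaled (de + (g + B)%:R) (dpos v0).
rewrite -/E in E_ge E_le; have E0 : 0 <= E%:~R :> R.
  have [+ _] := int_aboveP ((de + (g + B)%:R) / (d v0)%:R); apply: le_trans.
  by rewrite divr_ge0 ?addr_ge0 ?ler0n.
clearbody E.
pose D (v : place L) : int := if fb v then - n v
  else int_above (cv v / (d v)%:R) + (v == v0)%:Z * E.
have suppD f : f 0 = 0%N -> finite_set [set v | f (D v) != 0%N].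
  move=> f0; apply: sub_finite_set bad_fin => v /= fD; apply/XP.
  by apply: contraNT fD => vX; rewrite /D fbX // good_n // oppr0 f0.
have [s1 s1P] := exists_effective (suppD (fun z => absz (Num.max 0 z)) erefl).
have [s2 s2P] := exists_effective (suppD (fun z => absz (Num.min 0 z)) erefl).
have DE v : D v = (count_mem v s1)%:Z - (count_mem v s2)%:Z.
  by rewrite s1P s2P; move: (D v); clear => z; lia.
have subX (s : seq (place L)) : (forall v, D v = 0 -> count_mem v s = 0%N) ->
    {subset s <= X}.
  move=> h v; apply: contraTT => vX; rewrite -has_pred1 has_count -eqn0Ngt.
  by rewrite h // /D fbX // good_n // oppr0.
have s1X : {subset s1 <= X} by apply: subX => v e; rewrite s1P e.
have s2X : {subset s2 <= X} by apply: subX => v e; rewrite s2P e.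
have sum_v0 : \sum_(v <- X) (if v == v0 then (d v0)%:R * E%:~R else 0) =
    (d v0)%:R * E%:~R :> R.
  rewrite (bigD1_seq v0) //= eqxx big1 ?addr0 // => v /negbTE->; exact: erefl.
have inf_bd v := int_above_scaled (cv v) (dpos v).
have v0E v : ((v == v0)%:Z * E)%:~R * (d v)%:R =
    (if v == v0 then (d v0)%:R * E%:~R else 0) :> R.
  by case: eqVneq => [->|_]; rewrite ?mul1r ?mul0r // mulrC.
have degD : (ddeg cemb s2 + (g + B) <= ddeg cemb s1)%N.
  rewrite -(ler_nat R) natrD -lerBrDl.
  have -> : (ddeg cemb s1)%:R - (ddeg cemb s2)%:R =
      \sum_(v <- X) (d v)%:R * (D v)%:~R :> R.
    rewrite -(ddeg_sum cemb uX s1X) -(ddeg_sum cemb uX s2X) !natr_sum -sumrB.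
    by apply: eq_bigr => v _; rewrite DE intrB -!pmulrn mulrBr !natrM.
  apply: (@le_trans _ _ (\sum_(v <- X) (cv v -
      (if fb v then cv v + (d v)%:R * (n v)%:~R else 0) +
      (if v == v0 then (d v0)%:R * E%:~R else 0)))).
    rewrite big_split sum_v0 sumrB sum_cv -big_mkcond /= -/de.
    by move: E_ge; lra.
  apply: ler_sum => v _; rewrite /D; case: ifP => fv.
    have /negbTE-> : v != v0 by apply: contraTneq fv => ->; rewrite v0fb.
    by rewrite intrN; lra.
  have [+ _] := inf_bd v; have := v0E v; rewrite intrD mulrDr [_ * (_ * E)%:~R]mulrC.
  lra.
have Q1 : (1 < Q)%N := card_constants_gt1 fdep t_tr.
(* By Riemann's inequality the surplus g + B leaves at least Q^B > B elements in L(D), too many to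
   be all torsion. *)
have [x Dx xnt] : exists2 x, rr_space D x & ~ torsion phi x.
  apply: contrapT => h; have sub : rr_space D `<=` torsion phi.
    by move=> x Dx; apply: contrapT => nt; apply: h; exists x.
  have := geq_card_fset_set (card_le_trans (subset_card_le sub) tors).
  rewrite leqNgt => /negP; apply; apply: (@leq_trans (Q ^ B)); first exact: ltn_expl.
  have := gP s1 s2; rewrite -/(rr_card _).
  have -> : (fun v : place L => (count_mem v s1)%:Z - (count_mem v s2)%:Z) = D.
    by apply/funext => v; rewrite DE.
  move=> le; have := leq_trans (leq_pexp2l (ltnW Q1) degD) le.
  have -> : (ddeg cemb s2 + (g + B) = g + ddeg cemb s2 + B)%N by rewrite addnCA addnA.
  by rewrite expnD leq_pmul2l // expn_gt0 (ltnW Q1).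
exists x; split=> // S nS Lv; rewrite heightE (discE _ Lv nS).
have localE v : v \notin X -> local_height R iota r phi S v x = 0.
  move=> vX; have [fv _] := good _ vX; have [sn _] := nP _ fv.
  apply: (local_height_eq0 R hK r0 rk gen nS fv sn).
  by have := Dx v; rewrite /D fbX // opprK.
have -> : canonical_height R iota r phi S x =
    \sum_(v <- X) local_height R iota r phi S v x.
  rewrite /canonical_height (fsum_seq uX) => [|v _].
    by apply: eq_bigl => v; rewrite in_setT.
  by apply: contraNT => vX; apply/eqP; exact: localE.
have -> : \sum_(v \in infinite_places) (2 * (d v)%:R + generator_logp R iota T v) =
    \sum_(v <- X | ~~ fb v) (2 * (d v)%:R + generator_logp R iota T v).
  by rewrite (fsum_seq uX) => [|v /infX //]; apply: eq_bigl => v; rewrite infE.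
have d_le : (d v0)%:R <= \sum_(v <- X | ~~ fb v) (d v)%:R :> R.
  rewrite big_mkcond (bigD1_seq v0) //= v0fb /= lerDl; apply: sumr_ge0 => v _.
  by case: ifP.
apply: (@le_trans _ _ (\sum_(v <- X) ((local_height_j R iota r phi T v + cv v) +
    (if ~~ fb v then (d v)%:R + generator_logp R iota T v else 0) +
    (if v == v0 then (d v0)%:R * E%:~R else 0)))); last first.
  rewrite !big_split /= -big_mkcond /= sum_v0 sum_cv -/H !big_split /=.
  rewrite -mulr_sumr.
  move: E_le d_le; move: (\sum_(v <- X | ~~ fb v) (d v)%:R) => s.
  by move: (\sum_(v <- X | ~~ fb v) generator_logp R iota T v) => kp; lra.
apply: ler_sum => v _.
(* This sign lets the finite places, where the local height is 0, and the maximum with 0 in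
   [scaled_logp] be bounded by the same summand. *)
have lc : 0 <= local_height_j R iota r phi T v + cv v.
  by rewrite addrC; exact: (local_disc_local_height_j_ge0 R hK r0 rk gen hTnc v (@hTnc i0)).
case: ifPn => fv; last first.
  rewrite negbK in fv; have /negbTE-> : v != v0.
    by apply: contraTneq fv => ->; rewrite v0fb.
  have fvP : fin v by apply/asboolP.
  have [sn _] := nP _ fvP.
  rewrite (local_height_eq0 R hK r0 rk gen nS fvP sn) ?addr0 //.
  by have := Dx v; rewrite /D fv opprK.
apply: le_trans (local_height_le R hK r0 rk gen hTnc v x nS) _.
rewrite addrAC addrA lerD2r.
have vE : 0 <= (if v == v0 then (d v0)%:R * E%:~R else 0 : R).
  by case: ifP => // _; rewrite mulr_ge0.
have rhs0 : 0 <= local_height_j R iota r phi T v + cv v +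
    (if v == v0 then (d v0)%:R * E%:~R else 0) + (d v)%:R.
  by apply: addr_ge0 (ltW (dpos v)); apply: addr_ge0.
rewrite /scaled_logp; case: eqVneq => [//|x0]; rewrite ge_max rhs0 /=.
have := Dx v; rewrite pgeE // /D (negbTE fv) lerNl => h.
have h1 : (d v)%:R * (- v x)%:~R <=
    (d v)%:R * (int_above (cv v / (d v)%:R) + (v == v0)%:Z * E)%:~R :> R.
  by rewrite ler_wpM2l ?ler_int // ltW.
have h2 := (inf_bd v).2; have h3 := v0E v.
move: h1; rewrite intrN intrD mulrDr [_ * (_ * E)%:~R]mulrC h3 => h1.
move: h1 h2; clear; move: (if _ then _ else _) (_ * (int_above _)%:~R) => a b.
move: ((d v)%:R : R) (local_height_j _ _ _ _ _ _) (cv v) (_%:~R) => e l c z h1 h2; lra.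
Qed.
End SmallPoint.

Theorem theorem1p4 (R : realType) (Fq : finFieldType) (K : fieldType)
  (iota : {rmorphism Fq -> K}) (hK : is_function_field iota)
  (infty : place K) (hinfty : residue_dim (constants iota) infty = 1%N)
  (m : nat) (T : 'I_m -> regring infty)
  (hTnc : forall i, nonconstant iota (T i)) (hTgen : generates iota T)
  (L : fieldExtType K) (r : nat) (hr : (1 <= r)%N)
  (hunif : exists B : nat, forall phi : drinfeld #|Fq| (A_to_L infty L),
      has_rank phi r -> (torsion phi #<= `I_B)%card) :
  exists C : R, forall phi : drinfeld #|Fq| (A_to_L infty L),
    has_rank phi r ->
    exists x : L, ~ torsion phi x /\
      forall S : regring infty, nonconstant iota S ->
      forall Lv : (forall v : place L, completion v),
        canonical_height R iota r phi S x <=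
          2 * Num.max (height_j R iota r phi T)
                      (deg_min_disc R iota r phi S Lv) + C.
Proof.
have [t t_tr] := exists_transcendental L hK.
have fdep (x : L) : exists N, poly_dependent (const_emb iota L) x N.+1.
  exact: ext_poly_dependent hK x.
have [g gP] := riemann_inequality fdep t_tr.
have [B tors] := hunif.
(* Fixed before [phi]: g and the infinite places come from L, and B is the torsion bound for rank
   r. *)
exists (\sum_(v \in infinite_places infty (L := L))
    (2 * (pdeg iota v)%:R + generator_logp R iota T v) + (g + B)%:R) => phi rk.
have [x [xnt xh]] := exists_small_point R hK hr hTgen hTnc t_tr gP rk (tors phi rk).
exists x; split=> // S nS Lv; apply: le_trans (xh S nS Lv) _.
rewrite lerD2r; set a := height_j _ _ _ _ _; set b := deg_min_disc _ _ _ _ _ _.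
have : a <= Num.max a b by rewrite le_max lexx.
have : b <= Num.max a b by rewrite le_max lexx orbT.
clearbody a b; lra.
Qed.
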